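(* Let $0<q<1$, $\kappa=-\frac{2\pi}{\ln q}$, and let $\mu\in\mathbb{C}\setminus(\mathbb{Z}_{\le 0}\oplus\kappa\mathbb{Z}i)$. Let $F(\mu;q,x)=\sum_{n\ge 0}\frac{(q^\mu;q)_n}{n!}(-x)^n$. Then for all $x\in\mathbb{C}$ with $\Re(x)>0$, $$F(\mu;q,x)=\frac{\kappa\,(q^\mu;q)_\infty}{2\pi\,(q;q)_\infty}\Bigl(\frac1x\Bigr)^{\mu}\sum_{n\ge0}\frac{q^{n(n+1)/2}}{(q;q)_n}\,\Psi\Bigl(\mu+n,\frac{\kappa\pi}{2},x^*\Bigr)\Bigl(-\frac1x\Bigr)^n,$$ where $x^*=x^{-\kappa i}=e^{2\pi i\frac{\log x}{\ln q}}$.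
   Context: Notation: $(a;q)_0=1$, $(a;q)_n=\prod_{j=0}^{n-1}(1-aq^j)$, $(a;q)_\infty=\prod_{j\ge0}(1-aq^j)$. For $\Re(x)>0$, $\log x$ is the principal logarithm and $x^\beta=e^{\beta\log x}$. $\mathbb{Z}_{\le0}\oplus\kappa\mathbb{Z}i=\{m+\kappa k i: m\in\mathbb{Z},\ m\le0,\ k\in\mathbb{Z}\}$. For $(u,v)\in\mathbb{C}\times\mathbb{R}$ with $u\notin\mathbb{Z}_{\le0}\oplus\frac{2vi}{\pi}\mathbb{Z}$, $\Psi(u,v,z)$ is the Laurent series $$\Psi(u,v,z)=\sum_{n\in\mathbb{Z}}\Gamma\Bigl(u+\frac{2ivn}{\pi}\Bigr)z^n,$$ which converges on the annulus $e^{-|v|}<|z|<e^{|v|}$. *)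

(* Defs.v *)
From Stdlib Require Import Reals ZArith.
From Coquelicot Require Import Coquelicot.
Open Scope C_scope.

Definition Cexp (z : C) : C :=
  RtoC (exp (Re z)) * (cos (Im z), sin (Im z)).

(* Principal logarithm, meaningful for [0 < Re z] only: there the principal
   argument is [atan (Im z / Re z)]. *)
Definition Clog (z : C) : C := (ln (Cmod z), atan (Im z / Re z)).

(* [z^b], likewise for [0 < Re z]. *)
Definition Cpower (z b : C) : C := Cexp (b * Clog z).

Definition Czpow (z : C) (n : Z) : C :=
  match n with
  | Z0 => 1
  | Zpos p => z ^ Pos.to_nat p
  | Zneg p => / z ^ Pos.to_nat p
  end.

(* Limits and sums in C, componentwise; the values are meaningful when the
   sequence, resp. the series, converges. *)
Definition CLim_seq (u : nat -> C) : C :=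
  (real (Lim_seq (fun n => Re (u n))), real (Lim_seq (fun n => Im (u n)))).

Definition ex_Cseries (a : nat -> C) : Prop :=
  ex_series (K := C_AbsRing) (V := C_NormedModule) a.

Definition CSeries (a : nat -> C) : C :=
  (Series (fun n => Re (a n)), Series (fun n => Im (a n))).

(* A series over Z converges when its two halves do, as for Laurent series. *)
Definition ex_Zseries (a : Z -> C) : Prop :=
  ex_Cseries (fun n => a (Z.of_nat n)) /\
  ex_Cseries (fun n => a (- Z.of_nat (S n))%Z).

Definition ZSeries (a : Z -> C) : C :=
  CSeries (fun n => a (Z.of_nat n)) +
  CSeries (fun n => a (- Z.of_nat (S n))%Z).

Fixpoint qpoch (a q : C) (n : nat) : C :=
  match n with
  | O => 1
  | S m => qpoch a q m * (1 - a * q ^ m)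
  end.

Definition qpoch_inf (a q : C) : C := CLim_seq (qpoch a q).

(* Euler's integral, over (0, +oo); it converges for [0 < Re s]. *)
Definition Gamma_integral (s : C) : C :=
  RInt_gen (V := C_R_CompleteNormedModule)
    (fun t : R => Cpower (RtoC t) (s - 1) * RtoC (exp (- t)))
    (at_right 0) (Rbar_locally p_infty).

Fixpoint rising (s : C) (n : nat) : C :=
  match n with
  | O => 1
  | S m => rising s m * (s + RtoC (INR m))
  end.

(* Number of steps to the right needed to reach the half-plane [0 < Re s]:
   the least natural number N such that [0 < Re s + N]. *)
Definition Gamma_shift (s : C) : nat := Z.to_nat (up (- Re s)).

(* The Gamma function: Euler's integral, continued to the left by
   Gamma (s + 1) = s Gamma s; the value at the poles is irrelevant. *)
Definition CGamma (s : C) : C :=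
  let N := Gamma_shift s in
  Gamma_integral (s + RtoC (INR N)) / rising s N.

(* Z_{<=0} + c Z i *)
Definition nonpos_lattice (c : R) (z : C) : Prop :=
  exists m k : Z, (m <= 0)%Z /\ z = RtoC (IZR m) + RtoC (c * IZR k) * Ci.

Definition Psi_term (u : C) (v : R) (z : C) (n : Z) : C :=
  CGamma (u + RtoC (2 * v * IZR n / PI) * Ci) * Czpow z n.

Definition Psi (u : C) (v : R) (z : C) : C := ZSeries (Psi_term u v z).

Definition F_term (mu : C) (q : R) (x : C) (n : nat) : C :=
  qpoch (Cpower (RtoC q) mu) (RtoC q) n / RtoC (INR (fact n)) * (- x) ^ n.

Definition F (mu : C) (q : R) (x : C) : C := CSeries (F_term mu q x).

(* Main.v *)
Require Import Defs.
From Stdlib Require Import Reals ZArith Lra Lia.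
From Coquelicot Require Import Coquelicot.
Open Scope C_scope.

(** Put [h = - ln q], so that [kappa = 2 pi / h] and [q^(i kappa) = 1], and write
    [x = e^L] with [|Im L| < pi / 2].

    Suppose first that [Re mu > 0]. The inner bilateral series, multiplied by
    [x^(-mu-n)], is the sum over [k] of [Gamma (s) x^(-s)] at
    [s = mu + n + i kappa k]. Rotating the ray of integration in Euler's integral
    ([lineint_rotation]) gives
    [Gamma (s) x^(-s) = int_R exp (s y - x e^y) dy] for every [x] with [Re x > 0],
    so the terms are Fourier coefficients, and Poisson summation
    ([poisson_gamma]) turns the series into
    [h * sum_(k in Z) q^((mu+n) k) exp (- x q^k)]. The outer sum over [n] then
    runs over Euler's expansion of [(q^(k+1); q)_oo], which is [0] for [k < 0] and
    [(q; q)_oo / (q; q)_k] otherwise. The right-hand side has become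
    [(q^mu; q)_oo * sum_(k >= 0) q^(mu k) exp (- x q^k) / (q; q)_k], and so does [F],
    by Euler's expansion of [1 / (q^(mu+n); q)_oo]
    ([F_exp_series], [outer_sum_exp_series]).

    The other values of [mu] are reached by descending from [mu + 1] to [mu]
    ([identity_step]) rather than by analytic continuation in [mu]. Both sides,
    as functions [f_mu] of [x], satisfy
    [f_mu x - q^mu f_mu (q x) = (1 - q^mu) f_(mu+1) x] and
    [f_mu' = - (1 - q^mu) f_(mu+1)]. If they agree at [mu + 1], their difference at
    [mu] is constant along rays and equal to [q^mu] times itself; [q^mu] is not
    [1] because [mu] is off the excluded lattice.

    Interchanges of sums rest on domination by a product [A n * B k]
    ([double_series_swap], [outer_dom]), available because the Gaussian factor
    [q^(n(n+1)/2)] beats the factorial growth of [Gamma] in [n], while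
    [Gamma (s) x^(-s)] decays faster than any power of [k]
    ([gamma_pow_decay]). Derivatives are never taken under a sum or an integral:
    it is enough that increments are quadratically small
    ([quadratic_increments_const]). *)

(** * The complex exponential and the principal logarithm *)

Lemma Ceq (a b : C) : Re a = Re b -> Im a = Im b -> a = b.
Proof. destruct a, b; simpl; intros; subst; reflexivity. Qed.

Lemma RtoC_neq_0 (r : R) : r <> 0%R -> RtoC r <> 0.
Proof. intros H E. apply RtoC_inj in E. auto. Qed.

Lemma Cmod_minus_le_0 (a b : C) : (Cmod (a - b)%C <= 0)%R -> a = b.
Proof.
  intros H. assert (E : a - b = 0) by (apply Cmod_eq_0; generalize (Cmod_ge_0 (a - b)); lra).
  replace a with ((a - b) + b) by ring. rewrite E. ring.
Qed.

Lemma exp_le x y : (x <= y)%R -> (exp x <= exp y)%R.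
Proof. intros [H|H]; [left; now apply exp_increasing|subst; lra]. Qed.

Lemma Rmin1_pos x : (0 < x)%R -> (0 < Rmin 1 x /\ Rmin 1 x <= 1 /\ Rmin 1 x <= x)%R.
Proof. intros; repeat split; [apply Rmin_pos; lra|apply Rmin_l|apply Rmin_r]. Qed.

Lemma nat_above (x : R) : exists p : nat, (x <= INR p)%R.
Proof.
  destruct (Rle_dec 0 x) as [H|H].
  - destruct (nfloor_ex x H) as [n Hn]. exists (S n). rewrite S_INR. lra.
  - exists O. simpl; lra.
Qed.

Lemma Rabs_Re_le z : (Rabs (Re z) <= Cmod z)%R.
Proof. eapply Rle_trans; [|apply Rmax_Cmod]. apply Rmax_l. Qed.

Lemma Rabs_Im_le z : (Rabs (Im z) <= Cmod z)%R.
Proof. eapply Rle_trans; [|apply Rmax_Cmod]. apply Rmax_r. Qed.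

Lemma Cmod_le_ReIm z : (Cmod z <= Rabs (Re z) + Rabs (Im z))%R.
Proof.
  replace z with (RtoC (Re z) + Ci * RtoC (Im z)) at 1.
  - eapply Rle_trans; [apply Cmod_triangle|]. rewrite Cmod_mult, !Cmod_R.
    replace (Cmod Ci) with 1%R; [lra|].
    unfold Cmod, Ci; simpl. replace (0 * (0 * 1) + 1 * (1 * 1))%R with 1%R by ring. now rewrite sqrt_1.
  - apply Ceq; simpl; ring.
Qed.

Lemma Cexp_add a b : Cexp (a + b) = Cexp a * Cexp b.
Proof.
  destruct a as [a a'], b as [b b'].
  apply Ceq; unfold Cexp; simpl; rewrite exp_plus;
    [rewrite cos_plus | rewrite sin_plus]; ring.
Qed.

Lemma Cexp_0 : Cexp 0 = 1.
Proof. apply Ceq; unfold Cexp; simpl; rewrite exp_0, ?cos_0, ?sin_0; ring. Qed.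

Lemma Cmod_Cexp z : Cmod (Cexp z) = exp (Re z).
Proof.
  unfold Cexp. rewrite Cmod_mult, Cmod_R.
  rewrite Rabs_pos_eq by (left; apply exp_pos).
  unfold Cmod; simpl.
  replace (cos (Im z) * (cos (Im z) * 1) + sin (Im z) * (sin (Im z) * 1))%R
    with 1%R.
  - rewrite sqrt_1; ring.
  - generalize (sin2_cos2 (Im z)); unfold Rsqr; lra.
Qed.

Lemma Cexp_neq_0 z : Cexp z <> 0.
Proof.
  apply Cmod_gt_0. rewrite Cmod_Cexp. apply exp_pos.
Qed.

Lemma Cexp_opp z : Cexp (- z) = / Cexp z.
Proof.
  assert (H := Cexp_neq_0 z).
  replace (/ Cexp z) with (/ Cexp z * Cexp (z + - z)).
  - rewrite Cexp_add. field; exact H.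
  - replace (z + - z) with (RtoC 0) by ring. rewrite Cexp_0; ring.
Qed.

Lemma Cexp_RtoC (r : R) : Cexp (RtoC r) = RtoC (exp r).
Proof. apply Ceq; unfold Cexp; simpl; rewrite cos_0, sin_0; ring. Qed.

Lemma Cexp_pow z n : Cexp z ^ n = Cexp (RtoC (INR n) * z).
Proof.
  induction n as [|n IH].
  - simpl. replace (0 * z) with (RtoC 0) by ring. now rewrite Cexp_0.
  - rewrite S_INR, RtoC_plus. simpl Cpow. rewrite IH, <- Cexp_add.
    f_equal; ring.
Qed.

Lemma Cexp_zpow z k : Czpow (Cexp z) k = Cexp (RtoC (IZR k) * z).
Proof.
  destruct k as [|p|p]; simpl Czpow.
  - replace (0 * z) with (RtoC 0) by ring. now rewrite Cexp_0.
  - rewrite Cexp_pow, INR_IZR_INZ, positive_nat_Z. reflexivity.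
  - rewrite Cexp_pow, INR_IZR_INZ, positive_nat_Z, <- Cexp_opp.
    f_equal. rewrite <- Pos2Z.opp_pos, opp_IZR, RtoC_opp. ring.
Qed.

Lemma Im_Clog_lt x : (Rabs (Im (Clog x)) < PI / 2)%R.
Proof. unfold Clog; simpl. generalize (atan_bound (Im x / Re x)); intros H. apply Rabs_def1; lra. Qed.

Lemma Cexp_Clog x : (0 < Re x)%R -> Cexp (Clog x) = x.
Proof.
  intros Hx.
  assert (Hm : (0 < Cmod x)%R).
  { apply Cmod_gt_0. intros E; rewrite E in Hx; simpl in Hx; lra. }
  assert (Hc : (cos (atan (Im x / Re x)) = Re x / Cmod x)%R).
  { rewrite cos_atan.
    replace (1 + (Im x / Re x)²)%R with ((Cmod x / Re x)²)%R.
    - rewrite sqrt_Rsqr.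
      + field; lra.
      + apply Rlt_le, Rdiv_lt_0_compat; lra.
    - unfold Rsqr. unfold Rdiv.
      replace (Cmod x * / Re x * (Cmod x * / Re x))%R with (Cmod x ^ 2 * (/ Re x * / Re x))%R by ring.
      unfold Cmod. rewrite pow2_sqrt by nra. destruct x; simpl in *. field; lra. }
  apply Ceq; unfold Cexp, Clog; simpl; rewrite exp_ln by exact Hm.
  - rewrite Hc. field; lra.
  - rewrite sin_atan.
    replace ((Im x / Re x) / sqrt (1 + (Im x / Re x)²))%R
      with (Im x / Re x * cos (atan (Im x / Re x)))%R
      by (rewrite cos_atan; unfold Rdiv; ring).
    rewrite Hc. field; lra.
Qed.

Lemma Clog_inv x : (0 < Re x)%R -> Clog (1 / x) = - Clog x.
Proof.
  intros Hx.
  assert (Hx0 : x <> 0) by (intros E; rewrite E in Hx; simpl in Hx; lra).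
  assert (Hm : (0 < Cmod x)%R) by (apply Cmod_gt_0; exact Hx0).
  assert (Hd : (0 < Re x ^ 2 + Im x ^ 2)%R) by (destruct x; simpl in *; nra).
  apply Ceq; unfold Clog; simpl.
  - replace (1 / x) with (/ x) by (field; exact Hx0).
    rewrite Cmod_inv by exact Hx0. apply ln_Rinv, Hm.
  - rewrite <- atan_opp. f_equal. destruct x as [a b]; simpl in *.
    field. split; [lra|nra].
Qed.

Lemma Clog_RtoC t : (0 < t)%R -> Clog (RtoC t) = RtoC (ln t).
Proof.
  intros Ht. apply Ceq; unfold Clog; simpl.
  - rewrite Cmod_R, Rabs_pos_eq by lra. reflexivity.
  - replace (0 / t)%R with 0%R by (field; lra). apply atan_0.
Qed.

(** * Calculus for complex functions of a real variable *)

(** Differentiability of a complex function of a real variable, read off the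
    components so that real calculus applies. *)
Record cderive (f : R -> C) (t : R) (l : C) : Prop := {
  cderive_Re : is_derive (fun y => Re (f y)) t (Re l);
  cderive_Im : is_derive (fun y => Im (f y)) t (Im l) }.

Lemma cderive_ext_l f t l l' : l = l' -> cderive f t l -> cderive f t l'.
Proof. intros ->; auto. Qed.

Lemma cderive_const c t : cderive (fun _ => c) t 0.
Proof. split; apply (is_derive_const (V := R_NormedModule)). Qed.

Lemma cderive_id t : cderive RtoC t 1.
Proof. split; simpl; [apply (is_derive_id (K := R_AbsRing))
  | apply (is_derive_const (V := R_NormedModule))]. Qed.

Lemma cderive_plus f g t l m : cderive f t l -> cderive g t m -> cderive (fun y => f y + g y) t (l + m).
Proof.
  intros [H1 H2] [H3 H4]; split; simpl;
    apply (is_derive_plus (V := R_NormedModule)); assumption.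
Qed.

Lemma cderive_mult f g t l m :
  cderive f t l -> cderive g t m -> cderive (fun y => f y * g y) t (l * g t + f t * m).
Proof.
  intros [H1 H2] [H3 H4]; split; simpl.
  - evar_last.
    + apply (is_derive_minus (V := R_NormedModule)).
      * apply (is_derive_mult (fun y => Re (f y)) (fun y => Re (g y)));
          [exact H1|exact H3|intros; apply Rmult_comm].
      * apply (is_derive_mult (fun y => Im (f y)) (fun y => Im (g y)));
          [exact H2|exact H4|intros; apply Rmult_comm].
    + unfold minus, plus, opp, mult; simpl. unfold Re, Im; ring.
  - evar_last.
    + apply (is_derive_plus (V := R_NormedModule)).
      * apply (is_derive_mult (fun y => Re (f y)) (fun y => Im (g y)));
          [exact H1|exact H4|intros; apply Rmult_comm].
      * apply (is_derive_mult (fun y => Im (f y)) (fun y => Re (g y)));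
          [exact H2|exact H3|intros; apply Rmult_comm].
    + unfold minus, plus, opp, mult; simpl. unfold Re, Im; ring.
Qed.

Lemma cderive_exp f t l : cderive f t l -> cderive (fun y => Cexp (f y)) t (Cexp (f t) * l).
Proof.
  intros [H1 H2]; split.
  - apply (is_derive_ext (fun y => exp (Re (f y)) * cos (Im (f y)))%R).
    + intros y; unfold Cexp; simpl; ring.
    + set (u := fun y => Re (f y)) in *. set (v := fun y => Im (f y)) in *.
      evar_last.
      * apply (is_derive_mult (fun y => exp (u y)) (fun y => cos (v y)));
          [| |intros; apply Rmult_comm].
        -- apply (is_derive_comp exp u); [apply is_derive_exp|exact H1].
        -- apply (is_derive_comp cos v); [apply is_derive_cos|exact H2].
      * unfold plus, mult, scal; simpl; unfold mult; simpl; unfold u, v, Re, Im; ring.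
  - apply (is_derive_ext (fun y => exp (Re (f y)) * sin (Im (f y)))%R).
    + intros y; unfold Cexp; simpl; ring.
    + set (u := fun y => Re (f y)) in *. set (v := fun y => Im (f y)) in *.
      evar_last.
      * apply (is_derive_mult (fun y => exp (u y)) (fun y => sin (v y)));
          [| |intros; apply Rmult_comm].
        -- apply (is_derive_comp exp u); [apply is_derive_exp|exact H1].
        -- apply (is_derive_comp sin v); [apply is_derive_sin|exact H2].
      * unfold plus, mult, scal; simpl; unfold mult; simpl; unfold u, v, Re, Im; ring.
Qed.

Lemma cderive_scal c f t l : cderive f t l -> cderive (fun y => c * f y) t (c * l).
Proof.
  intros H. eapply cderive_ext_l; [|apply cderive_mult; [apply cderive_const|exact H]].
  cbv beta; ring.
Qed.

Lemma cderive_minus f g t l m : cderive f t l -> cderive g t m -> cderive (fun y => f y - g y) t (l - m).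
Proof.
  intros [H1 H2] [H3 H4]; split; simpl;
    apply (is_derive_minus (V := R_NormedModule)); assumption.
Qed.

Lemma is_RInt_FTC (f df : R -> R) a b l :
  (forall x, is_derive f x (df x)) -> (forall x, ex_derive df x) ->
  (f b - f a = l)%R -> is_RInt df a b l.
Proof.
  intros Hf Hd <-.
  apply (is_RInt_derive (V := R_CompleteNormedModule) f); intros; [apply Hf|].
  apply (ex_derive_continuous (K := R_AbsRing) (V := R_NormedModule)), Hd.
Qed.

Lemma is_RInt_cst (c a b l : R) : ((b - a) * c = l)%R -> is_RInt (fun _ => c) a b l.
Proof. intros <-. apply (is_RInt_const (V := R_NormedModule)). Qed.

Notation CRInt := (RInt (V := C_R_CompleteNormedModule)).
Notation is_CRInt := (is_RInt (V := C_R_NormedModule)).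

(** Componentwise, like [cderive]: integrability then reduces to that of real
    continuous functions. *)
Definition Ccont (f : R -> C) : Prop :=
  forall t, continuous (fun y => Re (f y)) t /\ continuous (fun y => Im (f y)) t.

Lemma cderive_Ccont f df : (forall t, cderive f t (df t)) -> Ccont f.
Proof.
  intros H t; split; apply (ex_derive_continuous (K := R_AbsRing) (V := R_NormedModule)).
  - exists (Re (df t)); apply (cderive_Re _ _ _ (H t)).
  - exists (Im (df t)); apply (cderive_Im _ _ _ (H t)).
Qed.

Lemma Ccont_const c : Ccont (fun _ => c).
Proof. split; apply continuous_const. Qed.

Lemma Ccont_RtoC (g : R -> R) : (forall t, ex_derive g t) -> Ccont (fun y => RtoC (g y)).
Proof.
  intros H t; split; simpl.
  - apply (ex_derive_continuous (K := R_AbsRing) (V := R_NormedModule)), H.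
  - apply continuous_const.
Qed.

Lemma Ccont_plus f g : Ccont f -> Ccont g -> Ccont (fun y => f y + g y).
Proof.
  intros Hf Hg t. destruct (Hf t) as [f1 f2], (Hg t) as [g1 g2]. split; simpl;
    apply (continuous_plus (V := R_NormedModule)); assumption.
Qed.

Lemma Ccont_mult f g : Ccont f -> Ccont g -> Ccont (fun y => f y * g y).
Proof.
  intros Hf Hg t. destruct (Hf t) as [f1 f2], (Hg t) as [g1 g2]. split; simpl.
  - apply (continuous_minus (V := R_NormedModule));
      apply (continuous_mult (K := R_AbsRing)); assumption.
  - apply (continuous_plus (V := R_NormedModule));
      apply (continuous_mult (K := R_AbsRing)); assumption.
Qed.

Lemma Ccont_continuous f t : Ccont f -> continuous (U := C_R_CompleteNormedModule) f t.
Proof.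
  intros H P [eps HP]. destruct (H t) as [H1 H2].
  assert (Q1 := H1 (ball (Re (f t)) eps) (ex_intro _ eps (fun _ h => h))).
  assert (Q2 := H2 (ball (Im (f t)) eps) (ex_intro _ eps (fun _ h => h))).
  unfold filtermap in *.
  apply (filter_imp (F := locally t) (fun y => ball (Re (f t)) eps (Re (f y)) /\ ball (Im (f t)) eps (Im (f y)))).
  - intros y [h1 h2]. apply HP. split; assumption.
  - apply (filter_and (F := locally t)); assumption.
Qed.

Lemma scal_RtoC (r : R) (z : C) : RtoC r * z = scal (V := C_R_NormedModule) r z.
Proof.
  apply Ceq; [change (Re (RtoC r * z) = r * Re z)%R|change (Im (RtoC r * z) = r * Im z)%R];
    destruct z; simpl; ring.
Qed.

Lemma is_CRInt_ex f a b : Ccont f -> is_CRInt f a b (CRInt f a b).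
Proof.
  intros H.
  apply (RInt_correct (V := C_R_CompleteNormedModule)).
  destruct (ex_RInt_continuous (V := R_CompleteNormedModule) (fun y => Re (f y)) a b) as [l1 H1].
  { intros z _; apply H. }
  destruct (ex_RInt_continuous (V := R_CompleteNormedModule) (fun y => Im (f y)) a b) as [l2 H2].
  { intros z _; apply H. }
  exists (l1, l2). apply (is_RInt_fct_extend_pair (U := R_NormedModule) (V := R_NormedModule)); assumption.
Qed.

Lemma is_CRInt_unique f a b l : is_CRInt f a b l -> CRInt f a b = l.
Proof. apply (is_RInt_unique (V := C_R_CompleteNormedModule)). Qed.

Lemma is_CRInt_pair f a b l :
  is_RInt (fun y => Re (f y)) a b (Re l) ->
  is_RInt (fun y => Im (f y)) a b (Im l) -> is_CRInt f a b l.
Proof.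
  destruct l; apply (is_RInt_fct_extend_pair (U := R_NormedModule) (V := R_NormedModule)).
Qed.

Lemma is_CRInt_Re f a b l : is_CRInt f a b l -> is_RInt (fun y => Re (f y)) a b (Re l).
Proof. apply (is_RInt_fct_extend_fst (U := R_NormedModule) (V := R_NormedModule)). Qed.
Lemma is_CRInt_Im f a b l : is_CRInt f a b l -> is_RInt (fun y => Im (f y)) a b (Im l).
Proof. apply (is_RInt_fct_extend_snd (U := R_NormedModule) (V := R_NormedModule)). Qed.

Lemma is_CRInt_FTC f df a b :
  (forall t, cderive f t (df t)) -> Ccont df -> is_CRInt df a b (f b - f a).
Proof.
  intros Hf Hc. apply is_CRInt_pair.
  - apply (is_RInt_derive (V := R_CompleteNormedModule) (fun y => Re (f y))).
    + intros; apply Hf.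
    + intros; apply Hc.
  - apply (is_RInt_derive (V := R_CompleteNormedModule) (fun y => Im (f y))).
    + intros; apply Hf.
    + intros; apply Hc.
Qed.

Lemma is_CRInt_plus f g a b l m :
  is_CRInt f a b l -> is_CRInt g a b m -> is_CRInt (fun y => f y + g y) a b (l + m).
Proof. apply (is_RInt_plus (V := C_R_NormedModule)). Qed.

Lemma is_CRInt_scal c f a b l :
  is_CRInt f a b l -> is_CRInt (fun y => c * f y) a b (c * l).
Proof.
  intros H. apply is_CRInt_pair; simpl.
  - apply (is_RInt_minus (V := R_NormedModule));
      apply (is_RInt_scal (V := R_NormedModule));
      [apply is_CRInt_Re|apply is_CRInt_Im]; exact H.
  - apply (is_RInt_plus (V := R_NormedModule));
      apply (is_RInt_scal (V := R_NormedModule));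
      [apply is_CRInt_Im|apply is_CRInt_Re]; exact H.
Qed.

Lemma is_CRInt_minus f g a b l m :
  is_CRInt f a b l -> is_CRInt g a b m -> is_CRInt (fun y => f y - g y) a b (l - m).
Proof. apply (is_RInt_minus (V := C_R_NormedModule)). Qed.

Lemma is_CRInt_ext f g a b l :
  (forall y, f y = g y) -> is_CRInt f a b l -> is_CRInt g a b l.
Proof. intros E. apply (is_RInt_ext (V := C_R_NormedModule)). intros; apply E. Qed.

Lemma is_CRInt_norm f g a b l lg : (a <= b)%R ->
  (forall y, (a <= y <= b)%R -> (Cmod (f y) <= g y)%R) ->
  is_CRInt f a b l -> is_RInt g a b lg -> (Cmod l <= lg)%R.
Proof.
  intros Hab Hb Hf Hg. rewrite Cmod_norm.
  apply (norm_RInt_le (V := C_R_NormedModule) f g a b); try assumption.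
  intros y Hy. rewrite <- Cmod_norm. now apply Hb.
Qed.

(** The empty sum is included, so that index [n] means the first [n] terms;
    [sum_n] has one more. *)
Fixpoint Csum (a : nat -> C) (n : nat) : C :=
  match n with O => 0 | S m => Csum a m + a m end.

Lemma cderive_pow_fact z n t :
  cderive (fun y => (RtoC y * z) ^ S n / RtoC (INR (fact (S n)))) t
     (z * ((RtoC t * z) ^ n / RtoC (INR (fact n)))).
Proof.
  assert (Hp : forall k, cderive (fun y => (RtoC y * z) ^ k) t
     (match k with O => 0 | S m => RtoC (INR (S m)) * z * (RtoC t * z) ^ m end)).
  { induction k as [|k IH].
    - simpl. apply cderive_const.
    - eapply cderive_ext_l; [|apply (cderive_mult (fun y => RtoC y * z) (fun y => (RtoC y * z) ^ k));
         [apply cderive_mult; [apply cderive_id|apply cderive_const]|exact IH]].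
      destruct k; simpl Cpow; rewrite ?S_INR, ?RtoC_plus; simpl INR; ring. }
  eapply cderive_ext_l; [|apply (cderive_mult _ (fun _ => / RtoC (INR (fact (S n))))); [apply (Hp (S n))|apply cderive_const]].
  rewrite fact_simpl, mult_INR, RtoC_mult.
  assert (RtoC (INR (S n)) <> 0) by (apply RtoC_neq_0, not_0_INR; discriminate).
  assert (RtoC (INR (fact n)) <> 0) by (apply RtoC_neq_0, INR_fact_neq_0).
  field; auto.
Qed.

Lemma cderive_Cexp_lin z t : cderive (fun y => Cexp (RtoC y * z)) t (z * Cexp (RtoC t * z)).
Proof.
  eapply cderive_ext_l; [|apply cderive_exp, cderive_mult; [apply cderive_id|apply cderive_const]]. cbv beta; ring.
Qed.

(** Integrating along the segment from [0] to [z] the bound of order [N] gives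
    the one of order [N + 1]; on that segment [|e^w|] is at most
    [max (1, e^(Re z))]. *)
Lemma Cexp_taylor N : forall z,
  (Cmod (Cexp z - Csum (fun n => z ^ n / RtoC (INR (fact n)))%C N)
   <= Cmod z ^ N / INR (fact N) * Rmax 1 (exp (Re z)))%R.
Proof.
  induction N as [|N IH]; intros z.
  - simpl. replace (Cexp z - 0) with (Cexp z) by ring. rewrite Cmod_Cexp.
    replace (1 / 1 * Rmax 1 (exp (Re z)))%R with (Rmax 1 (exp (Re z))) by field.
    apply Rmax_r.
  - set (T := fun w N => Csum (fun n => w ^ n / RtoC (INR (fact n))) N).
    assert (HD : forall M t, cderive (fun y => T (RtoC y * z) (S M)) t (z * T (RtoC t * z) M)).
    { induction M as [|M IHM]; intros t.
      - unfold T; simpl. eapply cderive_ext_l; [|apply cderive_const]. ring.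
      - unfold T in *. cbn [Csum]. eapply cderive_ext_l; [|apply cderive_plus; [apply IHM|apply cderive_pow_fact]].
        cbn [Csum]. ring. }
    assert (HT0 : forall M, T (RtoC 0 * z) (S M) = 1).
    { induction M as [|M IHM].
      - unfold T; simpl. field.
      - unfold T in *. change (Csum ?f (S (S M))) with (Csum f (S M) + f (S M)). rewrite IHM.
        simpl Cpow. unfold Cdiv. ring. }
    set (g := fun y : R => z * (Cexp (RtoC y * z) - T (RtoC y * z) N)).
    assert (HI : is_CRInt g 0 1 ((Cexp (RtoC 1 * z) - T (RtoC 1 * z) (S N))
                 - (Cexp (RtoC 0 * z) - T (RtoC 0 * z) (S N)))).
    { apply (is_CRInt_FTC (fun y => Cexp (RtoC y * z) - T (RtoC y * z) (S N))).
      - intros t. unfold g.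
        eapply cderive_ext_l; [|apply cderive_minus; [apply cderive_Cexp_lin|apply HD]]. ring.
      - apply (cderive_Ccont _ (fun t => z * (z * Cexp (RtoC t * z) - match N with O => 0 | S M => z * T (RtoC t * z) M end))).
        intros t. apply cderive_scal, cderive_minus; [apply cderive_Cexp_lin|].
        destruct N; [exact (cderive_const 0 t)|apply HD]. }
    rewrite HT0 in HI.
    replace (RtoC 1 * z) with z in HI by ring.
    replace (RtoC 0 * z) with (RtoC 0) in HI by ring. rewrite Cexp_0 in HI.
    replace (Cexp z - T z (S N) - (1 - 1)) with (Cexp z - T z (S N)) in HI by ring.
    fold (T z (S N)).
    set (m := Rmax 1 (exp (Re z))).
    assert (Hf : (0 < INR (fact N))%R) by apply INR_fact_lt_0.
    eapply (is_CRInt_norm g (fun y => Cmod z ^ S N / INR (fact N) * m * y ^ N)%R 0 1); [lra| |exact HI|].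
    + intros y Hy. unfold g. rewrite Cmod_mult.
      eapply Rle_trans.
      * apply Rmult_le_compat_l; [apply Cmod_ge_0|apply IH].
      * rewrite Cmod_mult, Cmod_R, Rabs_pos_eq, Rpow_mult_distr by lra.
        replace (Re (RtoC y * z)) with (y * Re z)%R by (destruct z; simpl; ring).
        replace (Cmod z ^ S N / INR (fact N) * m * y ^ N)%R
          with (Cmod z * (y ^ N * Cmod z ^ N / INR (fact N) * m))%R by (simpl; field; lra).
        apply Rmult_le_compat_l; [apply Cmod_ge_0|].
        apply Rmult_le_compat_l.
        { apply Rdiv_le_0_compat; [|exact Hf].
          apply Rmult_le_pos; apply pow_le; [lra|apply Cmod_ge_0]. }
        unfold m. apply Rmax_lub; [apply Rmax_l|].
        destruct (Rle_dec 0 (Re z)).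
        { eapply Rle_trans; [|apply Rmax_r]. apply exp_le; nra. }
        { eapply Rle_trans; [|apply Rmax_l]. rewrite <- exp_0. apply exp_le; nra. }
    + assert (HN : INR (S N) <> 0%R) by (apply not_0_INR; discriminate).
      apply (is_RInt_FTC (fun y => Cmod z ^ S N / INR (fact N) * m * (y ^ S N / INR (S N)))%R).
      * intros x. auto_derive; [exact I|].
        replace (pred (S N)) with N by reflexivity.
        change (match N with O => 1%R | S _ => (INR N + 1)%R end) with (INR (S N)).
        change (Cmod z ^ S N)%R with (Cmod z * Cmod z ^ N)%R.
        field. split; [lra|exact HN].
      * intros x. auto_derive; exact I.
      * rewrite fact_simpl, mult_INR, pow1. change (0 ^ S N)%R with (0 * 0 ^ N)%R.
        field. split; [lra|exact HN].
Qed.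

Lemma Cmod_Cexp_sub1 z : (Cmod (Cexp z - 1)%C <= Cmod z * exp (Cmod z))%R.
Proof.
  assert (H := Cexp_taylor 1 z). cbn [Csum] in H. simpl in H.
  replace (Cexp z - (0 + 1 / 1)) with (Cexp z - 1) in H by field.
  eapply Rle_trans; [exact H|]. rewrite Rmult_1_r. unfold Rdiv. rewrite Rinv_1, Rmult_1_r.
  apply Rmult_le_compat_l; [apply Cmod_ge_0|].
  apply Rmax_lub.
  - rewrite <- exp_0. apply exp_le, Cmod_ge_0.
  - apply exp_le. eapply Rle_trans; [apply Rle_abs|apply Rabs_Re_le].
Qed.

Lemma Cmod_Cexp_sub2 z :
  (Cmod (Cexp z - 1 - z)%C <= Cmod z ^ 2 / 2 * Rmax 1 (exp (Re z)))%R.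
Proof.
  assert (H := Cexp_taylor 2 z). cbn [Csum] in H. simpl in H.
  replace (Cexp z - (0 + 1 / 1 + z * 1 / 1)) with (Cexp z - 1 - z) in H by field.
  simpl. exact H.
Qed.

(** * Complex limits and series *)

Notation is_Cseries := (is_series (K := C_AbsRing) (V := C_NormedModule)).

Lemma is_series_scalR (c : R) (a : nat -> R) (l : R) :
  is_series a l -> is_series (fun n => c * a n)%R (c * l)%R.
Proof. apply (is_series_scal (V := R_NormedModule)). Qed.

Lemma ex_series_scalR (c : R) (a : nat -> R) :
  ex_series a -> ex_series (fun n => c * a n)%R.
Proof. apply (ex_series_scal (V := R_NormedModule)). Qed.

Lemma is_lim_seq_scal_0 c (u : nat -> R) :
  is_lim_seq u 0 -> is_lim_seq (fun n => c * u n)%R 0.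
Proof.
  intros H. replace (Finite 0) with (Finite (c * 0)) by (f_equal; ring).
  apply is_lim_seq_mult'; [apply is_lim_seq_const|exact H].
Qed.

(** A single real limit, which suits estimates; [Clim_split] gives the
    componentwise form. *)
Definition Clim (u : nat -> C) (l : C) : Prop :=
  is_lim_seq (fun n => Cmod (u n - l)) 0.

Fixpoint Rsum (a : nat -> R) (n : nat) : R :=
  match n with O => 0%R | S m => (Rsum a m + a m)%R end.

Lemma Clim_split u l : Clim u l <->
  is_lim_seq (fun n => Re (u n)) (Re l) /\ is_lim_seq (fun n => Im (u n)) (Im l).
Proof.
  unfold Clim. split.
  - intros H.
    assert (H0 : forall f : C -> R, (forall a b, f (a - b)%C = f a - f b)%R ->
      (forall z, Rabs (f z) <= Cmod z)%R -> is_lim_seq (fun n => f (u n)) (f l)).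
    { intros f Hs Hb.
      apply (is_lim_seq_ext (fun n => f (u n - l)%C + f l)%R).
      { intros n; rewrite Hs; ring. }
      replace (Finite (f l)) with (Rbar_plus 0 (f l)) by (simpl; f_equal; ring).
      apply is_lim_seq_plus'; [|apply is_lim_seq_const].
      apply (proj2 (is_lim_seq_abs_0 _)).
      apply (is_lim_seq_le_le (fun _ => 0%R) _ (fun n => Cmod (u n - l)));
        [|apply is_lim_seq_const|exact H].
      intros n; split; [apply Rabs_pos|apply Hb]. }
    split; apply H0; try (intros [] []; simpl; ring); [apply Rabs_Re_le|apply Rabs_Im_le].
  - intros [H1 H2].
    apply (is_lim_seq_le_le (fun _ => 0%R) _
       (fun n => (Rabs (Re (u n) - Re l) + Rabs (Im (u n) - Im l))%R)).
    + intros n; split; [apply Cmod_ge_0|]. eapply Rle_trans; [apply Cmod_le_ReIm|].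
      destruct (u n), l; simpl; apply Rle_refl.
    + apply is_lim_seq_const.
    + assert (X : forall (v : nat -> R) (m : R), is_lim_seq v m -> is_lim_seq (fun n => Rabs (v n - m)) 0).
      { intros v m Hv. apply (proj1 (is_lim_seq_abs_0 _)).
        replace (Finite 0) with (Finite (m - m)) by (f_equal; ring).
        apply is_lim_seq_minus'; [exact Hv|apply is_lim_seq_const]. }
      replace (Finite 0) with (Finite (0 + 0)) by (f_equal; ring).
      apply is_lim_seq_plus'; apply X; assumption.
Qed.

Lemma Re_Csum a n : Re (Csum a n) = Rsum (fun k => Re (a k)) n.
Proof. induction n as [|n IH]; [reflexivity|]. simpl Csum. simpl Rsum. now rewrite <- IH. Qed.
Lemma Im_Csum a n : Im (Csum a n) = Rsum (fun k => Im (a k)) n.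
Proof. induction n as [|n IH]; [reflexivity|]. simpl Csum. simpl Rsum. now rewrite <- IH. Qed.

Lemma Rsum_sum_n a n : sum_n a n = Rsum a (S n).
Proof.
  induction n as [|n IH].
  - rewrite sum_O. simpl. symmetry; apply Rplus_0_l.
  - rewrite sum_Sn, IH. reflexivity.
Qed.

Lemma is_series_Rsum a s : is_series a s <-> is_lim_seq (Rsum a) s.
Proof.
  split; intros H.
  - apply is_lim_seq_incr_1. apply (is_lim_seq_ext (sum_n a)); [|exact H].
    intros; apply Rsum_sum_n.
  - apply is_lim_seq_incr_1 in H.
    apply (is_lim_seq_ext _ (sum_n a)) in H; [exact H|].
    intros; symmetry; apply Rsum_sum_n.
Qed.

Lemma is_series_ge0 b s : (forall n, 0 <= b n)%R -> is_series b s -> (0 <= s)%R.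
Proof.
  intros Hb H. apply is_series_Rsum in H. apply (is_lim_seq_le (fun _ => 0%R) (Rsum b) 0%R s).
  - intros n; induction n as [|n IH]; cbn [Rsum]; [lra|]. specialize (Hb n). lra.
  - apply is_lim_seq_const.
  - exact H.
Qed.

Lemma is_Cseries_split a l : is_Cseries a l <->
  is_series (fun n => Re (a n)) (Re l) /\ is_series (fun n => Im (a n)) (Im l).
Proof.
  assert (HR : forall n, Re (sum_n (G := C_NormedModule) a n) = sum_n (fun k => Re (a k)) n).
  { induction n as [|n IH]; [now rewrite !sum_O|]. rewrite !sum_Sn, <- IH. reflexivity. }
  assert (HI : forall n, Im (sum_n (G := C_NormedModule) a n) = sum_n (fun k => Im (a k)) n).
  { induction n as [|n IH]; [now rewrite !sum_O|]. rewrite !sum_Sn, <- IH. reflexivity. }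
  unfold is_series. split.
  - intros H. split.
    + apply (filterlim_ext (fun n => Re (sum_n (G := C_NormedModule) a n))); [exact HR|].
      intros P [eps HP]. apply (H (fun z => P (Re z))). exists eps.
      intros z [Hz _]. apply HP, Hz.
    + apply (filterlim_ext (fun n => Im (sum_n (G := C_NormedModule) a n))); [exact HI|].
      intros P [eps HP]. apply (H (fun z => P (Im z))). exists eps.
      intros z [_ Hz]. apply HP, Hz.
  - intros [H1 H2] P [eps HP].
    destruct (H1 (ball (Re l) eps)) as [N1 HN1]; [now exists eps|].
    destruct (H2 (ball (Im l) eps)) as [N2 HN2]; [now exists eps|].
    exists (max N1 N2). intros n Hn. apply HP. split.
    + change (fst ?z) with (Re z). rewrite HR. apply HN1; lia.
    + change (snd ?z) with (Im z). rewrite HI. apply HN2; lia.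
Qed.

Lemma is_Cseries_lim a l : is_Cseries a l <-> Clim (Csum a) l.
Proof.
  rewrite is_Cseries_split, Clim_split, !is_series_Rsum.
  split; intros [H1 H2]; split.
  - eapply is_lim_seq_ext; [intros; symmetry; apply Re_Csum|exact H1].
  - eapply is_lim_seq_ext; [intros; symmetry; apply Im_Csum|exact H2].
  - eapply is_lim_seq_ext; [intros; apply Re_Csum|exact H1].
  - eapply is_lim_seq_ext; [intros; apply Im_Csum|exact H2].
Qed.

Lemma CSeries_unique (a : nat -> C) (l : C) : is_Cseries a l -> CSeries a = l.
Proof.
  intros H. apply is_Cseries_split in H. destruct H as [H1 H2].
  unfold CSeries. rewrite (is_series_unique _ _ H1), (is_series_unique _ _ H2).
  now destruct l.
Qed.

Lemma is_Cseries_unique (a : nat -> C) (l m : C) : is_Cseries a l -> is_Cseries a m -> l = m.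
Proof. intros H1 H2. now rewrite <- (CSeries_unique a l H1), (CSeries_unique a m H2). Qed.

Lemma Clim_unique u l m : Clim u l -> Clim u m -> l = m.
Proof.
  intros H1 H2. apply Clim_split in H1, H2.
  destruct H1 as [H1 H1'], H2 as [H2 H2'].
  apply is_lim_seq_unique in H1, H1', H2, H2'. apply Ceq; congruence.
Qed.

Lemma is_Cseries_ext (a b : nat -> C) (l : C) : (forall n, a n = b n) -> is_Cseries a l -> is_Cseries b l.
Proof. intros E. apply is_series_ext, E. Qed.
Lemma is_Cseries_plus (a b : nat -> C) (l m : C) :
  is_Cseries a l -> is_Cseries b m -> is_Cseries (fun n => a n + b n) (l + m).
Proof. apply (is_series_plus (V := C_NormedModule)). Qed.
Lemma is_Cseries_minus (a b : nat -> C) (l m : C) :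
  is_Cseries a l -> is_Cseries b m -> is_Cseries (fun n => a n - b n) (l - m).
Proof. apply (is_series_minus (V := C_NormedModule)). Qed.
Lemma is_Cseries_scal (c : C) (a : nat -> C) (l : C) : is_Cseries a l -> is_Cseries (fun n => c * a n) (c * l).
Proof. apply (is_series_scal (V := C_NormedModule)). Qed.
Lemma is_Cseries_0 : is_Cseries (fun _ => RtoC 0) (RtoC 0).
Proof.
  apply is_Cseries_lim. unfold Clim. apply (is_lim_seq_ext (fun _ => 0%R)); [|apply is_lim_seq_const].
  intros n. replace (Csum (fun _ => RtoC 0) n) with (RtoC 0).
  - replace (RtoC 0 - RtoC 0) with (RtoC 0) by ring. now rewrite Cmod_0.
  - induction n; simpl; [reflexivity|]. rewrite <- IHn. ring.
Qed.

Lemma is_Cseries_incr_1 (a : nat -> C) (l : C) : is_Cseries (fun n => a (S n)) l -> is_Cseries a (a O + l).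
Proof.
  rewrite !is_Cseries_lim. unfold Clim. intros H. apply is_lim_seq_incr_1.
  eapply is_lim_seq_ext; [|exact H]. intros n; cbv beta. f_equal.
  assert (E : Csum a (S n) = a O + Csum (fun k => a (S k)) n).
  { induction n as [|n IH]; [simpl; ring|]. change (Csum a (S (S n))) with (Csum a (S n) + a (S n)).
    rewrite IH. simpl. ring. }
  rewrite E. ring.
Qed.

Lemma Clim_ext u v l : (forall n, u n = v n) -> Clim u l -> Clim v l.
Proof. intros E. apply is_lim_seq_ext. intros n; now rewrite E. Qed.

Lemma Clim_is_0 u l v :
  (forall n, Cmod (u n - l)%C <= v n)%R -> is_lim_seq v 0 -> Clim u l.
Proof.
  intros H Hv. apply (is_lim_seq_le_le (fun _ => 0%R) _ v); [|apply is_lim_seq_const|exact Hv].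
  intros n; split; [apply Cmod_ge_0|apply H].
Qed.

Lemma Clim_plus u v l m : Clim u l -> Clim v m -> Clim (fun n => u n + v n) (l + m).
Proof.
  intros H1 H2. apply (Clim_is_0 _ _ (fun n => Cmod (u n - l)%C + Cmod (v n - m)%C)%R).
  - intros n. replace (u n + v n - (l + m)) with ((u n - l) + (v n - m)) by ring. apply Cmod_triangle.
  - replace (Finite 0) with (Finite (0 + 0)) by (f_equal; ring). apply is_lim_seq_plus'; assumption.
Qed.

Lemma Clim_scal c u l : Clim u l -> Clim (fun n => c * u n) (c * l).
Proof.
  intros H1. apply (Clim_is_0 _ _ (fun n => Cmod c * Cmod (u n - l)%C)%R).
  - intros n. replace (c * u n - c * l) with (c * (u n - l)) by ring. rewrite Cmod_mult. lra.
  - apply is_lim_seq_scal_0; assumption.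
Qed.

Lemma Clim_cesaro u l : Clim u l -> Clim (fun N => RtoC (/ INR (S N)) * Csum u (S N)) l.
Proof.
  intros H. apply Clim_split in H. apply Clim_split. destruct H as [H1 H2].
  assert (X : forall (v : nat -> R) (m : R), is_lim_seq v m ->
     is_lim_seq (fun N => / INR (S N) * Rsum v (S N))%R m).
  { intros v m Hv. apply is_lim_seq_Reals in Hv. apply Cesaro_1 in Hv.
    apply is_lim_seq_Reals in Hv. apply is_lim_seq_incr_1 in Hv.
    eapply is_lim_seq_ext; [|exact Hv]. intros n; cbv beta.
    change (pred (S n)) with n. unfold Rdiv. rewrite Rmult_comm. f_equal.
    rewrite <- Rsum_sum_n. symmetry. apply sum_n_Reals. }
  split.
  - eapply is_lim_seq_ext; [|apply X, H1]. intros n; cbv beta. rewrite <- Re_Csum.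
    generalize (/ INR (S n))%R. intros r. destruct (Csum u (S n)); simpl; ring.
  - eapply is_lim_seq_ext; [|apply X, H2]. intros n; cbv beta. rewrite <- Im_Csum.
    generalize (/ INR (S n))%R. intros r. destruct (Csum u (S n)); simpl; ring.
Qed.

Lemma Clim_bound u l c v (w : R) :
  Clim u l -> is_lim_seq v w -> eventually (fun n => Cmod (u n - c)%C <= v n)%R ->
  (Cmod (l - c)%C <= w)%R.
Proof.
  intros Hu Hv [N Hb].
  apply (is_lim_seq_le_loc (fun _ => Cmod (l - c)) (fun n => Cmod (u n - l)%C + v n)%R
           (Cmod (l - c)%C) w).
  - exists N; intros n Hn. specialize (Hb n Hn).
    replace (l - c) with ((- (u n - l)) + (u n - c)) by ring.
    eapply Rle_trans; [apply Cmod_triangle|]. rewrite Cmod_opp. lra.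
  - apply is_lim_seq_const.
  - replace (Finite w) with (Finite (0 + w)) by (f_equal; ring).
    apply is_lim_seq_plus'; [exact Hu|exact Hv].
Qed.

Lemma Cmod_Csum_diff a b N M :
  (forall n, Cmod (a n) <= b n)%R -> (N <= M)%nat ->
  (Cmod (Csum a M - Csum a N)%C <= Rsum b M - Rsum b N)%R.
Proof.
  intros Hb HNM. induction HNM as [|M HNM IH].
  - replace (Csum a N - Csum a N) with (RtoC 0) by ring. rewrite Cmod_0; lra.
  - simpl. replace (Csum a M + a M - Csum a N) with ((Csum a M - Csum a N) + a M) by ring.
    eapply Rle_trans; [apply Cmod_triangle|]. specialize (Hb M). lra.
Qed.

Lemma is_Cseries_tail (a : nat -> C) b (l : C) s N :
  (forall n, Cmod (a n) <= b n)%R -> is_Cseries a l -> is_series b s ->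
  (Cmod (l - Csum a N)%C <= s - Rsum b N)%R.
Proof.
  intros Hb Ha Hs. apply is_Cseries_lim in Ha. apply is_series_Rsum in Hs.
  apply (Clim_bound _ _ _ (fun n => Rsum b n - Rsum b N)%R (s - Rsum b N)%R Ha).
  - apply is_lim_seq_minus'; [exact Hs|apply is_lim_seq_const].
  - exists N. intros n Hn. now apply Cmod_Csum_diff.
Qed.

Lemma is_Cseries_norm (a : nat -> C) b (l : C) s :
  (forall n, Cmod (a n) <= b n)%R -> is_Cseries a l -> is_series b s -> (Cmod l <= s)%R.
Proof.
  intros Hb Ha Hs. generalize (is_Cseries_tail a b l s 0 Hb Ha Hs). simpl.
  replace (l - 0) with l by ring. lra.
Qed.

Lemma ex_Cseries_dom (a : nat -> C) b : (forall n, Cmod (a n) <= b n)%R -> ex_series b -> exists l : C, is_Cseries a l.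
Proof.
  intros Hb Hs.
  destruct (ex_series_le (V := R_CompleteNormedModule) (fun n => Re (a n)) b) as [x Hx].
  { intros n. eapply Rle_trans; [apply Rabs_Re_le|apply Hb]. } { exact Hs. }
  destruct (ex_series_le (V := R_CompleteNormedModule) (fun n => Im (a n)) b) as [y Hy].
  { intros n. eapply Rle_trans; [apply Rabs_Im_le|apply Hb]. } { exact Hs. }
  exists (x, y). apply is_Cseries_split. split; assumption.
Qed.

Lemma CSeries_correct a b :
  (forall n, Cmod (a n) <= b n)%R -> ex_series b -> is_Cseries a (CSeries a).
Proof.
  intros Hb Hs. destruct (ex_Cseries_dom a b Hb Hs) as [l Hl].
  now rewrite (CSeries_unique _ _ Hl).
Qed.

(** The product bound makes the tails uniform: cutting the outer sum at [N]
    changes the double sum by at most [(sum of A beyond N) * (sum of B)]. *)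
Lemma double_series_swap (a : nat -> nat -> C) A B (r c : nat -> C) :
  (forall n, 0 <= A n)%R -> (forall k, 0 <= B k)%R ->
  (forall n k, Cmod (a n k) <= A n * B k)%R -> ex_series A -> ex_series B ->
  (forall n, is_Cseries (a n) (r n)) -> (forall k, is_Cseries (fun n => a n k) (c k)) ->
  exists s : C, is_Cseries r s /\ is_Cseries c s.
Proof.
  intros HA HB Hb [sA HsA] [sB HsB] Hr Hc.
  assert (HsB0 := is_series_ge0 B sB HB HsB).
  assert (Hct : forall N k, (Cmod (c k - Csum (fun n => a n k) N)%C <= (sA - Rsum A N) * B k)%R).
  { intros N k.
    assert (E : forall N, Rsum (fun n => A n * B k)%R N = (Rsum A N * B k)%R).
    { intros M; induction M as [|M IH]; simpl; [ring|]. rewrite IH; ring. }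
    replace ((sA - Rsum A N) * B k)%R with (sA * B k - Rsum (fun n => A n * B k)%R N)%R
      by (rewrite E; ring).
    apply (is_Cseries_tail (fun n => a n k)); [intros n; apply Hb|apply Hc|].
    apply is_series_Rsum. eapply is_lim_seq_ext; [intros; symmetry; apply E|].
    apply (is_lim_seq_mult' (Rsum A) (fun _ => B k)); [now apply is_series_Rsum|apply is_lim_seq_const]. }
  destruct (ex_Cseries_dom c (fun k => sA * B k)%R) as [s Hs].
  { intros k. specialize (Hct O k). simpl in Hct.
    replace (c k - 0) with (c k) in Hct by ring. lra. }
  { exists (sA * sB)%R. apply is_series_scalR, HsB. }
  exists s. split; [|exact Hs].
  apply is_Cseries_lim. apply (Clim_is_0 _ _ (fun N => (sA - Rsum A N) * sB)%R).
  - intros N.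
    assert (Hp : is_Cseries (fun k => c k - Csum (fun n => a n k) N) (s - Csum r N)).
    { apply is_Cseries_minus; [exact Hs|]. clear Hct. induction N as [|N IH]; simpl.
      - apply is_Cseries_0.
      - apply is_Cseries_plus; [exact IH|apply Hr]. }
    replace (Csum r N - s) with (- (s - Csum r N)) by ring. rewrite Cmod_opp.
    apply (is_Cseries_norm _ (fun k => (sA - Rsum A N) * B k)%R _ _ (Hct N) Hp).
    apply is_series_scalR, HsB.
  - replace (Finite 0) with (Finite ((sA - sA) * sB)) by (f_equal; ring).
    apply is_lim_seq_mult'; [|apply is_lim_seq_const].
    apply is_lim_seq_minus'; [apply is_lim_seq_const|now apply is_series_Rsum].
Qed.

(** A bilateral series folded at [0] is an ordinary series whose partial sums
    are the symmetric ones, those to which Fejer's kernel is adapted. *)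
Definition zfold (t : Z -> C) (n : nat) : C :=
  match n with
  | O => t 0%Z
  | S _ => t (Z.of_nat n) + t (- Z.of_nat n)%Z
  end.

Lemma Cmod_zfold t (b : nat -> R) k :
  (Cmod (t (Z.of_nat k)) <= b k)%R -> (Cmod (t (- Z.of_nat k)%Z) <= b k)%R ->
  (Cmod (zfold t k) <= 2 * b k)%R.
Proof.
  intros H1 H2. destruct k as [|k]; unfold zfold.
  - change (Z.of_nat 0) with 0%Z in H1. generalize (Cmod_ge_0 (t 0%Z)). lra.
  - eapply Rle_trans; [apply Cmod_triangle|]. lra.
Qed.

Lemma zfold_ext t u n : (forall k, t k = u k) -> zfold t n = zfold u n.
Proof. intros E; destruct n; unfold zfold; now rewrite !E. Qed.

Lemma zfold_plus t u n : zfold (fun k => t k + u k) n = zfold t n + zfold u n.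
Proof. destruct n; unfold zfold; ring. Qed.

Lemma zfold_scal c t n : zfold (fun k => c * t k) n = c * zfold t n.
Proof. destruct n; unfold zfold; ring. Qed.

Lemma zfold_correct t b :
  (forall k, Cmod (t (Z.of_nat k)) <= b k)%R ->
  (forall k, Cmod (t (- Z.of_nat k)%Z) <= b k)%R -> ex_series b ->
  ex_Zseries t /\ is_Cseries (zfold t) (ZSeries t).
Proof.
  intros H1 H2 Hb.
  assert (P := CSeries_correct _ b H1 Hb).
  assert (Q : is_Cseries (fun n => t (- Z.of_nat (S n))%Z) (CSeries (fun n => t (- Z.of_nat (S n))%Z))).
  { apply (CSeries_correct _ (fun n => b (S n))).
    - intros n; apply H2.
    - now apply -> (ex_series_incr_1 b). }
  split.
  - split; [exists (CSeries (fun n => t (Z.of_nat n)))|exists (CSeries (fun n => t (- Z.of_nat (S n))%Z))]; assumption.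
  - unfold ZSeries.
    apply (is_Cseries_ext (fun n => t (Z.of_nat n) + match n with O => RtoC 0 | S m => t (- Z.of_nat (S m))%Z end)).
    + intros [|n]; unfold zfold; [|reflexivity]. simpl; ring.
    + apply is_Cseries_plus; [exact P|].
      replace (CSeries (fun n => t (- Z.of_nat (S n))%Z)) with (0 + CSeries (fun n => t (- Z.of_nat (S n))%Z)) by ring.
      apply (is_Cseries_incr_1 (fun n => match n with O => RtoC 0 | S m => t (- Z.of_nat (S m))%Z end)). exact Q.
Qed.

Lemma Zabs_nat_pos k : Z.abs_nat (Z.of_nat k) = k.
Proof. lia. Qed.

Lemma Zabs_nat_neg k : Z.abs_nat (- Z.of_nat k) = k.
Proof. lia. Qed.

Lemma zfold_dom (t : Z -> C) (K : R) (B : nat -> R) :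
  (forall k, Cmod (t k) <= K * B (Z.abs_nat k))%R -> ex_series B ->
  ex_Zseries t /\ is_Cseries (zfold t) (ZSeries t) /\ (Cmod (ZSeries t) <= 2 * (K * Series B))%R.
Proof.
  intros H HB.
  assert (HKB : ex_series (fun k => K * B k)%R) by (now apply ex_series_scalR).
  assert (H1 : forall k, (Cmod (t (Z.of_nat k)) <= K * B k)%R) by (intros k; generalize (H (Z.of_nat k)); now rewrite Zabs_nat_pos).
  assert (H2 : forall k, (Cmod (t (- Z.of_nat k)%Z) <= K * B k)%R) by (intros k; generalize (H (- Z.of_nat k)%Z); now rewrite Zabs_nat_neg).
  destruct (zfold_correct t _ H1 H2 HKB) as [X Y]. split; [exact X|]. split; [exact Y|].
  apply (is_Cseries_norm _ (fun k => 2 * (K * B k))%R _ _ ltac:(intros; apply (Cmod_zfold t (fun k => K * B k)%R); auto) Y).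
  apply is_series_scalR. apply is_series_scalR.
  now apply Series_correct.
Qed.

Lemma ex_Cseries_ext a b : (forall n, a n = b n) -> ex_Cseries a -> ex_Cseries b.
Proof. intros E [l Hl]. exists l. eapply is_Cseries_ext; eassumption. Qed.

Lemma ex_Zseries_ext t u : (forall k, t k = u k) -> ex_Zseries t -> ex_Zseries u.
Proof. intros E [H1 H2]. split; [revert H1|revert H2]; apply ex_Cseries_ext; intros; apply E. Qed.

Lemma ex_Zseries_scal c t : ex_Zseries t -> ex_Zseries (fun k => c * t k).
Proof. intros [[l Hl] [m Hm]]. split; eexists; apply is_Cseries_scal; eassumption. Qed.

Lemma ZSeries_ext t u : (forall k, t k = u k) -> ZSeries t = ZSeries u.
Proof.
  intros E. unfold ZSeries, CSeries. f_equal; f_equal; apply Series_ext; intros; now rewrite E.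
Qed.

Lemma ZSeries_scal c t : ex_Zseries t -> ZSeries (fun k => c * t k) = c * ZSeries t.
Proof.
  intros [[l Hl] [m Hm]]. unfold ZSeries.
  rewrite (CSeries_unique _ _ Hl), (CSeries_unique _ _ Hm),
    (CSeries_unique _ _ (is_Cseries_scal c _ _ Hl)), (CSeries_unique _ _ (is_Cseries_scal c _ _ Hm)). ring.
Qed.

Lemma ex_series_ratio (a : nat -> R) (k : R) :
  (forall n, 0 < a n)%R -> (k < 1)%R -> is_lim_seq (fun n => a (S n) / a n)%R k -> ex_series a.
Proof.
  intros Ha Hk Hl.
  apply (ex_series_ext (fun n => Rabs (a n))).
  { intros n. apply Rabs_pos_eq. left; apply Ha. }
  apply (ex_series_DAlembert a k Hk).
  - intros n; apply Rgt_not_eq, Ha.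
  - eapply is_lim_seq_ext; [|exact Hl]. intros n; cbv beta.
    rewrite Rabs_pos_eq; [reflexivity|].
    apply Rlt_le, Rdiv_lt_0_compat; apply Ha.
Qed.

Lemma ex_series_ge0_le (a b : nat -> R) :
  (forall n, 0 <= a n <= b n)%R -> ex_series b -> ex_series a.
Proof.
  intros H. apply (ex_series_le (V := R_CompleteNormedModule)).
  intros n. change (norm (a n)) with (Rabs (a n)). rewrite Rabs_pos_eq; apply H.
Qed.

Lemma lim_inv_INR : is_lim_seq (fun n => / INR (S n))%R 0.
Proof.
  apply (is_lim_seq_incr_1 (fun n => / INR n)%R).
  replace (Finite 0) with (Rbar_inv p_infty) by reflexivity.
  apply is_lim_seq_inv; [apply is_lim_seq_INR|discriminate].
Qed.

Lemma is_series_exp (r : R) : is_series (fun n => r ^ n / INR (fact n))%R (exp r).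
Proof.
  eapply is_series_ext; [|exact (is_exp_Reals r)].
  intros n. rewrite pow_n_pow. reflexivity.
Qed.

Lemma ex_series_inv_sqr : ex_series (fun k => / (1 + INR k) ^ 2)%R.
Proof.
  apply (ex_series_ge0_le _ (fun k => 2 * (/ INR (S k) - / INR (S (S k))))%R).
  - intros k. rewrite !S_INR. assert (H := pos_INR k). split.
    + left. apply Rinv_0_lt_compat, pow_lt. lra.
    + replace (2 * (/ (INR k + 1) - / (INR k + 1 + 1)))%R with (2 / ((INR k + 1) * (INR k + 2)))%R
        by (field; lra).
      apply (Rmult_le_reg_l ((1 + INR k) ^ 2 * (INR k + 2))).
      { apply Rmult_lt_0_compat; [apply pow_lt; lra|lra]. }
      replace ((1 + INR k) ^ 2 * (INR k + 2) * / (1 + INR k) ^ 2)%R with (INR k + 2)%R by (field; lra).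
      replace ((1 + INR k) ^ 2 * (INR k + 2) * (2 / ((INR k + 1) * (INR k + 2))))%R
        with (2 * (1 + INR k))%R by (field; lra). lra.
  - apply ex_series_scalR. exists 1%R. apply is_series_Rsum.
    apply (is_lim_seq_ext (fun n => 1 - / INR (S n))%R).
    + intros n. induction n as [|n IH]; [simpl; field|]. cbn [Rsum]. rewrite <- IH. ring.
    + replace (Finite 1) with (Finite (1 - 0)) by (f_equal; ring).
      apply is_lim_seq_minus'; [apply is_lim_seq_const|apply lim_inv_INR].
Qed.

Lemma is_Cseries_Cexp z : is_Cseries (fun n => z ^ n / RtoC (INR (fact n))) (Cexp z).
Proof.
  apply is_Cseries_lim.
  apply (Clim_is_0 _ _ (fun N => Cmod z ^ N / INR (fact N) * Rmax 1 (exp (Re z)))%R).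
  - intros N. rewrite <- Cmod_opp.
    match goal with |- (Cmod ?a <= _)%R =>
      replace a with (Cexp z - Csum (fun n => z ^ n / RtoC (INR (fact n))) N) by ring end.
    apply Cexp_taylor.
  - replace (Finite 0) with (Finite (0 * Rmax 1 (exp (Re z)))) by (f_equal; ring).
    apply is_lim_seq_mult'; [|apply is_lim_seq_const].
    apply (ex_series_lim_0 (fun N => Cmod z ^ N / INR (fact N))%R). eexists; apply is_series_exp.
Qed.

(** * Euler's expansions of infinite q-products *)

Section QSeries.
Variable q : R.
Hypothesis hq : (0 < q < 1)%R.

Lemma qpow_pos n : (0 < q ^ n)%R.
Proof. apply pow_lt; lra. Qed.
Lemma qpow_le1 n : (q ^ n <= 1)%R.
Proof. induction n; simpl; [lra|]. generalize (qpow_pos n); nra. Qed.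
Lemma qpow_lt1 n : (q ^ S n < 1)%R.
Proof. generalize (qpow_le1 n) (qpow_pos n); simpl; nra. Qed.

(** [(q;q)_n] as a real number. *)
Fixpoint qp (n : nat) : R :=
  match n with O => 1%R | S m => (qp m * (1 - q ^ S m))%R end.

Lemma qpoch_qp n : qpoch (RtoC q) (RtoC q) n = RtoC (qp n).
Proof.
  induction n as [|n IH]; simpl; [reflexivity|].
  rewrite IH, RtoC_mult, RtoC_minus, RtoC_mult, RtoC_pow. reflexivity.
Qed.

Lemma qp_pos n : (0 < qp n)%R.
Proof.
  induction n as [|n IH]; [simpl; lra|]. cbn [qp]. generalize (qpow_lt1 n).
  intros; apply Rmult_lt_0_compat; lra.
Qed.

(** The coefficients of [(q w; q)_oo] as a power series in [w]; their modulus
    is the factor in front of [Psi] in the outer series. *)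
Definition eul_coef (n : nat) : R :=
  ((-1) ^ n * q ^ (n * (n + 1) / 2) / qp n)%R.

Lemma eul_coef_0 : eul_coef 0 = 1%R.
Proof. unfold eul_coef; simpl. field. Qed.

Lemma eul_coef_S n : (eul_coef (S n) = - eul_coef n * q ^ S n / (1 - q ^ S n))%R.
Proof.
  unfold eul_coef.
  replace (S n * (S n + 1) / 2)%nat with (n * (n + 1) / 2 + S n)%nat.
  2: { replace (S n * (S n + 1))%nat with (n * (n + 1) + S n * 2)%nat by lia.
       rewrite Nat.div_add by lia. reflexivity. }
  rewrite pow_add. cbn [qp]. generalize (qpow_lt1 n) (qp_pos n). intros.
  change ((-1) ^ S n)%R with (-1 * (-1) ^ n)%R. field. lra.
Qed.

Lemma eul_coef_abs_S n : (Rabs (eul_coef (S n)) = Rabs (eul_coef n) * (q ^ S n / (1 - q ^ S n)))%R.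
Proof.
  rewrite eul_coef_S. unfold Rdiv. rewrite !Rabs_mult, Rabs_Ropp.
  generalize (qpow_lt1 n) (qpow_pos (S n)). intros.
  rewrite (Rabs_pos_eq (q ^ S n)) by lra. rewrite Rabs_inv, (Rabs_pos_eq (1 - q ^ S n)) by lra.
  ring.
Qed.

Lemma eul_coef_abs_pos n : (0 < Rabs (eul_coef n))%R.
Proof.
  induction n as [|n IH]; [rewrite eul_coef_0, Rabs_R1; lra|].
  rewrite eul_coef_abs_S. generalize (qpow_lt1 n) (qpow_pos (S n)). intros.
  apply Rmult_lt_0_compat; [exact IH|]. apply Rdiv_lt_0_compat; lra.
Qed.

Lemma lim_qpow : is_lim_seq (fun n => q ^ n)%R 0.
Proof. apply is_lim_seq_geom. rewrite Rabs_pos_eq; lra. Qed.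

Lemma lim_INR_qpow : is_lim_seq (fun n => INR (S n) * q ^ n)%R 0.
Proof.
  apply (ex_series_lim_0 (fun n => INR (S n) * q ^ n)%R).
  apply (ex_series_ratio _ q).
  - intros n. apply Rmult_lt_0_compat; [apply lt_0_INR; lia|apply qpow_pos].
  - lra.
  - apply (is_lim_seq_ext (fun n => q + q * / INR (S n))%R).
    + intros n. rewrite (S_INR (S n)). assert (INR (S n) <> 0)%R by (apply not_0_INR; discriminate).
      generalize (qpow_pos n); intros. simpl pow. field. split; lra.
    + replace (Finite q) with (Finite (q + q * 0)) by (f_equal; ring).
      apply is_lim_seq_plus'; [apply is_lim_seq_const|].
      apply is_lim_seq_mult'; [apply is_lim_seq_const|apply lim_inv_INR].
Qed.

(** The Gaussian decay of the coefficients beats the factorial growth of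
    [Gamma] to the right. *)
Lemma ex_series_eul_coef_fact r p : (0 < r)%R ->
  ex_series (fun n => Rabs (eul_coef n) * r ^ n * INR (fact (n + p)))%R.
Proof.
  intros Hr. apply (ex_series_ratio _ 0); [|lra|].
  - intros n. apply Rmult_lt_0_compat; [|apply INR_fact_lt_0].
    apply Rmult_lt_0_compat; [apply eul_coef_abs_pos|now apply pow_lt].
  - apply (is_lim_seq_ext (fun n => / (1 - q ^ S n) * (r * q) *
             (INR (S n) * q ^ n + INR p * q ^ n))%R).
    + intros n. rewrite eul_coef_abs_S. change (S n + p)%nat with (S (n + p)). rewrite fact_simpl, mult_INR.
      replace (INR (S (n + p))) with (INR (S n) + INR p)%R by (rewrite <- plus_INR; reflexivity).
      assert (H1 := eul_coef_abs_pos n). assert (H2 := INR_fact_neq_0 (n + p)).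
      assert (H3 := qpow_lt1 n). assert (r ^ n <> 0)%R by (apply pow_nonzero; lra).
      simpl pow in *. field. repeat split; auto; lra.
    + replace (Finite 0) with (Finite (/ (1 - 0) * (r * q) * (0 + INR p * 0))) by (f_equal; field).
      apply is_lim_seq_mult'.
      * apply is_lim_seq_mult'; [|apply is_lim_seq_const].
        apply (is_lim_seq_inv (fun n => 1 - q ^ S n)%R (1 - 0)%R).
        -- apply is_lim_seq_minus'; [apply is_lim_seq_const|].
           apply (is_lim_seq_incr_1 (fun n => q ^ n)%R), lim_qpow.
        -- intros E. injection E. lra.
      * apply is_lim_seq_plus'; [apply lim_INR_qpow|].
        apply is_lim_seq_mult'; [apply is_lim_seq_const|apply lim_qpow].
Qed.

Lemma fact_ge1 n : (1 <= INR (fact n))%R.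
Proof. replace 1%R with (INR 1) by reflexivity. apply le_INR, lt_O_fact. Qed.

Lemma ex_series_eul_coef r : (0 <= r)%R -> ex_series (fun n => Rabs (eul_coef n) * r ^ n)%R.
Proof.
  intros Hr. apply (ex_series_ge0_le _ (fun n => Rabs (eul_coef n) * (r + 1) ^ n * INR (fact (n + 0)))%R).
  - intros n. assert (H := eul_coef_abs_pos n). split.
    + apply Rmult_le_pos; [lra|now apply pow_le].
    + assert (r ^ n <= (r + 1) ^ n)%R by (apply pow_incr; lra).
      assert (0 <= r ^ n)%R by now apply pow_le.
      assert (F := fact_ge1 (n + 0)).
      assert (Rabs (eul_coef n) * r ^ n <= Rabs (eul_coef n) * (r + 1) ^ n)%R by nra.
      assert (0 <= Rabs (eul_coef n) * r ^ n)%R by (apply Rmult_le_pos; lra). nra.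
  - apply ex_series_eul_coef_fact; lra.
Qed.

(** Euler's expansion of [(q w; q)_oo]. Normalising by [q w] rather than [w]
    puts the value needed on the lattice, [(q^(1-k); q)_oo], at [w = q^(-k)]. *)
Definition eul (w : C) : C := CSeries (fun n => RtoC (eul_coef n) * w ^ n).

Lemma is_Cseries_eul w : is_Cseries (fun n => RtoC (eul_coef n) * w ^ n) (eul w).
Proof.
  apply (CSeries_correct _ (fun n => Rabs (eul_coef n) * Cmod w ^ n)%R).
  - intros n. rewrite Cmod_mult, Cmod_R, Cmod_pow. lra.
  - apply ex_series_eul_coef, Cmod_ge_0.
Qed.

(** The product formula [(q w; q)_oo = (1 - q w) (q^2 w; q)_oo], read off the
    recurrence of the coefficients. *)
Lemma eul_rec w : eul w = (1 - RtoC q * w) * eul (RtoC q * w).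
Proof.
  assert (H : is_Cseries (fun n => RtoC (eul_coef n) * w ^ n - RtoC (eul_coef n) * (RtoC q * w) ^ n)
                (0 + (- (RtoC q * w)) * eul (RtoC q * w))).
  { replace (RtoC 0) with (RtoC (eul_coef 0) * w ^ 0 - RtoC (eul_coef 0) * (RtoC q * w) ^ 0)
      by (simpl; ring).
    apply (is_Cseries_incr_1 (fun n => RtoC (eul_coef n) * w ^ n - RtoC (eul_coef n) * (RtoC q * w) ^ n)).
    eapply is_Cseries_ext; [|apply is_Cseries_scal, is_Cseries_eul]. intros n; cbv beta.
    rewrite eul_coef_S. generalize (qpow_lt1 n); intros Hn.
    assert (Hn' : RtoC (1 - q ^ S n) <> 0) by (apply RtoC_neq_0; lra).
    rewrite RtoC_div by lra. rewrite RtoC_mult, RtoC_opp.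
    rewrite !Cpow_mult_l, <- !RtoC_pow. simpl Cpow.
    replace (RtoC (q ^ n)) with (RtoC (q ^ n)) by reflexivity.
    rewrite RtoC_minus in *. simpl pow in *. rewrite RtoC_mult in *.
 field. exact Hn'. }
  assert (H2 := is_Cseries_minus _ _ _ _ (is_Cseries_eul w) (is_Cseries_eul (RtoC q * w))).
  assert (E := is_Cseries_unique _ _ _ H H2).
  replace (eul w) with ((eul w - eul (RtoC q * w)) + eul (RtoC q * w)) by ring.
  rewrite <- E. ring.
Qed.

(** Continuity at [0] of a power series, along the orbit of [z] under
    multiplication by [q]: what remains after iterating a [q]-recurrence. *)
Lemma power_series_lim_0 (c : nat -> C) (rho : R) (z : C) :
  ex_series (fun n => Cmod (c n) * rho ^ n)%R -> (Cmod z <= rho)%R ->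
  Clim (fun N => CSeries (fun n => c n * (RtoC (q ^ N) * z) ^ n)) (c O).
Proof.
  intros Hs Hz.
  assert (Hz0 := Cmod_ge_0 z).
  assert (Hs1 : ex_series (fun n => Cmod (c (S n)) * rho ^ S n)%R)
    by (now apply -> (ex_series_incr_1 (fun n => Cmod (c n) * rho ^ n)%R)).
  destruct Hs1 as [s Hs1].
  apply (Clim_is_0 _ _ (fun N => q ^ N * s)%R).
  - intros N.
    assert (Hb : forall n, (Cmod (c (S n) * (RtoC (q ^ N) * z) ^ S n) <= q ^ N * (Cmod (c (S n)) * rho ^ S n))%R).
    { intros n. rewrite Cmod_mult, Cmod_pow, Cmod_mult, Cmod_R, Rabs_pos_eq by (left; apply qpow_pos).
      rewrite Rpow_mult_distr.
      assert (Hc := Cmod_ge_0 (c (S n))).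
      assert (H1 : (0 <= Cmod z ^ S n <= rho ^ S n)%R) by (split; [now apply pow_le|apply pow_incr; lra]).
      assert (H2 : (0 <= (q ^ N) ^ S n <= q ^ N)%R).
      { split; [left; apply pow_lt, qpow_pos|].
        assert (Hn := qpow_pos N). assert (Hn' := qpow_le1 N).
        assert (0 <= (q ^ N) ^ n <= 1)%R.
        { split; [left; now apply pow_lt|]. rewrite <- (pow1 n). apply pow_incr; lra. }
        simpl; nra. }
      replace (q ^ N * (Cmod (c (S n)) * rho ^ S n))%R with (Cmod (c (S n)) * (q ^ N * rho ^ S n))%R by ring.
      apply Rmult_le_compat_l; [exact Hc|]. apply Rmult_le_compat; lra. }
    assert (Hss : is_series (fun n => q ^ N * (Cmod (c (S n)) * rho ^ S n))%R (q ^ N * s)%R)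
      by (apply is_series_scalR, Hs1).
    destruct (ex_Cseries_dom _ _ Hb (ex_intro _ _ Hss)) as [l Hl].
    assert (Hl' := is_Cseries_incr_1 (fun n => c n * (RtoC (q ^ N) * z) ^ n) l Hl).
    rewrite (CSeries_unique _ _ Hl'). simpl Cpow.
    replace (c O * 1 + l - c O) with l by ring.
    exact (is_Cseries_norm _ _ _ _ Hb Hl Hss).
  - replace (Finite 0) with (Finite (0 * s)) by (f_equal; ring).
    apply is_lim_seq_mult'; [apply lim_qpow|apply is_lim_seq_const].
Qed.

Lemma eul_lim z : Clim (fun N => eul (RtoC (q ^ N) * z)) 1.
Proof.
  assert (H := power_series_lim_0 (fun n => RtoC (eul_coef n)) (Cmod z) z). cbv beta in H.
  rewrite eul_coef_0 in H. apply H; [|lra].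
  apply (ex_series_ext (fun n => Rabs (eul_coef n) * Cmod z ^ n)%R).
  - intros; now rewrite Cmod_R.
  - apply ex_series_eul_coef, Cmod_ge_0.
Qed.

Lemma eul_qpoch a n : eul (a / RtoC q) = qpoch a (RtoC q) n * eul (RtoC (q ^ n) * (a / RtoC q)).
Proof.
  assert (Hq : RtoC q <> 0) by (apply RtoC_neq_0; lra).
  induction n as [|n IH].
  - simpl. replace (1 * (a / RtoC q)) with (a / RtoC q) by ring. ring.
  - rewrite IH. simpl qpoch. rewrite eul_rec.
    replace (RtoC q * (RtoC (q ^ n) * (a / RtoC q))) with (a * RtoC q ^ n)
      by (rewrite RtoC_pow; field; exact Hq).
    replace (RtoC (q ^ S n) * (a / RtoC q)) with (a * RtoC q ^ n)
      by (rewrite RtoC_pow; simpl Cpow; field; exact Hq).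
    ring.
Qed.

(** By [eul_qpoch] the partial product is [eul (a / q)] divided by a quantity
    that tends to [1]. *)
Lemma qpoch_inf_eul a : qpoch_inf a (RtoC q) = eul (a / RtoC q).
Proof.
  set (G := eul (a / RtoC q)).
  set (v := fun n => eul (RtoC (q ^ n) * (a / RtoC q))).
  assert (Hv : Clim v 1) by apply eul_lim.
  assert (HC : Clim (qpoch a (RtoC q)) G).
  { apply (is_lim_seq_le_le_loc (fun _ => 0%R) _ (fun n => 2 * Cmod G * Cmod (v n - 1)%C)%R).
    - destruct (proj2 (is_lim_seq_spec _ _) Hv (mkposreal (/ 2) ltac:(lra))) as [N HN].
      exists N. intros n Hn. specialize (HN n Hn). simpl in HN.
      rewrite Rminus_0_r, Rabs_pos_eq in HN by apply Cmod_ge_0.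
      split; [apply Cmod_ge_0|].
      assert (EG : G = qpoch a (RtoC q) n * v n) by apply eul_qpoch.
      assert (Hvn : (/ 2 <= Cmod (v n))%R).
      { assert (T := Cmod_triangle (v n) (- (v n - 1))). rewrite Cmod_opp in T.
        replace (v n + - (v n - 1)) with (RtoC 1) in T by ring. rewrite Cmod_1 in T. lra. }
      assert (Hq1 : (Cmod (qpoch a (RtoC q) n) <= 2 * Cmod G)%R).
      { rewrite EG, Cmod_mult. generalize (Cmod_ge_0 (qpoch a (RtoC q) n)). nra. }
      replace (qpoch a (RtoC q) n - G) with (qpoch a (RtoC q) n * (- (v n - 1))) by (rewrite EG; ring).
      rewrite Cmod_mult, Cmod_opp.
      apply Rmult_le_compat_r; [apply Cmod_ge_0|exact Hq1].
    - apply is_lim_seq_const.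
    - apply is_lim_seq_scal_0; exact Hv. }
  apply Clim_split in HC. destruct HC as [H1 H2].
  unfold qpoch_inf, CLim_seq.
  rewrite (is_lim_seq_unique _ _ H1), (is_lim_seq_unique _ _ H2). simpl. symmetry; apply surjective_pairing.
Qed.

Lemma ex_series_inv_qp r : (0 <= r < 1)%R -> ex_series (fun n => r ^ n / qp n)%R.
Proof.
  intros Hr. set (r' := ((r + 1) / 2)%R).
  apply (ex_series_ge0_le _ (fun n => r' ^ n / qp n)%R).
  { intros n. assert (H := qp_pos n). split.
    - apply Rdiv_le_0_compat; [now apply pow_le|exact H].
    - apply Rmult_le_compat_r; [left; now apply Rinv_0_lt_compat|].
      apply pow_incr; unfold r'; lra. }
  apply (ex_series_ratio _ r').
  - intros n. apply Rdiv_lt_0_compat; [apply pow_lt; unfold r'; lra|apply qp_pos].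
  - unfold r'; lra.
  - apply (is_lim_seq_ext (fun n => r' * / (1 - q ^ S n))%R).
    + intros n. cbn [qp]. generalize (qp_pos n) (qpow_lt1 n). intros.
      assert (r' ^ n <> 0)%R by (apply pow_nonzero; unfold r'; lra).
      change (r' ^ S n)%R with (r' * r' ^ n)%R. field. repeat split; auto; lra.
    + replace (Finite r') with (Finite (r' * / (1 - 0))) by (f_equal; field).
      apply is_lim_seq_mult'; [apply is_lim_seq_const|].
      apply (is_lim_seq_inv (fun n => 1 - q ^ S n)%R (1 - 0)%R).
      -- apply is_lim_seq_minus'; [apply is_lim_seq_const|].
         apply (is_lim_seq_incr_1 (fun n => q ^ n)%R), lim_qpow.
      -- intros E. injection E. lra.
Qed.

(** Euler's second expansion, of [1 / (z; q)_oo]. The sum [E] satisfies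
    [(1 - z) E z = E (q z)], hence [E z * eul (z / q)] is unchanged by
    [z -> q z]; along that orbit it tends to [1]. *)
Lemma is_Cseries_inv_eul z : (Cmod z < 1)%R ->
  exists E : C, is_Cseries (fun k => / RtoC (qp k) * z ^ k) E /\ E * eul (z / RtoC q) = 1.
Proof.
  intros Hz. assert (Hz0 := Cmod_ge_0 z).
  assert (Hq : RtoC q <> 0) by (apply RtoC_neq_0; lra).
  set (E := fun w => CSeries (fun k => / RtoC (qp k) * w ^ k)).
  assert (Hm : forall k, Cmod (/ RtoC (qp k)) = (/ qp k)%R).
  { intros k. rewrite Cmod_inv, Cmod_R, Rabs_pos_eq; [reflexivity|left; apply qp_pos|].
    intros X; apply RtoC_inj in X. generalize (qp_pos k); lra. }
  assert (HE : forall w, (Cmod w < 1)%R -> is_Cseries (fun k => / RtoC (qp k) * w ^ k) (E w)).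
  { intros w Hw. apply (CSeries_correct _ (fun k => Cmod w ^ k / qp k)%R).
    - intros k. rewrite Cmod_mult, Hm, Cmod_pow. unfold Rdiv; lra.
    - apply ex_series_inv_qp. split; [apply Cmod_ge_0|exact Hw]. }
  assert (Hqw : forall w, (Cmod w < 1)%R -> (Cmod (RtoC q * w) < 1)%R).
  { intros w Hw. rewrite Cmod_mult, Cmod_R, Rabs_pos_eq by lra. generalize (Cmod_ge_0 w); nra. }
  assert (Hrec : forall w, (Cmod w < 1)%R -> (1 - w) * E w = E (RtoC q * w)).
  { intros w Hw.
    assert (H : is_Cseries (fun k => / RtoC (qp k) * w ^ k - / RtoC (qp k) * (RtoC q * w) ^ k) (0 + w * E w)).
    { replace (RtoC 0) with (/ RtoC (qp 0) * w ^ 0 - / RtoC (qp 0) * (RtoC q * w) ^ 0) by (simpl; ring).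
      apply (is_Cseries_incr_1 (fun k => / RtoC (qp k) * w ^ k - / RtoC (qp k) * (RtoC q * w) ^ k)).
      eapply is_Cseries_ext; [|apply is_Cseries_scal, HE, Hw]. intros k; cbv beta.
      assert (Hk := qpow_lt1 k). assert (Hk2 := qp_pos k).
      assert (X1 : RtoC (qp k) <> 0) by (apply RtoC_neq_0; lra).
      assert (X2 : RtoC (1 - q ^ S k) <> 0) by (apply RtoC_neq_0; lra).
      cbn [qp]. rewrite RtoC_mult, !Cpow_mult_l, <- !RtoC_pow. simpl Cpow.
      rewrite RtoC_minus in *. field. auto. }
    assert (H2 := is_Cseries_minus _ _ _ _ (HE w Hw) (HE _ (Hqw w Hw))).
    assert (X := is_Cseries_unique _ _ _ H H2).
    replace (E (RtoC q * w)) with (E w - (E w - E (RtoC q * w))) by ring. rewrite <- X. ring. }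
  assert (HP : forall N, Cmod (RtoC (q ^ N) * z)%C < 1 /\
     E (RtoC (q ^ N) * z) * eul (RtoC (q ^ N) * (z / RtoC q)) = E z * eul (z / RtoC q)).
  { induction N as [|N [IH1 IH2]].
    - simpl. replace (1 * z) with z by ring. replace (1 * (z / RtoC q)) with (z / RtoC q) by ring. auto.
    - assert (X : RtoC (q ^ S N) * z = RtoC q * (RtoC (q ^ N) * z)) by (simpl pow; rewrite RtoC_mult; ring).
      rewrite X. split; [now apply Hqw|]. rewrite <- IH2, <- Hrec by exact IH1.
      rewrite (eul_rec (RtoC (q ^ N) * (z / RtoC q))).
      replace (RtoC q * (RtoC (q ^ N) * (z / RtoC q))) with (RtoC (q ^ N) * z) by (field; exact Hq).
      replace (RtoC (q ^ S N) * (z / RtoC q)) with (RtoC (q ^ N) * z)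
        by (simpl pow; rewrite RtoC_mult; field; exact Hq).
      ring. }
  exists (E z). split; [apply HE, Hz|].
  apply (Clim_unique (fun N => E (RtoC (q ^ N) * z) * eul (RtoC (q ^ N) * (z / RtoC q)))).
  - eapply Clim_ext; [intros N; symmetry; apply HP|].
    unfold Clim. apply (is_lim_seq_ext (fun _ => 0%R)); [|apply is_lim_seq_const].
    intros _. match goal with |- _ = Cmod ?a => replace a with (RtoC 0) by ring end. now rewrite Cmod_0.
  - assert (L1 : Clim (fun N => E (RtoC (q ^ N) * z)) (/ RtoC (qp 0))).
    { apply (power_series_lim_0 (fun k => / RtoC (qp k)) (Cmod z) z); [|lra].
      eapply ex_series_ext; [|apply (ex_series_inv_qp (Cmod z)); lra].
      intros k; cbv beta. rewrite Hm. unfold Rdiv. apply Rmult_comm. }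
    assert (L2 := eul_lim (z / RtoC q)).
    simpl in L1. replace (/ RtoC 1) with (RtoC 1) in L1 by (field).
    apply Clim_split in L1, L2. apply Clim_split. simpl in *.
    destruct L1 as [L1 L1'], L2 as [L2 L2']. split.
    + replace (Finite 1) with (Finite (1 * 1 - 0 * 0)) by (f_equal; ring).
      apply is_lim_seq_minus'; apply is_lim_seq_mult'; assumption.
    + replace (Finite 0) with (Finite (1 * 0 + 0 * 1)) by (f_equal; ring).
      apply is_lim_seq_plus'; apply is_lim_seq_mult'; assumption.
Qed.

End QSeries.

(** * Integrals over the real line *)

Lemma pow_fact_le_exp p x : (0 <= x)%R -> (x ^ p / INR (fact p) <= exp x)%R.
Proof.
  intros Hx. eapply Rle_trans; [|apply (exp_ge_taylor x p Hx)].
  destruct p as [|p]; [simpl; lra|]. rewrite tech5.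
  assert (0 <= sum_f_R0 (fun k => x ^ k / INR (fact k)) p)%R; [|lra].
  apply cond_pos_sum. intros k. apply Rdiv_le_0_compat; [now apply pow_le|apply INR_fact_lt_0].
Qed.

Lemma pow_exp x n : (exp x ^ n = exp (INR n * x))%R.
Proof.
  induction n as [|n IH]; [simpl; rewrite Rmult_0_l, exp_0; reflexivity|].
  rewrite S_INR. simpl pow. rewrite IH, <- exp_plus. f_equal; ring.
Qed.

(** [1] serves the left half of the line, and the quotient is the constant in
    [t^p <= (p! / c^p) e^(c t)], which serves the right half. *)
Definition decay_const (c : R) (p : nat) : R := (1 + INR (fact p) / c ^ p)%R.

Lemma decay_const_pos c p : (0 < c)%R -> (0 < decay_const c p)%R.
Proof.
  intros Hc. unfold decay_const.
  assert (0 < INR (fact p) / c ^ p)%R; [|lra].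
  apply Rdiv_lt_0_compat; [apply INR_fact_lt_0|now apply pow_lt].
Qed.

(** On the left the factor [exp (sigma y)] decays; on the right
    [exp (- c e^y)] beats the power [(e^y)^p]. *)
Lemma gamma_integrand_bound sigma c a p y :
  (0 < c)%R -> (a <= 1)%R -> (a <= sigma)%R -> (sigma + 1 <= INR p)%R ->
  (exp (sigma * y - c * exp y) <= decay_const c p * exp (- (a * Rabs y)))%R.
Proof.
  intros Hc Ha1 Ha Hp. unfold decay_const.
  assert (HF : (0 < INR (fact p) / c ^ p)%R)
    by (apply Rdiv_lt_0_compat; [apply INR_fact_lt_0|now apply pow_lt]).
  assert (He := exp_pos y).
  destruct (Rle_dec y 0) as [Hy|Hy].
  - rewrite Rabs_left1 by exact Hy.
    apply Rle_trans with (1 * exp (- (a * - y)))%R.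
    + rewrite Rmult_1_l. apply exp_le. nra.
    + apply Rmult_le_compat_r; [left; apply exp_pos|lra].
  - rewrite Rabs_pos_eq by lra.
    apply Rle_trans with (INR (fact p) / c ^ p * exp (- (a * y)))%R.
    2: { apply Rmult_le_compat_r; [left; apply exp_pos|lra]. }
    assert (Hx := pow_fact_le_exp p (c * exp y) ltac:(nra)).
    rewrite Rpow_mult_distr, pow_exp in Hx.
    assert (Hcp : (0 < c ^ p)%R) by now apply pow_lt.
    assert (Hf := INR_fact_lt_0 p).
    assert (Hx2 : (exp (INR p * y) <= INR (fact p) / c ^ p * exp (c * exp y))%R).
    { apply (Rmult_le_reg_l (c ^ p / INR (fact p))); [now apply Rdiv_lt_0_compat|].
      replace (c ^ p / INR (fact p) * (INR (fact p) / c ^ p * exp (c * exp y)))%R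
        with (exp (c * exp y)) by (field; split; lra).
      replace (c ^ p / INR (fact p) * exp (INR p * y))%R
        with (c ^ p * exp (INR p * y) / INR (fact p))%R by (field; lra). exact Hx. }
    apply Rle_trans with (exp (INR p * y) * exp (- (c * exp y) - y))%R.
    { rewrite <- exp_plus. apply exp_le. nra. }
    apply Rle_trans with (INR (fact p) / c ^ p * exp (c * exp y) * exp (- (c * exp y) - y))%R.
    { apply Rmult_le_compat_r; [left; apply exp_pos|exact Hx2]. }
    rewrite Rmult_assoc, <- exp_plus. apply Rmult_le_compat_l; [lra|].
    apply exp_le. nra.
Qed.

Lemma CRInt_tail_bound f K a A B :
  (0 < a)%R -> (0 <= K)%R -> Ccont f -> (forall y, Cmod (f y) <= K * exp (- (a * Rabs y)))%R ->
  (A <= B)%R ->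
  ((0 <= A)%R -> (Cmod (CRInt f A B) <= K / a * exp (- (a * A)))%R) /\
  ((B <= 0)%R -> (Cmod (CRInt f A B) <= K / a * exp (a * B))%R).
Proof.
  intros Ha HK Hc Hf HAB. split; intros H0.
  - apply Rle_trans with (K / a * (exp (- (a * A)) - exp (- (a * B))))%R.
    2: { apply Rmult_le_compat_l; [apply Rdiv_le_0_compat; lra|]. generalize (exp_pos (- (a * B))); lra. }
    apply (is_CRInt_norm f (fun y => K * exp (- (a * y)))%R A B _ _ HAB).
    + intros y Hy. specialize (Hf y). rewrite Rabs_pos_eq in Hf by lra. exact Hf.
    + now apply is_CRInt_ex.
    + apply (is_RInt_FTC (fun y => - (K / a) * exp (- (a * y)))%R).
      * intros x. auto_derive; [exact I|]. field. lra.
      * intros x. auto_derive; exact I.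
      * field; lra.
  - apply Rle_trans with (K / a * (exp (a * B) - exp (a * A)))%R.
    2: { apply Rmult_le_compat_l; [apply Rdiv_le_0_compat; lra|]. generalize (exp_pos (a * A)); lra. }
    apply (is_CRInt_norm f (fun y => K * exp (a * y))%R A B _ _ HAB).
    + intros y Hy. specialize (Hf y). rewrite Rabs_left1 in Hf by lra.
      replace (a * y)%R with (- (a * - y))%R by ring. exact Hf.
    + now apply is_CRInt_ex.
    + apply (is_RInt_FTC (fun y => (K / a) * exp (a * y))%R).
      * intros x. auto_derive; [exact I|]. field. lra.
      * intros x. auto_derive; exact I.
      * field; lra.
Qed.

Lemma CRInt_Chasles f a b c : Ccont f -> CRInt f a b + CRInt f b c = CRInt f a c.
Proof.
  intros H. symmetry. apply is_CRInt_unique.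
  apply (is_RInt_Chasles (V := C_R_NormedModule) f a b c); now apply is_CRInt_ex.
Qed.

Lemma exp_opp_geom a : (0 < a)%R -> (Rabs (exp (- a)) < 1)%R.
Proof.
  intros H. rewrite Rabs_pos_eq by (left; apply exp_pos).
  rewrite <- exp_0. apply exp_increasing. lra.
Qed.

Definition is_lineint (f : R -> C) (l : C) : Prop :=
  Clim (fun n => CRInt f (- INR n) (INR n)) l.

(** The tail bound is kept for all truncations [A <= 0 <= B]: Euler's integral
    needs independent ends, and Poisson summation ends at half-integral
    multiples of the step. *)
Lemma ex_lineint f K a :
  (0 < a)%R -> (0 <= K)%R -> Ccont f -> (forall y, Cmod (f y) <= K * exp (- (a * Rabs y)))%R ->
  exists l, is_lineint f l /\
    forall A B, (A <= 0 <= B)%R ->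
      (Cmod (CRInt f A B - l)%C <= K / a * (exp (a * A) + exp (- (a * B))))%R.
Proof.
  intros Ha HK Hc Hf.
  assert (HKa : (0 <= K / a)%R) by (apply Rdiv_le_0_compat; lra).
  assert (Hcmp : forall A B A' B', (A' <= A)%R -> (A <= 0 <= B)%R -> (B <= B')%R ->
    (Cmod (CRInt f A' B' - CRInt f A B)%C <= K / a * (exp (a * A) + exp (- (a * B))))%R).
  { intros A B A' B' HA [HA0 HB0] HB.
    rewrite <- (CRInt_Chasles f A' A B' Hc), <- (CRInt_Chasles f A B B' Hc).
    replace (CRInt f A' A + (CRInt f A B + CRInt f B B') - CRInt f A B)
      with (CRInt f A' A + CRInt f B B') by ring.
    eapply Rle_trans; [apply Cmod_triangle|].
    destruct (CRInt_tail_bound f K a A' A Ha HK Hc Hf HA) as [_ P].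
    destruct (CRInt_tail_bound f K a B B' Ha HK Hc Hf HB) as [Q _].
    specialize (P HA0). specialize (Q HB0). lra. }
  set (u := fun n => CRInt f (- INR n) (INR n)).
  destruct (ex_Cseries_dom (fun n => u (S n) - u n) (fun n => (K / a * 2) * exp (- a) ^ n)%R) as [l Hl].
  { intros n. unfold u. rewrite S_INR. assert (Hn := pos_INR n).
    eapply Rle_trans; [apply Hcmp; lra|]. rewrite pow_exp.
    replace (a * - INR n)%R with (INR n * - a)%R by ring.
    replace (- (a * INR n))%R with (INR n * - a)%R by ring. lra. }
  { apply ex_series_scalR. apply ex_series_geom.
    apply exp_opp_geom. lra. }
  apply is_Cseries_lim in Hl.
  assert (Hu : Clim u (u O + l)).
  { unfold Clim in *. eapply is_lim_seq_ext; [|exact Hl]. intros n; cbv beta. f_equal.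
    assert (E : Csum (fun n => u (S n) - u n) n = u n - u O).
    { induction n as [|n IH]; cbn [Csum]; [ring|]. rewrite IH. ring. }
    rewrite E. ring. }
  exists (u O + l). split; [exact Hu|].
  intros A B HAB.
  replace (CRInt f A B - (u O + l)) with (- (u O + l - CRInt f A B)) by ring. rewrite Cmod_opp.
  refine (Clim_bound u _ _ (fun _ => _) _ Hu (is_lim_seq_const _) _).
  destruct (nfloor_ex (Rmax (- A) B)) as [N HN].
  { eapply Rle_trans; [|apply Rmax_r]. lra. }
  exists (S N). intros n Hn. apply le_INR in Hn. rewrite S_INR in Hn.
  generalize (Rmax_l (- A) B) (Rmax_r (- A) B). intros.
  apply Hcmp; lra.
Qed.

Lemma is_lineint_unique f l m : is_lineint f l -> is_lineint f m -> l = m.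
Proof. apply Clim_unique. Qed.

Lemma is_lineint_plus f g l m : Ccont f -> Ccont g ->
  is_lineint f l -> is_lineint g m -> is_lineint (fun y => f y + g y) (l + m).
Proof.
  intros Cf Cg Hf Hg. unfold is_lineint.
  eapply Clim_ext; [|apply Clim_plus; [exact Hf|exact Hg]].
  intros n; cbv beta. symmetry. apply is_CRInt_unique, is_CRInt_plus; now apply is_CRInt_ex.
Qed.

Lemma is_lineint_scal c f l : Ccont f ->
  is_lineint f l -> is_lineint (fun y => c * f y) (c * l).
Proof.
  intros Cf Hf. unfold is_lineint.
  eapply Clim_ext; [|apply Clim_scal; exact Hf].
  intros n; cbv beta. symmetry. apply is_CRInt_unique, is_CRInt_scal; now apply is_CRInt_ex.
Qed.

Lemma is_lineint_ext f g l : (forall y, f y = g y) -> Ccont f -> is_lineint f l -> is_lineint g l.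
Proof.
  intros E Cf. apply Clim_ext. intros n. symmetry. apply is_CRInt_unique.
  eapply is_CRInt_ext; [exact E|]. now apply is_CRInt_ex.
Qed.

Lemma is_lineint_FTC f df K a : (0 < a)%R ->
  (forall t, cderive f t (df t)) -> Ccont df ->
  (forall y, Cmod (f y) <= K * exp (- (a * Rabs y)))%R -> is_lineint df 0.
Proof.
  intros Ha Hf Hc Hb.
  apply (Clim_is_0 _ _ (fun n => 2 * K * exp (- a) ^ n)%R).
  - intros n. rewrite (is_CRInt_unique _ _ _ _ (is_CRInt_FTC f df (- INR n) (INR n) Hf Hc)).
    replace (f (INR n) - f (- INR n)%R - 0) with (f (INR n) + - f (- INR n)%R) by ring.
    eapply Rle_trans; [apply Cmod_triangle|]. rewrite Cmod_opp, pow_exp.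
    assert (H1 := Hb (INR n)). assert (H2 := Hb (- INR n)%R).
    rewrite Rabs_Ropp in H2. rewrite Rabs_pos_eq in H1, H2 by apply pos_INR.
    replace (INR n * - a)%R with (- (a * INR n))%R by ring. lra.
  - apply is_lim_seq_scal_0. apply is_lim_seq_geom.
    apply exp_opp_geom. lra.
Qed.

(** Over [N] equal pieces the total increment is at most [K / N]. Verifying a
    quadratic bound takes only an estimate of remainders, so this replaces
    differentiation under integrals and sums. *)
Lemma quadratic_increments_const (D : R -> C) K :
  (forall t t', (0 <= t <= 1)%R -> (0 <= t' <= 1)%R ->
     (Cmod (D t' - D t)%C <= K * (t' - t) ^ 2)%R) -> D 1%R = D 0%R.
Proof.
  intros H.
  assert (HN : forall N k, (k <= S N)%nat ->
    (Cmod (D (INR k / INR (S N))%R - D 0%R)%C <= INR k * (K / INR (S N) ^ 2))%R).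
  { intros N k. assert (HS : (0 < INR (S N))%R) by (apply lt_0_INR; lia).
    induction k as [|k IH]; intros Hk.
    - simpl INR at 1. replace (0 / INR (S N))%R with 0%R by (field; lra).
      replace (D 0%R - D 0%R) with (RtoC 0) by ring. rewrite Cmod_0; simpl; lra.
    - specialize (IH ltac:(lia)).
      replace (D (INR (S k) / INR (S N))%R - D 0%R)
        with ((D (INR (S k) / INR (S N))%R - D (INR k / INR (S N))%R) + (D (INR k / INR (S N))%R - D 0%R)) by ring.
      eapply Rle_trans; [apply Cmod_triangle|].
      assert (Hkr : (INR (S k) <= INR (S N))%R) by (apply le_INR; lia).
      assert (Hk0 := pos_INR k). rewrite (S_INR k) in *.
      assert (X : forall j, (0 <= j <= INR (S N))%R -> (0 <= j / INR (S N) <= 1)%R).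
      { intros j Hj. split; [apply Rdiv_le_0_compat; lra|].
        apply (Rmult_le_reg_r (INR (S N))); [exact HS|]. unfold Rdiv. rewrite Rmult_assoc, Rinv_l; lra. }
      specialize (H (INR k / INR (S N))%R ((INR k + 1) / INR (S N))%R (X (INR k) ltac:(lra)) (X (INR k + 1)%R ltac:(lra))).
      replace (K * ((INR k + 1) / INR (S N) - INR k / INR (S N)) ^ 2)%R with (K / INR (S N) ^ 2)%R in H
        by (field; lra).
      lra. }
  assert (HL : (Cmod (D 1%R - D 0%R)%C <= 0)%R).
  { apply (is_lim_seq_le (fun _ => Cmod (D 1%R - D 0%R)%C) (fun N => K * / INR (S N))%R (Cmod (D 1%R - D 0%R)%C) 0%R).
    - intros N. specialize (HN N (S N) (le_n _)).
      assert (HS : (0 < INR (S N))%R) by (apply lt_0_INR; lia).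
      replace (INR (S N) / INR (S N))%R with 1%R in HN by (field; lra).
      replace (K * / INR (S N))%R with (INR (S N) * (K / INR (S N) ^ 2))%R by (field; lra). exact HN.
    - apply is_lim_seq_const.
    - apply is_lim_seq_scal_0; apply lim_inv_INR. }
  now apply Cmod_minus_le_0.
Qed.

(** * Euler's integral and the Gamma function *)

(** Under [t = e^w] the measure [t^(s-1) e^(-t) dt] becomes [phi s w dw], and
    [phi s] is entire: rotating the ray in [t] is shifting the line in [w]. *)
Definition phi (s w : C) : C := Cexp (s * w - Cexp w).

(** The integrand of [Gamma s x^(-s)], [x = e^L], in the variable [log t]. *)
Definition Phi (s L : C) (y : R) : C := Cexp (s * RtoC y - Cexp (RtoC y + L)).

Lemma phi_Phi s L y : phi s (RtoC y + L) = Cexp (s * L) * Phi s L y.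
Proof. unfold phi, Phi. rewrite <- Cexp_add. f_equal. ring. Qed.

Lemma cderive_phi s L y :
  cderive (fun y => phi s (RtoC y + L)) y ((s - Cexp (RtoC y + L)) * phi s (RtoC y + L)).
Proof.
  unfold phi.
  assert (H1 : cderive (fun y => RtoC y + L) y (1 + 0)) by (apply cderive_plus; [apply cderive_id|apply cderive_const]).
  eapply cderive_ext_l.
  2: { apply cderive_exp, cderive_minus; [apply cderive_scal, H1|apply cderive_exp, H1]. }
  cbv beta. ring.
Qed.

Lemma cderive_Phi s L y : cderive (Phi s L) y ((s - Cexp (RtoC y + L)) * Phi s L y).
Proof.
  assert (H1 : cderive (fun y => RtoC y + L) y (1 + 0)) by (apply cderive_plus; [apply cderive_id|apply cderive_const]).
  eapply cderive_ext_l.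
  2: { unfold Phi. apply cderive_exp, cderive_minus; [apply cderive_scal, cderive_id|apply cderive_exp, H1]. }
  unfold Phi. cbv beta. ring.
Qed.

Lemma Ccont_Phi s L : Ccont (Phi s L).
Proof. eapply cderive_Ccont. intros; apply cderive_Phi. Qed.

Lemma Ccont_phi s L : Ccont (fun y => phi s (RtoC y + L)).
Proof. eapply cderive_Ccont. intros; apply cderive_phi. Qed.

Lemma Ccont_dPhi s L : Ccont (fun y => (s - Cexp (RtoC y + L)) * Phi s L y).
Proof.
  apply Ccont_mult; [|apply Ccont_Phi].
  eapply cderive_Ccont. intros t. apply cderive_minus; [apply cderive_const|].
  apply cderive_exp, cderive_plus; [apply cderive_id|apply cderive_const].
Qed.

Lemma Ccont_dphi s L : Ccont (fun y => (s - Cexp (RtoC y + L)) * phi s (RtoC y + L)).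
Proof.
  apply Ccont_mult; [|apply Ccont_phi].
  eapply cderive_Ccont. intros t. apply cderive_minus; [apply cderive_const|].
  apply cderive_exp, cderive_plus; [apply cderive_id|apply cderive_const].
Qed.

(** The logarithms of the [x] with [0 < Re x]. *)
Notation in_strip L := (Rabs (Im L) < PI / 2)%R.

(** [Re e^L], the rate at which [e^(- x t)] decays when [x = e^L]. *)
Definition rate (L : C) : R := (exp (Re L) * cos (Im L))%R.

Lemma rate_pos L : in_strip L -> (0 < rate L)%R.
Proof.
  intros H. apply Rmult_lt_0_compat; [apply exp_pos|].
  apply Rabs_def2 in H. apply cos_gt_0; lra.
Qed.

Lemma Cmod_Phi s L y : Cmod (Phi s L y) = exp (Re s * y - rate L * exp y).
Proof.
  unfold Phi. rewrite Cmod_Cexp. f_equal. unfold rate, Cexp.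
  destruct s, L; simpl. rewrite exp_plus, Rplus_0_l. ring.
Qed.

Lemma lineint_norm f l K a :
  (0 < a)%R -> (0 <= K)%R -> Ccont f -> (forall y, Cmod (f y) <= K * exp (- (a * Rabs y)))%R ->
  is_lineint f l -> (Cmod l <= 2 * K / a)%R.
Proof.
  intros Ha HK Hc Hf Hl.
  destruct (ex_lineint f K a Ha HK Hc Hf) as [m [Hm Hb]].
  rewrite (is_lineint_unique _ _ _ Hl Hm). specialize (Hb 0%R 0%R ltac:(lra)).
  assert (E : CRInt f 0 0 = RtoC 0) by exact (RInt_point (V := C_R_CompleteNormedModule) 0 f).
  rewrite E in Hb. replace (RtoC 0 - m) with (- m) in Hb by ring. rewrite Cmod_opp in Hb.
  rewrite !Rmult_0_r, Ropp_0, exp_0 in Hb.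
  replace (2 * K / a)%R with (K / a * (1 + 1))%R by (field; lra). exact Hb.
Qed.

(** [phi' = (s - e^w) phi], and the remainder is controlled by the second-order
    Taylor bound for the exponential, applied to the increment of the exponent
    and to [d] itself. Each derivative costs a factor [|s| + e^(Re w)], which
    the decay of [phi] absorbs. *)
Lemma phi_quad s w d l : (Cmod d <= l)%R ->
  (Cmod (phi s (w + d) - phi s w - d * ((s - Cexp w) * phi s w))%C
   <= Cmod d ^ 2 * (1 + Cmod s + exp l * exp (Re w)) ^ 2 * (Cmod (phi s w) + Cmod (phi s (w + d))))%R.
Proof.
  intros Hd.
  set (z := s * d - Cexp w * (Cexp d - 1)).
  assert (Ez : phi s (w + d) = phi s w * Cexp z).
  { unfold phi, z. rewrite <- Cexp_add. f_equal. rewrite Cexp_add. ring. }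
  assert (Hd0 := Cmod_ge_0 d). assert (Hs0 := Cmod_ge_0 s).
  assert (He := exp_pos (Re w)). assert (Hl : (1 <= exp l)%R) by (rewrite <- exp_0; apply exp_le; lra).
  assert (Hel : (exp (Cmod d) <= exp l)%R) by (apply exp_le; lra).
  assert (Hz : (Cmod z <= Cmod d * (1 + Cmod s + exp l * exp (Re w)))%R).
  { unfold z. eapply Rle_trans; [apply Cmod_triangle|]. rewrite Cmod_opp, !Cmod_mult, Cmod_Cexp.
    assert (H := Cmod_Cexp_sub1 d).
    assert (Cmod (Cexp d - 1)%C <= Cmod d * exp l)%R by (eapply Rle_trans; [exact H|]; nra). nra. }
  set (Q := (1 + Cmod s + exp l * exp (Re w))%R) in *.
  assert (HQ : (exp l * exp (Re w) <= Q)%R) by (unfold Q; lra).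
  assert (HQ1 : (1 <= Q)%R) by (unfold Q; nra).
  replace (phi s (w + d) - phi s w - d * ((s - Cexp w) * phi s w))
    with (phi s w * (Cexp z - 1 - z) + phi s w * (- (Cexp w * (Cexp d - 1 - d)))).
  2: { rewrite Ez. unfold z. ring. }
  eapply Rle_trans; [apply Cmod_triangle|]. rewrite !Cmod_mult, Cmod_opp, Cmod_mult, Cmod_Cexp.
  assert (Hp0 := Cmod_ge_0 (phi s w)).
  assert (A1 : (Cmod (phi s w) * Cmod (Cexp z - 1 - z)%C
     <= Cmod d ^ 2 * Q ^ 2 / 2 * (Cmod (phi s w) + Cmod (phi s (w + d))))%R).
  { assert (H := Cmod_Cexp_sub2 z).
    assert (Hz2 : (Cmod z ^ 2 <= Cmod d ^ 2 * Q ^ 2)%R).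
    { rewrite <- Rpow_mult_distr. apply pow_incr. split; [apply Cmod_ge_0|exact Hz]. }
    assert (Hmx : (Rmax 1 (exp (Re z)) <= 1 + exp (Re z))%R).
    { apply Rmax_lub; generalize (exp_pos (Re z)); lra. }
    rewrite Ez, Cmod_mult, Cmod_Cexp.
    assert (0 <= Rmax 1 (exp (Re z)))%R by (eapply Rle_trans; [|apply Rmax_l]; lra).
    assert (Cmod (Cexp z - 1 - z)%C <= Cmod d ^ 2 * Q ^ 2 / 2 * (1 + exp (Re z)))%R.
    { eapply Rle_trans; [exact H|]. apply Rmult_le_compat; [|assumption|lra|assumption].
      generalize (pow2_ge_0 (Cmod z)); lra. }
    replace (Cmod d ^ 2 * Q ^ 2 / 2 * (Cmod (phi s w) + Cmod (phi s w) * exp (Re z)))%R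
      with (Cmod (phi s w) * (Cmod d ^ 2 * Q ^ 2 / 2 * (1 + exp (Re z))))%R by field.
    apply Rmult_le_compat_l; assumption. }
  assert (A2 : (Cmod (phi s w) * (exp (Re w) * Cmod (Cexp d - 1 - d)%C)
     <= Cmod d ^ 2 * Q ^ 2 / 2 * Cmod (phi s w))%R).
  { assert (H := Cmod_Cexp_sub2 d).
    assert (Hmx : (Rmax 1 (exp (Re d)) <= exp l)%R).
    { apply Rmax_lub; [exact Hl|]. apply exp_le. eapply Rle_trans; [apply Rle_abs|].
      eapply Rle_trans; [apply Rabs_Re_le|exact Hd]. }
    assert (H2 : (Cmod (Cexp d - 1 - d)%C <= Cmod d ^ 2 / 2 * exp l)%R).
    { eapply Rle_trans; [exact H|]. apply Rmult_le_compat_l; [|exact Hmx].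
      generalize (pow2_ge_0 (Cmod d)); lra. }
    rewrite (Rmult_comm (Cmod d ^ 2 * Q ^ 2 / 2)). apply Rmult_le_compat_l; [exact Hp0|].
    apply Rle_trans with (Cmod d ^ 2 / 2 * (exp l * exp (Re w)))%R; [nra|].
    replace (Cmod d ^ 2 * Q ^ 2 / 2)%R with (Cmod d ^ 2 / 2 * (Q * Q))%R by field.
    apply Rmult_le_compat_l; [generalize (pow2_ge_0 (Cmod d)); lra|]. nra. }
  assert (Hp1 := Cmod_ge_0 (phi s (w + d))).
  assert (H0 : (0 <= Cmod d ^ 2 * Q ^ 2)%R) by (apply Rmult_le_pos; apply pow2_ge_0).
  nra.
Qed.

Lemma cos_shrink b t : (Rabs b < PI / 2)%R -> (0 <= t <= 1)%R -> (cos b <= cos (t * b))%R.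
Proof.
  intros Hb Ht.
  assert (E : forall x, cos x = cos (Rabs x)).
  { intros x. unfold Rabs. destruct (Rcase_abs x); [now rewrite cos_neg|reflexivity]. }
  rewrite (E b), (E (t * b)%R), Rabs_mult, (Rabs_pos_eq t) by lra.
  assert (H0 := Rabs_pos b). apply cos_decr_1; nra.
Qed.

Lemma phi_bound s L t y : in_strip L -> (0 <= t <= 1)%R ->
  (Cmod (phi s (RtoC y + RtoC t * L)%C) <=
   exp (Cmod s * Cmod L) * exp (Re s * y - exp (- Cmod L) * cos (Im L) * exp y))%R.
Proof.
  intros HL Ht. rewrite phi_Phi, Cmod_mult, Cmod_Cexp, Cmod_Phi.
  apply Rmult_le_compat; try (left; apply exp_pos).
  - apply exp_le. eapply Rle_trans; [apply Rle_abs|].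
    eapply Rle_trans; [apply Rabs_Re_le|]. rewrite !Cmod_mult, Cmod_R, Rabs_pos_eq by lra.
    assert (H1 := Cmod_ge_0 s). assert (H2 := Cmod_ge_0 L).
    assert (0 <= Cmod s * Cmod L)%R by now apply Rmult_le_pos. nra.
  - apply exp_le. apply Rplus_le_compat_l, Ropp_le_contravar, Rmult_le_compat_r; [left; apply exp_pos|].
    unfold rate. replace (Re (RtoC t * L)) with (t * Re L)%R by (destruct L; simpl; ring).
    replace (Im (RtoC t * L)) with (t * Im L)%R by (destruct L; simpl; ring).
    apply Rmult_le_compat; [left; apply exp_pos| | |now apply cos_shrink].
    + left. apply Rabs_def2 in HL. apply cos_gt_0; lra.
    + apply exp_le. assert (H := Rabs_Re_le L).
      apply Rabs_le_between in H. assert (H2 := Cmod_ge_0 L). nra.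
Qed.

(** As a function of [f], for use with [quadratic_increments_const]. *)
Definition lineint (f : R -> C) : C := CLim_seq (fun n => CRInt f (- INR n) (INR n)).

Lemma lineint_unique f l : is_lineint f l -> lineint f = l.
Proof.
  intros H. apply Clim_split in H. destruct H as [H1 H2].
  unfold lineint, CLim_seq. rewrite (is_lim_seq_unique _ _ H1), (is_lim_seq_unique _ _ H2).
  symmetry. apply surjective_pairing.
Qed.

(** Cauchy's theorem for a strip, along the path [t L]: the integral of
    [phi s (y + t L)] over [y] changes by a quantity quadratic in the increment
    of [t], since the linear term is the integral of a derivative. *)
Lemma lineint_rotation s L : (0 < Re s)%R -> in_strip L ->
  exists l, is_lineint (Phi s 0) l /\ is_lineint (Phi s L) (Cexp (- (s * L)) * l).
Proof.
  intros Hs HL.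
  destruct (nat_above (Re s + 3)) as [p Hp].
  destruct (Rmin1_pos (Re s) Hs) as [Ha [Ha1 Has]]. set (a := Rmin 1 (Re s)) in *.
  set (c0 := (exp (- Cmod L) * cos (Im L))%R).
  assert (Hc0 : (0 < c0)%R).
  { apply Rmult_lt_0_compat; [apply exp_pos|]. apply Rabs_def2 in HL. apply cos_gt_0; lra. }
  set (K := decay_const c0 p).
  assert (HK : (0 <= K)%R) by (left; now apply decay_const_pos).
  assert (B : forall k y, (0 <= k <= 2)%R ->
     (exp ((Re s + k) * y - c0 * exp y) <= K * exp (- (a * Rabs y)))%R).
  { intros k y Hk. apply gamma_integrand_bound; lra. }
  set (M := exp (Cmod s * Cmod L)). assert (HM : (0 < M)%R) by apply exp_pos.
  assert (Bphi : forall t y, (0 <= t <= 1)%R ->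
     (Cmod (phi s (RtoC y + RtoC t * L)%C) <= M * K * exp (- (a * Rabs y)))%R).
  { intros t y Ht. eapply Rle_trans; [now apply phi_bound|].
    fold M c0. rewrite Rmult_assoc. apply Rmult_le_compat_l; [lra|].
    specialize (B 0%R y ltac:(lra)). rewrite Rplus_0_r in B. exact B. }
  set (f := fun (t y : R) => phi s (RtoC y + RtoC t * L)).
  assert (Cf : forall t, Ccont (f t)) by (intros t; apply Ccont_phi).
  assert (HMK : (0 <= M * K)%R) by (apply Rmult_le_pos; lra).
  assert (Ef : forall t, (0 <= t <= 1)%R -> is_lineint (f t) (lineint (f t))).
  { intros t Ht. destruct (ex_lineint (f t) (M * K) a Ha HMK (Cf t)) as [l [Hl _]].
    - intros y. now apply Bphi.
    - now rewrite (lineint_unique _ _ Hl). }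
  set (E := exp (Cmod L)). assert (HE : (1 <= E)%R) by (unfold E; rewrite <- exp_0; apply exp_le, Cmod_ge_0).
  assert (Hs0 := Cmod_ge_0 s). assert (HL0 := Cmod_ge_0 L).
  set (W := (1 + Cmod s + E * E)%R).
  assert (HW : (0 <= W)%R) by (unfold W; nra).
  assert (Hconst : lineint (f 1%R) = lineint (f 0%R)).
  { apply (quadratic_increments_const (fun t => lineint (f t)) (2 * (W ^ 2 * (2 * M) * (4 * K)) / a * Cmod L ^ 2)%R).
    intros t t' Ht Ht'.
    set (d := RtoC (t' - t) * L).
    assert (Hd : Cmod d = (Rabs (t' - t) * Cmod L)%R) by (unfold d; now rewrite Cmod_mult, Cmod_R).
    assert (Hd1 : (Cmod d <= Cmod L)%R).
    { rewrite Hd. assert (Rabs (t' - t) <= 1)%R by (apply Rabs_le; lra). nra. }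
    set (dphi := fun y : R => (s - Cexp (RtoC y + RtoC t * L)) * phi s (RtoC y + RtoC t * L)).
    assert (Cd : Ccont dphi) by apply Ccont_dphi.
    assert (Hdl : is_lineint dphi 0).
    { apply (is_lineint_FTC (f t) dphi (M * K) a Ha).
      - intros y. apply cderive_phi.
      - exact Cd.
      - intros y. now apply Bphi. }
    set (r := fun y => (f t' y + (-(1)) * f t y) + (- d) * dphi y).
    assert (Cr : Ccont r).
    { apply Ccont_plus; [apply Ccont_plus; [apply Cf|]|]; apply Ccont_mult; try apply Ccont_const; auto. }
    assert (Hr : is_lineint r (lineint (f t') - lineint (f t))).
    { replace (lineint (f t') - lineint (f t)) with
        ((lineint (f t') + (-(1)) * lineint (f t)) + (- d) * 0) by ring.
      apply is_lineint_plus.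
      - apply Ccont_plus; [apply Cf|apply Ccont_mult; [apply Ccont_const|apply Cf]].
      - apply Ccont_mult; [apply Ccont_const|exact Cd].
      - apply is_lineint_plus; [apply Cf|apply Ccont_mult; [apply Ccont_const|apply Cf]|now apply Ef|].
        apply is_lineint_scal; [apply Cf|now apply Ef].
      - now apply is_lineint_scal. }
    replace (2 * (W ^ 2 * (2 * M) * (4 * K)) / a * Cmod L ^ 2 * (t' - t) ^ 2)%R
      with (2 * (Cmod d ^ 2 * (W ^ 2 * (2 * M) * (4 * K))) / a)%R.
    2: { rewrite Hd, Rpow_mult_distr, pow2_abs. field; lra. }
    apply (lineint_norm r _ (Cmod d ^ 2 * (W ^ 2 * (2 * M) * (4 * K)))%R a Ha).
    - assert (H1 := pow2_ge_0 (Cmod d)). assert (H2 := pow2_ge_0 W).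
      apply Rmult_le_pos; [exact H1|]. apply Rmult_le_pos; [|lra].
      apply Rmult_le_pos; [exact H2|lra].
    - exact Cr.
    - intros y.
      replace (r y) with (phi s ((RtoC y + RtoC t * L) + d) - phi s (RtoC y + RtoC t * L)
         - d * ((s - Cexp (RtoC y + RtoC t * L)) * phi s (RtoC y + RtoC t * L))).
      2: { unfold r, f, dphi, d. replace (RtoC y + RtoC t * L + RtoC (t' - t) * L) with (RtoC y + RtoC t' * L)
             by (rewrite RtoC_minus; ring). ring. }
      eapply Rle_trans; [apply (phi_quad _ _ _ (Cmod L) Hd1)|].
      replace (RtoC y + RtoC t * L + d) with (RtoC y + RtoC t' * L)
        by (unfold d; rewrite RtoC_minus; ring).
      assert (Hy := exp_pos y).
      assert (HRe : (exp (Re (RtoC y + RtoC t * L)) <= E * exp y)%R).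
      { unfold E. rewrite <- exp_plus. apply exp_le.
        replace (Re (RtoC y + RtoC t * L)) with (y + t * Re L)%R by (destruct L; simpl; ring).
        assert (H := Rabs_Re_le L). apply Rabs_le_between in H. nra. }
      fold E.
      assert (HQ : (0 <= 1 + Cmod s + E * exp (Re (RtoC y + RtoC t * L)) <= W * (1 + exp y))%R).
      { split; [generalize (exp_pos (Re (RtoC y + RtoC t * L))); nra|]. unfold W. nra. }
      apply (pow_incr _ _ 2) in HQ. rewrite Rpow_mult_distr in HQ.
      assert (P1 := phi_bound s L t y HL Ht). assert (P2 := phi_bound s L t' y HL Ht').
      fold c0 M in P1, P2. set (ex := exp (Re s * y - c0 * exp y)) in *.
      assert (Hex : (0 < ex)%R) by apply exp_pos.
      assert (Hfin : ((1 + exp y) ^ 2 * ex <= 4 * K * exp (- (a * Rabs y)))%R).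
      { assert (B0 := B 0%R y ltac:(lra)). assert (B1 := B 1%R y ltac:(lra)). assert (B2 := B 2%R y ltac:(lra)).
        assert (X : forall k, exp ((Re s + k) * y - c0 * exp y) = (exp (k * y) * ex)%R).
        { intros k. unfold ex. rewrite <- exp_plus. f_equal. ring. }
        rewrite X in B0, B1, B2. rewrite Rmult_0_l, exp_0 in B0. rewrite Rmult_1_l in B0, B1.
        replace (2 * y)%R with (y + y)%R in B2 by ring. rewrite exp_plus in B2. nra. }
      rewrite !Rmult_assoc. apply Rmult_le_compat_l; [apply pow2_ge_0|].
      apply Rle_trans with (W ^ 2 * (1 + exp y) ^ 2 * (2 * M * ex))%R.
      + apply Rmult_le_compat; [apply pow2_ge_0| |exact HQ|lra].
        generalize (Cmod_ge_0 (phi s (RtoC y + RtoC t * L))) (Cmod_ge_0 (phi s (RtoC y + RtoC t' * L))); lra.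
      + replace (W ^ 2 * (1 + exp y) ^ 2 * (2 * M * ex))%R
          with (W ^ 2 * (2 * M) * ((1 + exp y) ^ 2 * ex))%R by ring.
        replace (W ^ 2 * (2 * (M * (4 * (K * exp (- (a * Rabs y)))))))%R
          with (W ^ 2 * (2 * M) * (4 * K * exp (- (a * Rabs y))))%R by ring.
        apply Rmult_le_compat_l; [|exact Hfin].
        apply Rmult_le_pos; [apply pow2_ge_0|lra].
    - exact Hr. }
  exists (lineint (f 0%R)). split.
  - apply (is_lineint_ext (f 0%R)); [|apply Cf|apply Ef; lra].
    intros y. unfold f, phi, Phi. replace (RtoC y + RtoC 0 * L) with (RtoC y + 0) by ring.
    f_equal. ring.
  - rewrite <- Hconst.
    apply (is_lineint_ext (fun y => Cexp (- (s * L)) * f 1%R y)).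
    + intros y. unfold f. replace (RtoC y + RtoC 1 * L) with (RtoC y + L) by ring.
      rewrite phi_Phi, Cmult_assoc, <- Cexp_add.
      replace (- (s * L) + s * L) with (RtoC 0) by ring. rewrite Cexp_0. ring.
    + apply Ccont_mult; [apply Ccont_const|apply Cf].
    + apply is_lineint_scal; [apply Cf|apply Ef; lra].
Qed.

(** The substitution [t = e^y], which makes both ends converge exponentially. *)
Lemma Gamma_integral_lineint s : (0 < Re s)%R -> is_lineint (Phi s 0) (Gamma_integral s).
Proof.
  intros Hs.
  destruct (nat_above (Re s + 1)) as [p Hp].
  destruct (Rmin1_pos (Re s) Hs) as [Ha [Ha1 Has]]. set (a := Rmin 1 (Re s)) in *.
  assert (Hr0 : rate 0 = 1%R) by (unfold rate; simpl; rewrite exp_0, cos_0; ring).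
  set (K := decay_const 1 p).
  assert (HK : (0 < K)%R) by (apply decay_const_pos; lra).
  destruct (ex_lineint (Phi s 0) K a Ha (Rlt_le _ _ HK) (Ccont_Phi s 0)) as [l [Hl Ht]].
  { intros y. rewrite Cmod_Phi, Hr0. apply gamma_integrand_bound; lra. }
  replace (Gamma_integral s) with l; [exact Hl|]. symmetry.
  unfold Gamma_integral. apply (is_RInt_gen_unique (V := C_R_CompleteNormedModule)).
  set (g := fun t : R => Cpower (RtoC t) (s - 1) * RtoC (exp (- t))).
  assert (HI : forall x y, (0 < x)%R -> (x <= y)%R -> is_CRInt g x y (CRInt (Phi s 0) (ln x) (ln y))).
  { intros x y Hx Hxy.
    apply (is_RInt_ext (V := C_R_NormedModule) (fun t : R => scal (/ t)%R (Phi s 0 (ln t) : C_R_NormedModule))).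
    - intros t Ht0. rewrite Rmin_left, Rmax_right in Ht0 by exact Hxy.
      assert (H0 : (0 < t)%R) by lra.
      unfold g, Cpower. rewrite Clog_RtoC by exact H0.
      transitivity (RtoC (/ t) * Phi s 0 (ln t)).
      + symmetry. apply scal_RtoC.
      + unfold Phi. replace (RtoC (ln t) + 0) with (RtoC (ln t)) by ring.
        rewrite Cexp_RtoC, exp_ln by exact H0.
        replace (RtoC (/ t)) with (Cexp (RtoC (- ln t))).
        2: { rewrite Cexp_RtoC, exp_Ropp, exp_ln by exact H0. reflexivity. }
        rewrite <- (Cexp_RtoC (- t)), <- !Cexp_add. f_equal. rewrite !RtoC_opp. ring.
    - apply (is_RInt_comp (V := C_R_CompleteNormedModule) (Phi s 0) ln Rinv).
      + intros t _. apply Ccont_continuous, Ccont_Phi.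
      + intros t Ht'. rewrite Rmin_left in Ht' by exact Hxy. split.
        * apply is_derive_ln. lra.
        * apply continuous_Rinv. lra. }
  unfold is_RInt_gen. intros P [eps HP].
  (* truncating at [y = - X / a] and [y = X / a] leaves at most
     [(2 K / a) e^(-X)], and [e^X > X] *)
  destruct (nat_above (4 * K / a / eps)) as [n Hn].
  assert (He := cond_pos eps).
  set (X := (INR n + 1)%R). assert (HX : (0 < X)%R) by (unfold X; generalize (pos_INR n); lra).
  assert (HX2 : (4 * K / a < X * eps)%R).
  { apply (Rmult_le_compat_r eps) in Hn; [|lra]. unfold X.
    replace (4 * K / a / eps * eps)%R with (4 * K / a)%R in Hn by (field; lra). lra. }
  assert (HKa : (0 < K / a)%R) by now apply Rdiv_lt_0_compat.
  assert (Hsmall : (K / a * (exp (- (a * (X / a))) + exp (- (a * (X / a)))) < eps)%R).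
  { replace (a * (X / a))%R with X by (field; lra). rewrite exp_Ropp.
    assert (Hx := exp_ineq1 X ltac:(lra)).
    assert (Hi : (/ exp X < / X)%R) by (apply Rinv_lt_contravar; [apply Rmult_lt_0_compat; [lra|apply exp_pos]|lra]).
    apply Rlt_trans with (K / a * (/ X + / X))%R.
    - apply Rmult_lt_compat_l; lra.
    - apply (Rmult_lt_reg_r X); [exact HX|].
      replace (K / a * (/ X + / X) * X)%R with (4 * K / a / 2)%R by (field; lra). lra. }
  apply (Filter_prod _ _ _ (fun x => 0 < x < exp (- (X / a)))%R (fun y => exp (X / a) < y)%R).
  - exists (mkposreal _ (exp_pos (- (X / a)))). intros x Hx Hx0. split; [exact Hx0|].
    unfold ball in Hx; simpl in Hx; unfold AbsRing_ball, abs, minus, plus, opp in Hx; simpl in Hx.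
    rewrite Ropp_0, Rplus_0_r in Hx. apply Rabs_def2 in Hx. lra.
  - exists (exp (X / a)). auto.
  - intros x y Hx Hy. simpl.
    assert (HXa : (0 < X / a)%R) by now apply Rdiv_lt_0_compat.
    assert (Hlx : (ln x <= - (X / a))%R).
    { rewrite <- (ln_exp (- (X / a))). left. apply ln_increasing; lra. }
    assert (Hly : (X / a <= ln y)%R).
    { rewrite <- (ln_exp (X / a)). left. apply ln_increasing; [apply exp_pos|lra]. }
    exists (CRInt (Phi s 0) (ln x) (ln y)). split.
    + apply HI; [lra|]. assert (exp (- (X / a)) < exp (X / a))%R by (apply exp_increasing; lra). lra.
    + apply HP.
      assert (Hd := Ht (ln x) (ln y) ltac:(lra)).
      assert (Hd2 : (Cmod (CRInt (Phi s 0) (ln x) (ln y) - l)%C < eps)%R).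
      { eapply Rle_lt_trans; [exact Hd|]. eapply Rle_lt_trans; [|exact Hsmall].
        apply Rmult_le_compat_l; [lra|]. apply Rplus_le_compat; apply exp_le; nra. }
      set (w := CRInt (Phi s 0) (ln x) (ln y)) in *. clearbody w.
      assert (R1 := Rabs_Re_le (w - l)). assert (R2 := Rabs_Im_le (w - l)).
      destruct w as [w1 w2], l as [l1 l2]. simpl in R1, R2.
      split; unfold ball; simpl; unfold AbsRing_ball, abs, minus, plus, opp; simpl; unfold Rminus in *; lra.
Qed.

Lemma Gamma_integral_rotated s L : (0 < Re s)%R -> in_strip L ->
  is_lineint (Phi s L) (Gamma_integral s * Cexp (- (s * L))).
Proof.
  intros Hs HL. destruct (lineint_rotation s L Hs HL) as [l [H0 H1]].
  rewrite (is_lineint_unique _ _ _ (Gamma_integral_lineint s Hs) H0), Cmult_comm. exact H1.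
Qed.

(** Integration by parts: [(s - e^y) Phi s 0 y] is a derivative. *)
Lemma Gamma_integral_rec s : (0 < Re s)%R -> Gamma_integral (s + 1) = s * Gamma_integral s.
Proof.
  intros Hs.
  assert (Hs1 : (0 < Re (s + 1))%R) by (destruct s; simpl in *; lra).
  assert (H0 := Gamma_integral_lineint s Hs). assert (H1 := Gamma_integral_lineint (s + 1) Hs1).
  destruct (nat_above (Re s + 1)) as [p Hp].
  destruct (Rmin1_pos (Re s) Hs) as [Ha [Ha1 Has]]. set (a := Rmin 1 (Re s)) in *.
  assert (Hr0 : rate 0 = 1%R) by (unfold rate; simpl; rewrite exp_0, cos_0; ring).
  assert (HD : is_lineint (fun y => (s - Cexp (RtoC y + 0)) * Phi s 0 y) 0).
  { apply (is_lineint_FTC (Phi s 0) _ (decay_const 1 p) a Ha).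
    - intros y. apply cderive_Phi.
    - apply Ccont_dPhi.
    - intros y. rewrite Cmod_Phi, Hr0. apply gamma_integrand_bound; lra. }
  assert (HS : is_lineint (fun y => s * Phi s 0 y + (-(1)) * Phi (s + 1) 0 y)
                 (s * Gamma_integral s + (-(1)) * Gamma_integral (s + 1))).
  { apply is_lineint_plus.
    - apply Ccont_mult; [apply Ccont_const|apply Ccont_Phi].
    - apply Ccont_mult; [apply Ccont_const|apply Ccont_Phi].
    - apply is_lineint_scal; [apply Ccont_Phi|exact H0].
    - apply is_lineint_scal; [apply Ccont_Phi|exact H1]. }
  assert (E : s * Gamma_integral s + (-(1)) * Gamma_integral (s + 1) = 0).
  { apply (is_lineint_unique _ _ _ HS). apply (is_lineint_ext (fun y => (s - Cexp (RtoC y + 0)) * Phi s 0 y)).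
    - intros y. unfold Phi.
      replace ((s + 1) * RtoC y - Cexp (RtoC y + 0)) with ((RtoC y + 0) + (s * RtoC y - Cexp (RtoC y + 0))) by ring.
      rewrite (Cexp_add (RtoC y + 0)). ring.
    - apply Ccont_dPhi.
    - exact HD. }
  replace (s * Gamma_integral s) with
    ((s * Gamma_integral s + (-(1)) * Gamma_integral (s + 1)) + Gamma_integral (s + 1)) by ring.
  rewrite E. ring.
Qed.

Lemma CGamma_pos s : (0 < Re s)%R -> CGamma s = Gamma_integral s.
Proof.
  intros Hs. unfold CGamma.
  replace (Gamma_shift s) with O.
  - simpl. replace (s + 0) with s by ring. field.
  - unfold Gamma_shift. destruct (archimed (- Re s)) as [H1 H2].
    assert (H : (up (- Re s) < 1)%Z) by (apply lt_IZR; lra). lia.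
Qed.

Lemma rising_split s n : rising s (S n) = s * rising (s + 1) n.
Proof.
  induction n as [|n IH].
  - simpl. ring.
  - change (rising s (S (S n))) with (rising s (S n) * (s + RtoC (INR (S n)))).
    rewrite IH, S_INR, RtoC_plus. simpl rising. ring.
Qed.

Lemma rising_neq_0 s n : (forall m : nat, s <> - RtoC (INR m)) -> rising s n <> 0.
Proof.
  intros H. induction n as [|n IH].
  - simpl. intros E. apply RtoC_inj in E. lra.
  - simpl. apply Cmult_neq_0; [exact IH|]. intros E. apply (H n).
    replace s with ((s + RtoC (INR n)) - RtoC (INR n)) by ring. rewrite E. ring.
Qed.

(** Left of the imaginary axis this is how the continuation is defined, the
    number of steps to the right half-plane dropping by one. *)
Lemma CGamma_rec s : (forall m : nat, s <> - RtoC (INR m)) -> CGamma (s + 1) = s * CGamma s.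
Proof.
  intros Hs. destruct (Rlt_dec 0 (Re s)) as [H|H].
  - rewrite !CGamma_pos by (destruct s; simpl in *; lra). now apply Gamma_integral_rec.
  - assert (Eshift : Gamma_shift s = S (Gamma_shift (s + 1))).
    { unfold Gamma_shift.
      destruct (archimed (- Re s)) as [H1 H2].
      assert (Eu : (up (- Re s) - 1)%Z = up (- Re (s + 1)%C)).
      { apply tech_up; rewrite minus_IZR; destruct s; simpl in *; lra. }
      rewrite <- Eu.
      assert (0 < up (- Re s))%Z by (apply lt_IZR; lra). lia. }
    assert (Hs0 : s <> 0).
    { intros E. apply (Hs O). rewrite E. simpl. ring. }
    assert (Hs1 : forall m : nat, s + 1 <> - RtoC (INR m)).
    { intros m E. apply (Hs (S m)). rewrite S_INR, RtoC_plus.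
      replace s with ((s + 1) - 1) by ring. rewrite E. ring. }
    unfold CGamma. rewrite Eshift, rising_split, S_INR, RtoC_plus.
    replace (s + (RtoC (INR (Gamma_shift (s + 1))) + 1)) with (s + 1 + RtoC (INR (Gamma_shift (s + 1)))) by ring.
    assert (Hr := rising_neq_0 (s + 1) (Gamma_shift (s + 1)) Hs1).
    field. auto.
Qed.

Lemma CGamma_rising s n : (forall m : nat, s <> - RtoC (INR m)) ->
  CGamma (s + RtoC (INR n)) = rising s n * CGamma s.
Proof.
  intros Hs. induction n as [|n IH].
  - simpl. replace (s + 0) with s by ring. ring.
  - rewrite S_INR, RtoC_plus, Cplus_assoc, CGamma_rec.
    + rewrite IH. simpl. ring.
    + intros m E. apply (Hs (n + m)%nat). rewrite plus_INR, RtoC_plus.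
      replace s with ((s + RtoC (INR n)) - RtoC (INR n)) by ring. rewrite E. ring.
Qed.

(** * Poisson summation *)

(** [Gamma s x^(-s)] for [x = e^L]. Both sides of the theorem are followed in the
    variable [L], where powers of [x] are exponentials and [x -> q x] is a
    translation. *)
Definition gamma_pow (s L : C) : C := CGamma s * Cexp (- (s * L)).

Lemma gamma_pow_lineint s L : (0 < Re s)%R -> in_strip L -> is_lineint (Phi s L) (gamma_pow s L).
Proof. intros Hs HL. unfold gamma_pow. rewrite CGamma_pos by exact Hs. now apply Gamma_integral_rotated. Qed.

Fixpoint dirichlet (n : nat) (x : R) : R :=
  match n with O => 1%R | S m => (dirichlet m x + 2 * cos (INR n * x))%R end.

(** [N] times Fejer's kernel; the sum of the first [N] Dirichlet kernels is
    easier to telescope without the normalisation. *)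
Definition fejer (N : nat) (x : R) : R := Rsum (fun n => dirichlet n x) N.

Lemma dirichlet_telescope n x :
  ((1 - cos x) * dirichlet n x = cos (INR n * x) - cos (INR (S n) * x))%R.
Proof.
  induction n as [|n IH].
  - simpl. rewrite Rmult_0_l, Rmult_1_l, cos_0. ring.
  - cbn [dirichlet]. rewrite Rmult_plus_distr_l, IH.
    rewrite (S_INR (S n)). set (z := (INR (S n) * x)%R).
    replace (INR n * x)%R with (z - x)%R by (unfold z; rewrite S_INR; ring).
    replace ((INR (S n) + 1) * x)%R with (z + x)%R by (unfold z; ring).
    rewrite cos_minus, cos_plus. ring.
Qed.

Lemma fejer_telescope N x : ((1 - cos x) * fejer N x = 1 - cos (INR N * x))%R.
Proof.
  unfold fejer. induction N as [|N IH].
  - simpl. rewrite Rmult_0_l, cos_0. ring.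
  - cbn [Rsum]. rewrite Rmult_plus_distr_l, IH, dirichlet_telescope. ring.
Qed.

(** Where [cos x < 1] the telescoped product shows it; elsewhere every cosine
    in the kernel is [1]. *)
Lemma fejer_ge0 N x : (0 <= fejer N x)%R.
Proof.
  destruct (Rlt_dec (cos x) 1) as [H|H].
  - apply (Rmult_le_reg_l (1 - cos x)); [lra|].
    rewrite fejer_telescope. generalize (COS_bound (INR N * x)); lra.
  - assert (Hc : cos x = 1%R) by (generalize (COS_bound x); lra).
    assert (Hs : sin x = 0%R).
    { generalize (sin2_cos2 x). rewrite Hc. unfold Rsqr. intros. nra. }
    assert (Hj : forall j, cos (INR j * x) = 1%R /\ sin (INR j * x) = 0%R).
    { induction j as [|j [IH1 IH2]].
      - simpl. rewrite Rmult_0_l, cos_0, sin_0. auto.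
      - rewrite S_INR, Rmult_plus_distr_r, Rmult_1_l, cos_plus, sin_plus, IH1, IH2, Hc, Hs. lra. }
    assert (HD : forall n, (0 <= dirichlet n x)%R).
    { induction n as [|n IH]; cbn [dirichlet]; [lra|]. rewrite (proj1 (Hj (S n))). lra. }
    unfold fejer. induction N as [|N IH]; cbn [Rsum]; [lra|]. specialize (HD N). lra.
Qed.

Lemma sin_ge_third t : (0 <= t <= 2)%R -> (t / 3 <= sin t)%R.
Proof.
  intros Ht. assert (H := Cexp_taylor 3 (0, t)).
  apply Rle_trans with (r1 := Rabs (Im (Cexp (0, t) - Csum (fun n => (0, t) ^ n / RtoC (INR (fact n))) 3))) in H;
    [|apply Rabs_Im_le].
  assert (E : Im (Cexp (0, t) - Csum (fun n => (0, t) ^ n / RtoC (INR (fact n))) 3) = (sin t - t)%R).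
  { unfold Cexp; cbn [Csum]; simpl. rewrite exp_0. field. }
  rewrite E in H. simpl in H. rewrite exp_0, Rmax_left in H by lra.
  assert (Em : Cmod (0, t) = t).
  { unfold Cmod; simpl. replace (0 * (0 * 1) + t * (t * 1))%R with (t * t)%R by ring. apply sqrt_square; lra. }
  rewrite Em in H. apply Rabs_le_between in H.
  replace (1 + 1 + 1 + 1 + 1 + 1)%R with 6%R in H by ring.
  assert (t * t * t <= 4 * t)%R by nra.
  nra.
Qed.

(** The constant is not sharp: it comes from [sin t >= t / 3] on [[0, 2]], for
    which Taylor's formula suffices. *)
Lemma sqr_le_one_minus_cos x : (Rabs x <= PI)%R -> (x ^ 2 <= 18 * (1 - cos x))%R.
Proof.
  intros H. set (t := (Rabs x / 2)%R).
  assert (Ht : (0 <= t <= 2)%R) by (unfold t; generalize (Rabs_pos x) PI_4; lra).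
  assert (H3 := sin_ge_third t Ht).
  assert (E : cos x = cos (2 * t)).
  { unfold t. replace (2 * (Rabs x / 2))%R with (Rabs x) by field.
    unfold Rabs. destruct (Rcase_abs x); [now rewrite cos_neg|reflexivity]. }
  rewrite E, cos_2a_sin. rewrite <- pow2_abs. replace (Rabs x) with (2 * t)%R by (unfold t; field).
  nra.
Qed.

Lemma cos_period_Z x k : cos (x + 2 * PI * IZR k) = cos x.
Proof.
  assert (P : forall n, cos (x + 2 * PI * INR n) = cos x).
  { intros n. rewrite <- (cos_period x n). f_equal; ring. }
  destruct (Z_le_dec 0 k) as [H|H].
  - rewrite <- (P (Z.to_nat k)), INR_IZR_INZ, Z2Nat.id by exact H. reflexivity.
  - rewrite <- (cos_period (x + 2 * PI * IZR k) (Z.to_nat (- k))), INR_IZR_INZ, Z2Nat.id by lia.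
    f_equal. rewrite opp_IZR. ring.
Qed.

Lemma sin_period_Z x k : sin (x + 2 * PI * IZR k) = sin x.
Proof.
  rewrite <- !cos_shift. rewrite <- (cos_period_Z (PI / 2 - x) (- k)).
  f_equal. rewrite opp_IZR. ring.
Qed.

Section Cells.
Variable h : R.
Hypothesis hh : (0 < h)%R.
Let kap : R := (2 * PI / h)%R.

Lemma kap_pos : (0 < kap)%R.
Proof. apply Rdiv_lt_0_compat; [|exact hh]. generalize PI_RGT_0; lra. Qed.

Lemma RInt_cos_cell m j : (0 < j)%nat ->
  is_RInt (fun y => cos (INR j * (kap * y))) (m - h / 2) (m + h / 2) 0.
Proof.
  intros Hj. assert (Hj' : (0 < INR j)%R) by now apply lt_0_INR. assert (Hk := kap_pos).
  apply (is_RInt_FTC (fun y => sin (INR j * (kap * y)) / (INR j * kap))%R).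
  - intros x. auto_derive; [exact I|]. field. split; lra.
  - intros x. auto_derive; exact I.
  - replace (INR j * (kap * (m + h / 2)))%R with (INR j * (kap * (m - h / 2)) + 2 * PI * IZR (Z.of_nat j))%R.
    + rewrite sin_period_Z. lra.
    + rewrite <- INR_IZR_INZ. unfold kap. field. lra.
Qed.

Lemma RInt_dirichlet_cell m n :
  is_RInt (fun y => dirichlet n (kap * y)) (m - h / 2) (m + h / 2) h.
Proof.
  induction n as [|n IH].
  - simpl. apply is_RInt_cst; field.
  - cbn [dirichlet]. evar_last.
    + apply (is_RInt_plus (V := R_NormedModule)); [exact IH|].
      apply (is_RInt_scal (V := R_NormedModule)), RInt_cos_cell. lia.
    + unfold plus, scal; simpl; unfold mult; simpl. ring.
Qed.

Lemma RInt_fejer_cell m N :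
  is_RInt (fun y => fejer N (kap * y)) (m - h / 2) (m + h / 2) (INR N * h)%R.
Proof.
  unfold fejer. induction N as [|N IH].
  - simpl. apply is_RInt_cst; ring.
  - cbn [Rsum]. rewrite S_INR. evar_last.
    + apply (is_RInt_plus (V := R_NormedModule)); [exact IH|apply RInt_dirichlet_cell].
    + unfold plus; simpl. ring.
Qed.

Lemma ex_derive_dirichlet n k x : ex_derive (fun y => dirichlet n (k * y)) x.
Proof.
  induction n as [|n IH]; cbn [dirichlet].
  - apply (ex_derive_const (V := R_NormedModule)).
  - apply (ex_derive_plus (V := R_NormedModule)); [exact IH|]. auto_derive. exact I.
Qed.

Lemma ex_derive_fejer N k x : ex_derive (fun y => fejer N (k * y)) x.
Proof.
  unfold fejer. induction N as [|N IH]; cbn [Rsum].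
  - apply (ex_derive_const (V := R_NormedModule)).
  - apply (ex_derive_plus (V := R_NormedModule)); [exact IH|]. apply ex_derive_dirichlet.
Qed.

Lemma Ccont_fejer N : Ccont (fun y => RtoC (fejer N (kap * y))).
Proof. apply (Ccont_RtoC (fun y => fejer N (kap * y))). intros; apply ex_derive_fejer. Qed.

(** On a cell centred at a lattice point the kernel evaluates a Lipschitz
    function at the centre: [|x| <= eps + x^2 / eps], and [x^2] is dominated by
    [1 - cos], which cancels the growth of the kernel with [N]. *)
Lemma fejer_cell f B k N eps :
  (0 < eps)%R -> (0 <= B)%R -> Ccont f -> (1 <= N)%nat ->
  (forall y, (IZR k * h - h / 2 <= y <= IZR k * h + h / 2)%R ->
     (Cmod (f y - f (IZR k * h)%R)%C <= B * Rabs (y - IZR k * h))%R) ->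
  (Cmod (CRInt (fun y => f y * RtoC (fejer N (kap * y))) (IZR k * h - h / 2) (IZR k * h + h / 2)
         - RtoC (INR N * h) * f (IZR k * h)%R)%C
   <= B * (eps * (INR N * h) + 18 / kap ^ 2 / eps * h))%R.
Proof.
  intros He HB Hc HN HL. set (m := (IZR k * h)%R) in *. assert (Hk := kap_pos).
  assert (HF : is_CRInt (fun y => RtoC (fejer N (kap * y))) (m - h / 2) (m + h / 2) (RtoC (INR N * h))).
  { apply is_CRInt_pair; simpl; [apply RInt_fejer_cell|].
    apply is_RInt_cst; ring. }
  assert (H1 : is_CRInt (fun y => f y * RtoC (fejer N (kap * y)) - f m * RtoC (fejer N (kap * y)))
     (m - h / 2) (m + h / 2)
     (CRInt (fun y => f y * RtoC (fejer N (kap * y))) (m - h / 2) (m + h / 2) - f m * RtoC (INR N * h))).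
  { apply is_CRInt_minus.
    - apply is_CRInt_ex, Ccont_mult; [exact Hc|apply Ccont_fejer].
    - now apply is_CRInt_scal. }
  rewrite (Cmult_comm (RtoC (INR N * h))).
  eapply (is_CRInt_norm _ (fun y => B * (eps * fejer N (kap * y)
             + 18 / kap ^ 2 / eps * (1 - cos (INR N * (kap * y)))))%R (m - h / 2)%R (m + h / 2)%R _ _ ltac:(lra) _ H1).
  - evar_last.
    + apply (is_RInt_scal (V := R_NormedModule)). apply (is_RInt_plus (V := R_NormedModule)).
      * apply (is_RInt_scal (V := R_NormedModule)), RInt_fejer_cell.
      * apply (is_RInt_scal (V := R_NormedModule)). apply (is_RInt_minus (V := R_NormedModule)).
        -- apply is_RInt_cst; reflexivity.
        -- apply RInt_cos_cell. lia.
    + unfold minus, plus, opp, scal; simpl; unfold mult; simpl.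
      replace (m + h / 2 - (m - h / 2))%R with h by field. ring.
  Unshelve.
  intros y Hy. cbv beta.
  replace (f y * RtoC (fejer N (kap * y)) - f m * RtoC (fejer N (kap * y)))
    with ((f y - f m) * RtoC (fejer N (kap * y))) by ring.
  rewrite Cmod_mult, Cmod_R, Rabs_pos_eq by apply fejer_ge0.
  rewrite <- fejer_telescope.
  assert (HF0 := fejer_ge0 N (kap * y)).
  set (d := Rabs (y - m)).
  assert (Hd : (d <= eps + d ^ 2 / eps)%R).
  { apply (Rmult_le_reg_l eps); [exact He|].
    replace (eps * (eps + d ^ 2 / eps))%R with (eps ^ 2 + d ^ 2)%R by (field; lra).
    generalize (pow2_ge_0 (eps - d)). generalize (Rabs_pos (y - m)). fold d. nra. }
  assert (Hcos : (d ^ 2 <= 18 / kap ^ 2 * (1 - cos (kap * y)))%R).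
  { assert (X : (Rabs (kap * (y - m)) <= PI)%R).
    { rewrite Rabs_mult, Rabs_pos_eq by lra.
      apply Rle_trans with (kap * (h / 2))%R.
      - apply Rmult_le_compat_l; [lra|]. apply Rabs_le. lra.
      - unfold kap. right. field. lra. }
    apply sqr_le_one_minus_cos in X.
    replace (cos (kap * y)) with (cos (kap * (y - m))).
    2: { rewrite <- (cos_period_Z (kap * (y - m)) k). f_equal. unfold m, kap. field. lra. }
    rewrite Rpow_mult_distr in X. unfold d. rewrite pow2_abs.
    apply (Rmult_le_reg_l (kap ^ 2)); [apply pow_lt; lra|].
    replace (kap ^ 2 * (18 / kap ^ 2 * (1 - cos (kap * (y - m)))))%R
      with (18 * (1 - cos (kap * (y - m))))%R by (field; lra). exact X. }
  apply Rle_trans with (B * d * fejer N (kap * y))%R.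
  { apply Rmult_le_compat_r; [exact HF0|]. now apply HL. }
  rewrite Rmult_assoc. apply Rmult_le_compat_l; [exact HB|].
  replace (eps * fejer N (kap * y) + 18 / kap ^ 2 / eps * ((1 - cos (kap * y)) * fejer N (kap * y)))%R
    with ((eps + (18 / kap ^ 2 * (1 - cos (kap * y))) / eps) * fejer N (kap * y))%R by (field; lra).
  apply Rmult_le_compat_r; [exact HF0|].
  eapply Rle_trans; [exact Hd|]. apply Rplus_le_compat_l.
  apply Rmult_le_compat_r; [left; now apply Rinv_0_lt_compat|exact Hcos].
Qed.

Lemma fejer_cells f (b : nat -> R) N eps K :
  (0 < eps)%R -> (forall k, 0 <= b k)%R -> Ccont f -> (1 <= N)%nat ->
  (forall k y, (IZR k * h - h / 2 <= y <= IZR k * h + h / 2)%R ->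
     (Cmod (f y - f (IZR k * h)%R)%C <= b (Z.abs_nat k) * Rabs (y - IZR k * h))%R) ->
  (Cmod (CRInt (fun y => f y * RtoC (fejer N (kap * y))) (- (INR K * h + h / 2)) (INR K * h + h / 2)
         - RtoC (INR N * h) * Csum (zfold (fun k => f (IZR k * h)%R)) (S K))%C
   <= 2 * Rsum b (S K) * (eps * (INR N * h) + 18 / kap ^ 2 / eps * h))%R.
Proof.
  intros He Hb Hc HN HL.
  set (E := (eps * (INR N * h) + 18 / kap ^ 2 / eps * h)%R).
  assert (HE : (0 <= E)%R).
  { unfold E. assert (Hk := kap_pos). assert (0 <= INR N)%R by apply pos_INR.
    assert (0 < kap ^ 2)%R by (apply pow_lt; lra).
    assert (0 <= 18 / kap ^ 2 / eps)%R by (repeat (apply Rdiv_le_0_compat; [|assumption]); lra).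
    assert (0 <= eps * (INR N * h))%R by (apply Rmult_le_pos; [lra|apply Rmult_le_pos; lra]).
    assert (0 <= 18 / kap ^ 2 / eps * h)%R by (apply Rmult_le_pos; lra). lra. }
  set (g := fun y => f y * RtoC (fejer N (kap * y))).
  assert (Cg : Ccont g) by (apply Ccont_mult; [exact Hc|apply Ccont_fejer]).
  assert (HC : forall k, (Cmod (CRInt g (IZR k * h - h / 2) (IZR k * h + h / 2)
         - RtoC (INR N * h) * f (IZR k * h)%R)%C <= b (Z.abs_nat k) * E)%R).
  { intros k. apply fejer_cell; auto. }
  induction K as [|K IH].
  - cbn [Csum Rsum]. unfold zfold.
    specialize (HC 0%Z). simpl in HC.
    replace (- (INR 0 * h + h / 2))%R with (0 * h - h / 2)%R by (simpl; ring).
    replace (INR 0 * h + h / 2)%R with (0 * h + h / 2)%R by (simpl; ring).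
    rewrite Cplus_0_l, Rplus_0_l. eapply Rle_trans; [exact HC|].
    specialize (Hb O). assert (0 <= b O * E)%R by (apply Rmult_le_pos; assumption). lra.
  - change (Csum (zfold (fun k => f (IZR k * h)%R)) (S (S K)))
      with (Csum (zfold (fun k => f (IZR k * h)%R)) (S K) + zfold (fun k => f (IZR k * h)%R) (S K)).
    change (Rsum b (S (S K))) with (Rsum b (S K) + b (S K))%R.
    assert (H1 := HC (Z.of_nat (S K))). assert (H2 := HC (- Z.of_nat (S K))%Z).
    rewrite Zabs2Nat.id in H1. replace (Z.abs_nat (- Z.of_nat (S K))) with (S K) in H2 by lia.
    unfold zfold at 2.
    rewrite opp_IZR in H2 |- *. rewrite <- INR_IZR_INZ in H1, H2 |- *.
    rewrite <- (CRInt_Chasles g _ (- (INR K * h + h / 2)) _ Cg).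
    rewrite <- (CRInt_Chasles g (- (INR K * h + h / 2)) (INR K * h + h / 2) _ Cg).
    replace (- (INR (S K) * h + h / 2))%R with (- INR (S K) * h - h / 2)%R by (rewrite S_INR; field).
    replace (- (INR K * h + h / 2))%R with (- INR (S K) * h + h / 2)%R in * by (rewrite S_INR; field).
    replace (INR K * h + h / 2)%R with (INR (S K) * h - h / 2)%R in * by (rewrite S_INR; field).
    match type of IH with (Cmod ?a <= _)%R => match type of H1 with (Cmod ?b <= _)%R =>
      match type of H2 with (Cmod ?c <= _)%R => match goal with |- (Cmod ?z <= _)%R =>
      replace z with (a + (b + c)) by ring end end end end.
    eapply Rle_trans; [apply Cmod_triangle|].
    eapply Rle_trans; [apply Rplus_le_compat_l, Cmod_triangle|].
    lra.
Qed.

End Cells.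

Lemma Phi_shift u L w (y : R) : Phi (u + w) L y = Cexp (w * RtoC y) * Phi u L y.
Proof. unfold Phi. rewrite <- Cexp_add. f_equal. ring. Qed.

(** Multiplying the integrand by a character shifts the argument of [Gamma] by
    an imaginary amount, so the Fourier coefficients are values of [Gamma]. *)
Lemma Phi_cos u L (k y : R) :
  Phi (u + RtoC k * Ci) L y + Phi (u + RtoC (- k) * Ci) L y = RtoC (2 * cos (k * y)) * Phi u L y.
Proof.
  rewrite !Phi_shift. rewrite <- Cmult_plus_distr_r. f_equal.
  assert (E : forall r : R, Cexp (RtoC r * Ci * RtoC y) = (cos (r * y), sin (r * y))).
  { intros r. unfold Cexp. replace (Re (RtoC r * Ci * RtoC y)) with 0%R by (simpl; ring).
    replace (Im (RtoC r * Ci * RtoC y)) with (r * y)%R by (simpl; ring). rewrite exp_0. ring. }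
  rewrite !E. rewrite <- Ropp_mult_distr_l, cos_neg, sin_neg. apply Ceq; simpl; ring.
Qed.

(** Poisson summation, by Fejer's method. Integrated against the integrand,
    [N] times Fejer's kernel gives the sum of the first [N] symmetric partial
    sums of the left-hand series; cell by cell it also gives [N h] times the sum
    of the lattice values, up to [o(N)]. Cesaro means of a convergent series
    have the same limit, so the two sides agree. *)
Lemma poisson_gamma u L h (H : C) : (0 < h)%R -> (0 < Re u)%R -> in_strip L ->
  is_Cseries (zfold (fun k => gamma_pow (u + RtoC (2 * PI / h * IZR k) * Ci) L)) H ->
  is_Cseries (zfold (fun k => RtoC h * Phi u L (IZR k * h)%R)) H.
Proof.
  intros hh Hu HL HH.
  set (kap := (2 * PI / h)%R).
  destruct (nat_above (Re u + 2)) as [p Hp].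
  destruct (Rmin1_pos (Re u) Hu) as [Ha [Ha1 Has]]. set (a := Rmin 1 (Re u)) in *.
  assert (Hc := rate_pos L HL).
  set (K := decay_const (rate L) p).
  assert (HK : (0 <= K)%R) by (left; now apply decay_const_pos).
  set (f := Phi u L). assert (Cf : Ccont f) by apply Ccont_Phi.
  assert (Hf : forall y, (Cmod (f y) <= K * exp (- (a * Rabs y)))%R).
  { intros y. unfold f. rewrite Cmod_Phi. apply gamma_integrand_bound; lra. }
  set (df := fun y : R => (u - Cexp (RtoC y + L)) * f y).
  set (K' := ((Cmod u + exp (Re L)) * K)%R).
  assert (Hu0 := Cmod_ge_0 u). assert (HeL := exp_pos (Re L)).
  assert (HK' : (0 <= K')%R) by (apply Rmult_le_pos; lra).
  assert (Hdf : forall y, (Cmod (df y) <= K' * exp (- (a * Rabs y)))%R).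
  { intros y. unfold df. rewrite Cmod_mult.
    assert (H1 : (Cmod (u - Cexp (RtoC y + L))%C <= Cmod u + exp (Re L) * exp y)%R).
    { eapply Rle_trans; [apply Cmod_triangle|]. rewrite Cmod_opp, Cmod_Cexp.
      replace (Re (RtoC y + L)) with (Re L + y)%R by (destruct L; simpl; ring).
      rewrite exp_plus. lra. }
    assert (H2 : (exp y * Cmod (f y) <= K * exp (- (a * Rabs y)))%R).
    { unfold f. rewrite Cmod_Phi, <- exp_plus.
      replace (y + (Re u * y - rate L * exp y))%R with ((Re u + 1) * y - rate L * exp y)%R by ring.
      apply gamma_integrand_bound; lra. }
    specialize (Hf y). assert (Hfy := Cmod_ge_0 (f y)).
    apply Rle_trans with (Cmod u * Cmod (f y) + exp (Re L) * (exp y * Cmod (f y)))%R; [nra|].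
    unfold K'. nra. }
  (* a bound for [df] on the [k]-th cell, whose points are within [h / 2] of [k h] *)
  set (b := fun k : nat => (K' * exp (a * h / 2) * exp (- (a * h)) ^ k)%R).
  assert (Hb0 : forall k, (0 <= b k)%R).
  { intros k. unfold b. apply Rmult_le_pos; [|apply pow_le; left; apply exp_pos].
    apply Rmult_le_pos; [exact HK'|left; apply exp_pos]. }
  assert (Hgeom : forall C0, ex_series (fun k => C0 * exp (- (a * h)) ^ k)%R).
  { intros C0. apply ex_series_scalR, ex_series_geom.
    apply exp_opp_geom. nra. }
  assert (Hlip : forall k y, (IZR k * h - h / 2 <= y <= IZR k * h + h / 2)%R ->
     (Cmod (f y - f (IZR k * h)%R)%C <= b (Z.abs_nat k) * Rabs (y - IZR k * h))%R).
  { intros k y Hy. set (m := (IZR k * h)%R) in *.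
    assert (Hsup : forall z, (m - h / 2 <= z <= m + h / 2)%R -> (Cmod (df z) <= b (Z.abs_nat k))%R).
    { intros z Hz. eapply Rle_trans; [apply Hdf|]. unfold b. rewrite Rmult_assoc.
      apply Rmult_le_compat_l; [exact HK'|]. rewrite pow_exp, <- exp_plus. apply exp_le.
      assert (Hm : (Rabs m = INR (Z.abs_nat k) * h)%R).
      { unfold m. rewrite Rabs_mult, (Rabs_pos_eq h), <- abs_IZR, INR_IZR_INZ, Zabs2Nat.id_abs by lra. reflexivity. }
      assert (Hz2 : (Rabs m - h / 2 <= Rabs z)%R).
      { replace m with (z - (z - m))%R at 1 by ring.
        assert (T := Rabs_triang z (- (z - m))). rewrite Rabs_Ropp in T.
        assert (Rabs (z - m) <= h / 2)%R by (apply Rabs_le; lra). unfold Rminus in *. lra. }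
      rewrite Hm in Hz2. nra. }
    destruct (Rle_dec m y) as [Hmy|Hmy].
    - rewrite (Rabs_pos_eq (y - m)) by lra.
      apply (is_CRInt_norm df (fun _ => b (Z.abs_nat k)) m y _ _ Hmy).
      + intros z Hz. apply Hsup. lra.
      + exact (is_CRInt_FTC f df _ _ (cderive_Phi u L) (Ccont_dPhi u L)).
      + apply is_RInt_cst; ring.
    - rewrite Rabs_left by lra.
      replace (f y - f m) with (- (f m - f y)) by ring. rewrite Cmod_opp.
      apply (is_CRInt_norm df (fun _ => b (Z.abs_nat k)) y m _ _ ltac:(lra)).
      + intros z Hz. apply Hsup. lra.
      + exact (is_CRInt_FTC f df _ _ (cderive_Phi u L) (Ccont_dPhi u L)).
      + apply is_RInt_cst; ring. }
  assert (HG : exists G : C, is_Cseries (zfold (fun k => f (IZR k * h)%R)) G).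
  { destruct (zfold_correct (fun k => f (IZR k * h)%R) (fun k => K * exp (- (a * h)) ^ k)%R) as [_ X].
    - intros k. eapply Rle_trans; [apply Hf|]. apply Rmult_le_compat_l; [exact HK|].
      rewrite pow_exp, <- INR_IZR_INZ. apply exp_le.
      rewrite Rabs_pos_eq by (apply Rmult_le_pos; [apply pos_INR|lra]). lra.
    - intros k. eapply Rle_trans; [apply Hf|]. apply Rmult_le_compat_l; [exact HK|].
      rewrite pow_exp, opp_IZR, <- INR_IZR_INZ. apply exp_le.
      rewrite <- Ropp_mult_distr_l, Rabs_Ropp.
      rewrite Rabs_pos_eq by (apply Rmult_le_pos; [apply pos_INR|lra]). lra.
    - apply Hgeom.
    - eexists; exact X. }
  destruct HG as [G HG].
  destruct (Hgeom (K' * exp (a * h / 2))%R) as [SB HSB]. fold b in HSB.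
  set (t := fun k : Z => u + RtoC (kap * IZR k) * Ci).
  set (Z := fun n => Csum (zfold (fun k => gamma_pow (t k) L)) (S n)).
  assert (Ht : forall k, (0 < Re (t k))%R).
  { intros k. unfold t. destruct u; simpl in *. lra. }
  assert (HLD : forall n, Ccont (fun y => f y * RtoC (dirichlet n (kap * y))) /\
             is_lineint (fun y => f y * RtoC (dirichlet n (kap * y))) (Z n)).
  { assert (HCt : forall w, Ccont (Phi w L)) by (intros; apply Ccont_Phi).
    induction n as [|n [IHc IHn]].
    - simpl. split; [apply Ccont_mult; [exact Cf|apply Ccont_const]|].
      apply (is_lineint_ext (Phi (t 0%Z) L)); [|apply HCt|].
      + intros y. unfold t. replace (u + RtoC (kap * 0) * Ci) with u by (rewrite Rmult_0_r; ring). unfold f; ring.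
      + unfold Z. cbn [Csum]. rewrite Cplus_0_l. unfold zfold. apply gamma_pow_lineint; [apply Ht|exact HL].
    - assert (E : forall y : R, f y * RtoC (dirichlet n (kap * y)) + (Phi (t (Z.of_nat (S n))) L y + Phi (t (- Z.of_nat (S n))%Z) L y)
         = f y * RtoC (dirichlet (S n) (kap * y))).
      { intros y. unfold t. rewrite opp_IZR, <- INR_IZR_INZ, <- Ropp_mult_distr_r, Phi_cos.
        cbn [dirichlet]. rewrite RtoC_plus. fold f.
        replace (INR (S n) * (kap * y))%R with (kap * INR (S n) * y)%R by ring. ring. }
      split.
      + apply Ccont_mult; [exact Cf|].
        apply (Ccont_RtoC (fun y => dirichlet (S n) (kap * y))). intros; apply ex_derive_dirichlet.
      + eapply is_lineint_ext; [exact E| |].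
        * apply Ccont_plus; [exact IHc|apply Ccont_plus; apply HCt].
        * change (Z (S n)) with (Z n + zfold (fun k => gamma_pow (t k) L) (S n)). unfold zfold.
          apply is_lineint_plus; [exact IHc|apply Ccont_plus; apply HCt|exact IHn|].
          apply is_lineint_plus; [apply HCt|apply HCt| |]; apply gamma_pow_lineint; auto. }
  assert (HLF : forall N, is_lineint (fun y => f y * RtoC (fejer N (kap * y))) (Csum Z N)).
  { induction N as [|N IH].
    - unfold fejer. simpl. apply (is_lineint_ext (fun y => 0 * f y)); [intros; ring| |].
      + apply Ccont_mult; [apply Ccont_const|exact Cf].
      + assert (E0 := is_lineint_scal 0 f (gamma_pow u L) Cf (gamma_pow_lineint u L Hu HL)).
        rewrite Cmult_0_l in E0. exact E0.
    - cbn [Csum]. destruct (HLD N) as [Hd1 Hd2].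
      apply (is_lineint_ext (fun y => f y * RtoC (fejer N (kap * y)) + f y * RtoC (dirichlet N (kap * y)))).
      + intros y. unfold fejer. cbn [Rsum]. rewrite RtoC_plus. ring.
      + apply Ccont_plus; [|exact Hd1]. apply Ccont_mult; [exact Cf|]. apply (Ccont_fejer h).
      + apply is_lineint_plus; auto. apply Ccont_mult; [exact Cf|]. apply (Ccont_fejer h). }
  assert (Hmain : forall N eps, (0 < eps)%R ->
    (Cmod (Csum Z (S N) - RtoC (INR (S N) * h) * G)%C <=
       2 * SB * (eps * (INR (S N) * h) + 18 / kap ^ 2 / eps * h))%R).
  { intros N eps He.
    set (g := fun y => f y * RtoC (fejer (S N) (kap * y))).
    assert (Cg : Ccont g) by (apply Ccont_mult; [exact Cf|apply (Ccont_fejer h)]).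
    assert (HD : exists MD, (0 <= MD)%R /\ forall y, (Rabs (fejer (S N) y) <= MD)%R).
    { assert (HD1 : forall n y, (Rabs (dirichlet n y) <= 1 + 2 * INR n)%R).
      { induction n as [|n IH]; intros y; cbn [dirichlet].
        - rewrite Rabs_R1. simpl; lra.
        - eapply Rle_trans; [apply Rabs_triang|]. rewrite Rabs_mult, (Rabs_pos_eq 2) by lra.
          assert (X : (Rabs (cos (INR (S n) * y)) <= 1)%R) by (apply Rabs_le, COS_bound).
          specialize (IH y). rewrite S_INR in *. lra. }
      exists (Rsum (fun n => 1 + 2 * INR n)%R (S N)). split.
      - generalize (S N). intros n; induction n as [|n IH]; cbn [Rsum]; [lra|]. generalize (pos_INR n); lra.
      - intros y. unfold fejer. generalize (S N). intros n; induction n as [|n IH]; cbn [Rsum].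
        + rewrite Rabs_R0; lra.
        + eapply Rle_trans; [apply Rabs_triang|]. specialize (HD1 n y). lra. }
    destruct HD as [MD [HMD HD]].
    assert (HKM : (0 <= K * MD)%R) by (apply Rmult_le_pos; lra).
    destruct (ex_lineint g (K * MD) a Ha HKM Cg) as [l [Hl Htail]].
    { intros y. unfold g. rewrite Cmod_mult, Cmod_R. specialize (Hf y). specialize (HD (kap * y)%R).
      replace (K * MD * exp (- (a * Rabs y)))%R with (K * exp (- (a * Rabs y)) * MD)%R by ring.
      apply Rmult_le_compat; auto; [apply Cmod_ge_0|apply Rabs_pos]. }
    assert (El := is_lineint_unique _ _ _ (HLF (S N)) Hl). rewrite El.
    (* [l] is known from symmetric truncations at integers; the tail bound gives
       the same limit for truncations at the boundaries of cells *)
    assert (HlimI : Clim (fun K0 => CRInt g (- (INR K0 * h + h / 2)) (INR K0 * h + h / 2)) l).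
    { apply (Clim_is_0 _ _ (fun K0 => (K * MD / a * 2) * exp (- (a * h)) ^ K0)%R).
      - intros K0. assert (HK0 := pos_INR K0).
        assert (Hx : (0 <= INR K0 * h)%R) by (apply Rmult_le_pos; lra).
        eapply Rle_trans; [apply Htail; lra|].
        rewrite Rmult_assoc. apply Rmult_le_compat_l; [apply Rdiv_le_0_compat; lra|].
        rewrite pow_exp.
        assert (X : (exp (- (a * (INR K0 * h + h / 2))) <= exp (INR K0 * - (a * h)))%R) by (apply exp_le; nra).
        replace (a * - (INR K0 * h + h / 2))%R with (- (a * (INR K0 * h + h / 2)))%R by ring. lra.
      - apply (ex_series_lim_0 (fun K0 => K * MD / a * 2 * exp (- (a * h)) ^ K0)%R), Hgeom. }
    assert (HlimG : Clim (fun K0 => CRInt g (- (INR K0 * h + h / 2)) (INR K0 * h + h / 2)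
        + (- RtoC (INR (S N) * h)) * Csum (zfold (fun k => f (IZR k * h)%R)) (S K0))
        (l + (- RtoC (INR (S N) * h)) * G)).
    { apply Clim_plus; [exact HlimI|]. apply Clim_scal.
      apply is_Cseries_lim in HG. unfold Clim in *. apply -> (is_lim_seq_incr_1 (fun n => Cmod (Csum (zfold (fun k => f (IZR k * h)%R)) n - G))) in HG.
      exact HG. }
    replace (l - RtoC (INR (S N) * h) * G) with (l + (- RtoC (INR (S N) * h)) * G - 0) by ring.
    apply (Clim_bound _ _ 0 (fun K0 => 2 * Rsum b (S K0) * (eps * (INR (S N) * h) + 18 / kap ^ 2 / eps * h))%R _ HlimG).
    - apply (is_lim_seq_mult' _ (fun _ => _)); [|apply is_lim_seq_const].
      apply is_lim_seq_mult'; [apply is_lim_seq_const|].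
      apply is_series_Rsum in HSB. now apply -> (is_lim_seq_incr_1 (Rsum b)) in HSB.
    - exists O. intros K0 _.
      assert (HFC := fejer_cells h hh f b (S N) eps K0 He Hb0 Cf ltac:(lia) Hlip).
      fold kap in HFC. fold g in HFC.
      match type of HFC with (Cmod ?z <= _)%R => match goal with |- (Cmod ?z' <= _)%R =>
        replace z' with z by ring end end.
      exact HFC. }
  assert (HZ : Clim Z H).
  { apply is_Cseries_lim in HH. unfold Clim in *.
    now apply -> (is_lim_seq_incr_1 (fun n => Cmod (Csum (zfold (fun k => gamma_pow (t k) L)) n - H))) in HH. }
  assert (HCes := Clim_cesaro Z H HZ).
  assert (HSB0 := is_series_ge0 b SB Hb0 HSB).
  assert (Heps : forall eps, (0 < eps)%R -> (Cmod (H - RtoC h * G)%C <= 2 * SB * (eps * h))%R).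
  { intros eps He.
    apply (Clim_bound _ _ (RtoC h * G) (fun N => 2 * SB * (eps * h + 18 / kap ^ 2 / eps * h * / INR (S N)))%R _ HCes).
    - replace (Finite (2 * SB * (eps * h))) with (Finite (2 * SB * (eps * h + 18 / kap ^ 2 / eps * h * 0))) by (f_equal; ring).
      apply (is_lim_seq_mult' (fun _ => _)); [apply is_lim_seq_const|].
      apply (is_lim_seq_plus' (fun _ => _)); [apply is_lim_seq_const|].
      apply (is_lim_seq_mult' (fun _ => _)); [apply is_lim_seq_const|]. apply lim_inv_INR.
    - exists O. intros N _. specialize (Hmain N eps He).
      assert (HS : (0 < INR (S N))%R) by (apply lt_0_INR; lia).
      assert (HS' : RtoC (INR (S N)) <> 0) by (apply RtoC_neq_0; lra).
      replace (RtoC (/ INR (S N)) * Csum Z (S N) - RtoC h * G)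
        with (RtoC (/ INR (S N)) * (Csum Z (S N) - RtoC (INR (S N) * h) * G)).
      2: { rewrite RtoC_inv, RtoC_mult by lra. field. exact HS'. }
      rewrite Cmod_mult, Cmod_R, Rabs_pos_eq by (left; now apply Rinv_0_lt_compat).
      apply (Rmult_le_reg_l (INR (S N))); [exact HS|].
      rewrite <- Rmult_assoc, Rinv_r, Rmult_1_l by lra.
      eapply Rle_trans; [exact Hmain|]. right. field. repeat split; try lra.
      unfold kap. intros E. assert (X := kap_pos h hh). unfold kap in X. lra. }
  assert (EH : H = RtoC h * G).
  { apply Cmod_minus_le_0, le_epsilon. intros e He. rewrite Rplus_0_l.
    assert (Hx : (0 < 2 * SB * h + 1)%R) by (assert (0 <= SB * h)%R by (apply Rmult_le_pos; lra); lra).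
    eapply Rle_trans; [apply (Heps (e / (2 * SB * h + 1))%R); now apply Rdiv_lt_0_compat|].
    apply (Rmult_le_reg_r (2 * SB * h + 1)); [exact Hx|].
    replace (2 * SB * (e / (2 * SB * h + 1) * h) * (2 * SB * h + 1))%R with (2 * SB * h * e)%R by (field; lra).
    nra. }
  rewrite EH. apply (is_Cseries_ext (fun n => RtoC h * zfold (fun k => f (IZR k * h)%R) n)).
  - intros n. symmetry. apply zfold_scal.
  - now apply is_Cseries_scal.
Qed.

(** * Decay of the Gamma function along the lattice *)

Lemma finite_min (g : nat -> nat -> R) : (forall n m, 0 < g n m)%R -> forall N M,
  exists d, (0 < d)%R /\ forall n m, (n < N)%nat -> (m < M)%nat -> (d <= g n m)%R.
Proof.
  intros Hg N M.
  assert (H1 : forall n, exists d, (0 < d)%R /\ forall m, (m < M)%nat -> (d <= g n m)%R).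
  { intros n. induction M as [|M [d [Hd IH]]].
    - exists 1%R. split; [lra|]. intros; lia.
    - exists (Rmin d (g n M)). split; [now apply Rmin_pos|].
      intros m Hm. destruct (Nat.eq_dec m M) as [Em|Em].
      + subst. apply Rmin_r.
      + eapply Rle_trans; [apply Rmin_l|]. apply IH. lia. }
  induction N as [|N [d [Hd IH]]].
  - exists 1%R. split; [lra|]. intros; lia.
  - destruct (H1 N) as [e [He He2]].
    exists (Rmin d e). split; [now apply Rmin_pos|].
    intros n m Hn Hm. destruct (Nat.eq_dec n N) as [En|En].
    + subst. eapply Rle_trans; [apply Rmin_r|]. now apply He2.
    + eapply Rle_trans; [apply Rmin_l|]. apply IH; lia.
Qed.

Lemma INR_abs_nat k : INR (Z.abs_nat k) = Rabs (IZR k).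
Proof. now rewrite INR_IZR_INZ, Zabs2Nat.id_abs, abs_IZR. Qed.

(** The points at which [Gamma] is evaluated, [mu + n + i kap k]. *)
Definition gamma_pt (kap : R) (mu : C) (n : nat) (k : Z) : C :=
  mu + RtoC (INR n) + RtoC (kap * IZR k) * Ci.

Lemma Re_gamma_pt kap mu n k : Re (gamma_pt kap mu n k) = (Re mu + INR n)%R.
Proof. unfold gamma_pt. destruct mu; simpl; ring. Qed.
Lemma Im_gamma_pt kap mu n k : Im (gamma_pt kap mu n k) = (Im mu + kap * IZR k)%R.
Proof. unfold gamma_pt. destruct mu; simpl; ring. Qed.

Lemma gamma_pt_add kap mu n k j : gamma_pt kap mu n k + RtoC (INR j) = gamma_pt kap mu (n + j) k.
Proof. unfold gamma_pt. rewrite plus_INR, RtoC_plus. ring. Qed.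

Lemma gamma_pt_succ kap mu n k : gamma_pt kap (mu + 1) n k = gamma_pt kap mu n k + 1.
Proof. unfold gamma_pt. ring. Qed.

Lemma gamma_pt_neq kap mu n k : ~ nonpos_lattice kap mu -> forall m : nat, gamma_pt kap mu n k <> - RtoC (INR m).
Proof.
  intros H m E. apply H. exists (- Z.of_nat (n + m))%Z, (- k)%Z. split; [lia|].
  rewrite !opp_IZR, <- INR_IZR_INZ, plus_INR.
  replace mu with (gamma_pt kap mu n k - RtoC (INR n) - RtoC (kap * IZR k) * Ci) by (unfold gamma_pt; ring).
  rewrite E, !RtoC_mult, !RtoC_opp, RtoC_plus. ring.
Qed.

Lemma nonpos_lattice_succ kap mu : ~ nonpos_lattice kap mu -> ~ nonpos_lattice kap (mu + 1).
Proof.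
  intros H [m [k [Hm E]]]. apply H. exists (m - 1)%Z, k. split; [lia|].
  rewrite minus_IZR, RtoC_minus. replace mu with (mu + 1 - 1) by ring. rewrite E. ring.
Qed.

Lemma nonpos_lattice_pos kap mu : (0 < Re mu)%R -> ~ nonpos_lattice kap mu.
Proof.
  intros H [m [k [Hm E]]]. rewrite E in H. simpl in H. apply IZR_le in Hm. nra.
Qed.

(** For large [k] the imaginary part grows linearly, for large [n] the real part
    is at least [1], and finitely many points, none of them [0], remain. *)
Lemma gamma_pt_lower kap mu : (0 < kap)%R -> ~ nonpos_lattice kap mu ->
  exists c, (0 < c)%R /\ forall n k, (c * (1 + Rabs (IZR k)) <= Cmod (gamma_pt kap mu n k))%R.
Proof.
  intros Hk Hmu.
  destruct (nat_above (1 - Re mu)) as [n0 Hn0].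
  destruct (nat_above ((Rabs (Im mu) + kap / 4) / (3 * kap / 4))) as [k0 Hk0].
  assert (Hk0' : (Rabs (Im mu) + kap / 4 <= 3 * kap / 4 * INR k0)%R).
  { apply (Rmult_le_compat_r (3 * kap / 4)) in Hk0; [|lra].
    replace ((Rabs (Im mu) + kap / 4) / (3 * kap / 4) * (3 * kap / 4))%R with (Rabs (Im mu) + kap / 4)%R in Hk0 by (field; lra).
    lra. }
  destruct (finite_min (fun n m => Rmin (Cmod (gamma_pt kap mu n (Z.of_nat m))) (Cmod (gamma_pt kap mu n (- Z.of_nat m)%Z))))
    with (N := n0) (M := k0) as [d [Hd Hdm]].
  { intros n m. apply Rmin_pos; apply Cmod_gt_0; intros E;
      apply (gamma_pt_neq kap mu n _ Hmu O) in E || (eapply (gamma_pt_neq kap mu n _ Hmu O); rewrite E); simpl; ring. }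
  set (d' := Rmin 1 d). assert (Hd' : (0 < d')%R) by (apply Rmin_pos; lra).
  assert (Hk00 := pos_INR k0).
  exists (Rmin (kap / 4) (d' / (1 + INR k0))). split.
  { apply Rmin_pos; [lra|]. apply Rdiv_lt_0_compat; lra. }
  intros n k. assert (Hka := Rabs_pos (IZR k)).
  destruct (Rle_dec (INR k0) (Rabs (IZR k))) as [Hc|Hc].
  - apply Rle_trans with (kap / 4 * (1 + Rabs (IZR k)))%R.
    { apply Rmult_le_compat_r; [lra|apply Rmin_l]. }
    eapply Rle_trans; [|apply Rabs_Im_le]. rewrite Im_gamma_pt.
    assert (T := Rabs_triang (Im mu + kap * IZR k) (- Im mu)).
    replace (Im mu + kap * IZR k + - Im mu)%R with (kap * IZR k)%R in T by ring.
    rewrite Rabs_Ropp, Rabs_mult, (Rabs_pos_eq kap) in T by lra. nra.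
  - apply Rle_trans with (d' / (1 + INR k0) * (1 + Rabs (IZR k)))%R.
    { apply Rmult_le_compat_r; [lra|apply Rmin_r]. }
    apply Rle_trans with d'.
    { apply (Rmult_le_reg_r (1 + INR k0)); [lra|].
      replace (d' / (1 + INR k0) * (1 + Rabs (IZR k)) * (1 + INR k0))%R with (d' * (1 + Rabs (IZR k)))%R by (field; lra).
      apply Rmult_le_compat_l; lra. }
    destruct (le_lt_dec n0 n) as [Hn|Hn].
    + apply le_INR in Hn. eapply Rle_trans; [apply Rmin_l|].
      eapply Rle_trans; [|apply Rabs_Re_le]. rewrite Re_gamma_pt. rewrite Rabs_pos_eq; lra.
    + eapply Rle_trans; [apply Rmin_r|].
      assert (Hkn : (Z.abs_nat k < k0)%nat).
      { apply INR_lt. rewrite INR_abs_nat. lra. }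
      specialize (Hdm n (Z.abs_nat k) Hn Hkn). cbv beta in Hdm.
      eapply Rle_trans; [exact Hdm|].
      destruct (Z_le_dec 0 k).
      * eapply Rle_trans; [apply Rmin_l|]. replace (Z.of_nat (Z.abs_nat k)) with k by lia. lra.
      * eapply Rle_trans; [apply Rmin_r|]. replace (- Z.of_nat (Z.abs_nat k))%Z with k by lia. lra.
Qed.

Lemma gamma_pow_rec s L : (forall m : nat, s <> - RtoC (INR m)) -> s * gamma_pow s L = Cexp L * gamma_pow (s + 1) L.
Proof.
  intros H. unfold gamma_pow. rewrite CGamma_rec by exact H.
  replace (- (s * L)) with (L + - ((s + 1) * L)) by ring. rewrite Cexp_add. ring.
Qed.

Lemma gamma_pow_rising s L n : (forall m : nat, s <> - RtoC (INR m)) ->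
  rising s n * gamma_pow s L = Cexp (RtoC (INR n) * L) * gamma_pow (s + RtoC (INR n)) L.
Proof.
  intros H. unfold gamma_pow. rewrite CGamma_rising by exact H.
  replace (- (s * L)) with (RtoC (INR n) * L + - ((s + RtoC (INR n)) * L)) by ring. rewrite Cexp_add. ring.
Qed.

Lemma gamma_pow_bound_right s L p : (1 <= Re s)%R -> in_strip L -> (Re s + 1 <= INR p)%R ->
  (Cmod (gamma_pow s L) <= 2 * decay_const (rate L) p)%R.
Proof.
  intros Hs HL Hp. assert (Hc := rate_pos L HL).
  replace (2 * decay_const (rate L) p)%R with (2 * decay_const (rate L) p / 1)%R by apply Rdiv_1_r.
  apply (lineint_norm (Phi s L)); [lra|left; now apply decay_const_pos|apply Ccont_Phi| |apply gamma_pow_lineint; [lra|exact HL]].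
  intros y. rewrite Cmod_Phi. apply gamma_integrand_bound; lra.
Qed.

Lemma decay_const_le_pow c n p : (0 < c)%R ->
  (decay_const c (n + p) <= 2 * (1 + / c) ^ p * ((1 + / c) ^ n * INR (fact (n + p))))%R.
Proof.
  intros Hc. set (r := (1 + / c)%R). assert (Hi := Rinv_0_lt_compat c Hc).
  replace (2 * r ^ p * (r ^ n * INR (fact (n + p))))%R with (2 * (INR (fact (n + p)) * r ^ (n + p)))%R
    by (rewrite pow_add; ring).
  assert (Hf := fact_ge1 (n + p)). unfold decay_const, Rdiv. rewrite <- pow_inv.
  assert (Hr1 : (1 <= r ^ (n + p))%R) by (apply pow_R1_Rle; unfold r; lra).
  assert (Hr2 : ((/ c) ^ (n + p) <= r ^ (n + p))%R) by (apply pow_incr; unfold r; lra).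
  assert (Hi0 : (0 <= (/ c) ^ (n + p))%R) by (apply pow_le; lra). nra.
Qed.

(** Shifting the argument [N + 4] steps to the right reaches the half-plane where
    the integral bounds [gamma_pow] uniformly in [k]; each of the factors divided
    out on the way is at least of order [1 + |s|] and of order [1 + |k|]. Two
    powers of each are enough: [1 / k^2] is summable, and a second derivative
    in [L] costs [|s|^2]. *)
Lemma gamma_pow_decay kap mu L : (0 < kap)%R -> ~ nonpos_lattice kap mu -> in_strip L ->
  exists K p r, (0 <= K)%R /\ (0 < r)%R /\ forall n k,
   (Cmod (gamma_pow (gamma_pt kap mu n k) L) * (1 + Cmod (gamma_pt kap mu n k)) ^ 2 * (1 + Rabs (IZR k)) ^ 2
      <= K * (r ^ n * INR (fact (n + p))))%R.
Proof.
  intros Hk Hmu HL.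
  destruct (gamma_pt_lower kap mu Hk Hmu) as [c1 [Hc1 Hlow]].
  destruct (nat_above (1 - Re mu)) as [N HN].
  destruct (nat_above (Re mu + INR (N + 4) + 1)) as [p Hp].
  assert (Hc := rate_pos L HL). set (c := rate L) in *.
  set (r := (1 + / c)%R). assert (Hr : (0 < r)%R) by (unfold r; generalize (Rinv_0_lt_compat c Hc); lra).
  (* [|s| <= |s + j| + j] and [c1 <= |s + j|] give [d (1 + |s|) <= |s + j|] *)
  set (d := (/ (1 + (1 + INR (N + 4)) / c1))%R).
  assert (HN4 := pos_INR (N + 4)).
  assert (Hdd : (0 < 1 + (1 + INR (N + 4)) / c1)%R).
  { assert (0 < (1 + INR (N + 4)) / c1)%R by (apply Rdiv_lt_0_compat; lra). lra. }
  assert (Hd : (0 < d)%R) by now apply Rinv_0_lt_compat.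
  set (low := (c1 ^ N * (d ^ 2 * c1 ^ 2))%R).
  assert (Hlow0 : (0 < low)%R).
  { unfold low. apply Rmult_lt_0_compat; [|apply Rmult_lt_0_compat]; apply pow_lt; lra. }
  set (E := exp (INR (N + 4) * Re L)). assert (HE : (0 < E)%R) by apply exp_pos.
  exists (/ low * E * (2 * (2 * r ^ p)))%R, p, r.
  assert (Hrp : (0 < r ^ p)%R) by now apply pow_lt.
  split.
  { assert (Hil := Rinv_0_lt_compat low Hlow0).
    apply Rmult_le_pos; [apply Rmult_le_pos; lra|lra]. }
  split; [exact Hr|]. intros n k.
  set (s := gamma_pt kap mu n k).
  assert (Hs := gamma_pt_neq kap mu n k Hmu). fold s in Hs.
  assert (Hs0 := Cmod_ge_0 s). assert (Hka := Rabs_pos (IZR k)).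
  assert (Hj1 : forall j, (c1 * (1 + Rabs (IZR k)) <= Cmod (s + RtoC (INR j))%C)%R).
  { intros j. unfold s. rewrite gamma_pt_add. apply Hlow. }
  assert (Hj2 : forall j, (j <= N + 4)%nat -> (d * (1 + Cmod s) <= Cmod (s + RtoC (INR j))%C)%R).
  { intros j Hj. apply le_INR in Hj. assert (Hj0 := pos_INR j).
    assert (T := Cmod_triangle (s + RtoC (INR j)) (- RtoC (INR j))).
    replace (s + RtoC (INR j) + - RtoC (INR j)) with s in T by ring.
    rewrite Cmod_opp, Cmod_R, Rabs_pos_eq in T by exact Hj0.
    specialize (Hj1 j). set (m := Cmod (s + RtoC (INR j))%C) in *.
    assert (Hm : (c1 <= m)%R) by nra.
    apply (Rmult_le_reg_l (1 + (1 + INR (N + 4)) / c1)); [exact Hdd|].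
    rewrite <- Rmult_assoc. unfold d. rewrite Rinv_r, Rmult_1_l by lra.
    rewrite Rmult_plus_distr_r.
    assert (X : (1 + INR (N + 4) <= (1 + INR (N + 4)) / c1 * m)%R).
    { apply (Rmult_le_reg_r c1); [exact Hc1|].
      replace ((1 + INR (N + 4)) / c1 * m * c1)%R with ((1 + INR (N + 4)) * m)%R by (field; lra).
      apply Rmult_le_compat_l; lra. }
    lra. }
  assert (HrN : (c1 ^ N <= Cmod (rising s N))%R).
  { clear HN Hp Hj2 low Hlow0 E HE d Hdd Hd HN4. induction N as [|N IH].
    - simpl. rewrite Cmod_1; lra.
    - simpl rising. rewrite Cmod_mult. simpl pow. rewrite Rmult_comm.
      apply Rmult_le_compat; [apply pow_le; lra|lra|exact IH|].
      specialize (Hj1 N). nra. }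
  assert (Hrise : (low * ((1 + Cmod s) ^ 2 * (1 + Rabs (IZR k)) ^ 2) <= Cmod (rising s (N + 4)))%R).
  { replace (N + 4)%nat with (S (S (S (S N)))) at 1 by lia.
    cbn [rising]. rewrite !Cmod_mult.
    assert (J0 := Hj2 N ltac:(lia)). assert (J1 := Hj2 (S N) ltac:(lia)).
    assert (J2 := Hj1 (S (S N))). assert (J3 := Hj1 (S (S (S N)))).
    set (A := (1 + Cmod s)%R) in *. set (B := (1 + Rabs (IZR k))%R) in *.
    replace (low * (A ^ 2 * B ^ 2))%R with (c1 ^ N * (d * A) * (d * A) * (c1 * B) * (c1 * B))%R
      by (unfold low; ring).
    assert (HA : (0 <= d * A)%R) by (apply Rmult_le_pos; unfold A; lra).
    assert (HB : (0 <= c1 * B)%R) by (apply Rmult_le_pos; unfold B; lra).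
    assert (HcN : (0 <= c1 ^ N)%R) by (apply pow_le; lra).
    repeat (apply Rmult_le_compat; [repeat (apply Rmult_le_pos; [|assumption]); assumption|assumption| |assumption]).
    exact HrN. }
  assert (HG := gamma_pow_rising s L (N + 4) Hs).
  apply (f_equal Cmod) in HG. rewrite !Cmod_mult, Cmod_Cexp in HG.
  replace (Re (RtoC (INR (N + 4)) * L)) with (INR (N + 4) * Re L)%R in HG by (destruct L; cbn [Re Im fst snd Cmult RtoC]; ring).
  fold E in HG.
  assert (Hre : Re (s + RtoC (INR (N + 4))) = (Re mu + INR n + INR (N + 4))%R).
  { unfold s. rewrite gamma_pt_add, Re_gamma_pt, !plus_INR. ring. }
  assert (HB : (Cmod (gamma_pow (s + RtoC (INR (N + 4))) L) <= 2 * decay_const c (n + p))%R).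
  { apply gamma_pow_bound_right; [|exact HL|]; rewrite Hre; rewrite !plus_INR in *; generalize (pos_INR n); simpl in *; lra. }
  assert (HF := decay_const_le_pow c n p Hc). fold r in HF.
  set (X := (r ^ n * INR (fact (n + p)))%R) in *.
  set (G := Cmod (gamma_pow s L)) in *. assert (HG0 : (0 <= G)%R) by apply Cmod_ge_0.
  set (Y := ((1 + Cmod s) ^ 2 * (1 + Rabs (IZR k)) ^ 2)%R) in *.
  rewrite Rmult_assoc. fold Y.
  apply (Rmult_le_reg_l low); [exact Hlow0|].
  replace (low * (/ low * E * (2 * (2 * r ^ p)) * X))%R with (E * (2 * (2 * r ^ p * X)))%R by (field; lra).
  apply Rle_trans with (Cmod (rising s (N + 4)) * G)%R; [nra|].
  rewrite HG. apply Rmult_le_compat_l; lra.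
Qed.

(** * The bilateral series and the outer series *)

Section Outer.
Variable q : R.
Hypothesis hq : (0 < q < 1)%R.

Definition qh : R := (- ln q)%R.
Definition qkap : R := (2 * PI / qh)%R.

Lemma qh_pos : (0 < qh)%R.
Proof. unfold qh. assert (ln q < 0)%R; [|lra]. rewrite <- ln_1. apply ln_increasing; lra. Qed.

Lemma qkap_pos : (0 < qkap)%R.
Proof. apply Rdiv_lt_0_compat; [generalize PI_RGT_0; lra|apply qh_pos]. Qed.

Lemma exp_qh n : exp (- (INR n * qh)) = (q ^ n)%R.
Proof.
  replace (- (INR n * qh))%R with (INR n * ln q)%R by (unfold qh; ring).
  rewrite <- pow_exp, exp_ln by lra. reflexivity.
Qed.

(** [x^(-mu-n) Psi (mu + n, kappa pi / 2, x^(- i kappa))] for [x = e^L]. *)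
Definition inner_sum (mu : C) (n : nat) (L : C) : C := ZSeries (fun k => gamma_pow (gamma_pt qkap mu n k) L).

Definition outer_sum (mu L : C) : C := CSeries (fun n => RtoC (eul_coef q n) * inner_sum mu n L).

Lemma strip_shift L t : in_strip L -> in_strip (L + RtoC t).
Proof. destruct L; simpl. now rewrite Rplus_0_r. Qed.

(** One dominating product for the double series and for its second derivative
    in [L], valid along whole periods [|t| <= 2 h]. *)
Lemma outer_dom mu L : ~ nonpos_lattice qkap mu -> in_strip L ->
  exists A B : nat -> R, ex_series A /\ ex_series B /\ (forall n, 0 <= A n)%R /\ (forall k, 0 <= B k)%R /\
  forall n k t, (Rabs t <= 2 * qh)%R ->
   (Rabs (eul_coef q n) * (Cmod (gamma_pow (gamma_pt qkap mu n k) (L + RtoC t)%C) * (1 + Cmod (gamma_pt qkap mu n k)) ^ 2)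
     <= A n * B (Z.abs_nat k))%R.
Proof.
  intros Hmu HL.
  destruct (gamma_pow_decay qkap mu L qkap_pos Hmu HL) as [K [p [r [HK [Hr Hdec]]]]].
  assert (Hh := qh_pos).
  set (M := exp (2 * qh * Rabs (Re mu))). assert (HM : (0 < M)%R) by apply exp_pos.
  set (r2 := (r * exp (2 * qh))%R).
  assert (Hr2 : (0 < r2)%R) by (apply Rmult_lt_0_compat; [exact Hr|apply exp_pos]).
  exists (fun n => K * M * (Rabs (eul_coef q n) * r2 ^ n * INR (fact (n + p))))%R, (fun k => / (1 + INR k) ^ 2)%R.
  split; [|split; [|split; [|split]]].
  - apply ex_series_scalR. now apply ex_series_eul_coef_fact.
  - apply ex_series_inv_sqr.
  - intros n. apply Rmult_le_pos; [apply Rmult_le_pos; lra|].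
    apply Rmult_le_pos; [|left; apply INR_fact_lt_0].
    apply Rmult_le_pos; [apply Rabs_pos|apply pow_le; lra].
  - intros k. left. apply Rinv_0_lt_compat, pow_lt. generalize (pos_INR k); lra.
  - intros n k t Ht. set (s := gamma_pt qkap mu n k). specialize (Hdec n k). fold s in Hdec.
    cbv beta. rewrite INR_abs_nat.
    assert (Hka := Rabs_pos (IZR k)).
    assert (HB : (0 < (1 + Rabs (IZR k)) ^ 2)%R) by (apply pow_lt; lra).
    set (B := ((1 + Rabs (IZR k)) ^ 2)%R) in *.
    assert (EG : (Cmod (gamma_pow s (L + RtoC t)%C) <= Cmod (gamma_pow s L) * (M * exp (2 * qh) ^ n))%R).
    { unfold gamma_pow. replace (- (s * (L + RtoC t))) with (- (s * L) + - (s * RtoC t)) by ring.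
      rewrite Cexp_add, Cmult_assoc, (Cmod_mult _ (Cexp (- (s * RtoC t)))), Cmod_Cexp.
      apply Rmult_le_compat_l; [apply Cmod_ge_0|].
      rewrite pow_exp. unfold M. rewrite <- exp_plus. apply exp_le.
      replace (Re (- (s * RtoC t))) with (- (Re s * t))%R by (destruct s; simpl; ring).
      unfold s. rewrite Re_gamma_pt.
      eapply Rle_trans; [apply Rle_abs|]. rewrite Rabs_Ropp, Rabs_mult.
      assert (T := Rabs_triang (Re mu) (INR n)). rewrite (Rabs_pos_eq (INR n)) in T by apply pos_INR.
      apply Rle_trans with ((Rabs (Re mu) + INR n) * (2 * qh))%R; [|right; ring].
      apply Rmult_le_compat; [apply Rabs_pos|apply Rabs_pos|exact T|exact Ht]. }
    set (S2 := ((1 + Cmod s) ^ 2)%R) in *.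
    assert (HS2 : (0 <= S2)%R) by apply pow2_ge_0.
    assert (Ha := Rabs_pos (eul_coef q n)).
    replace (K * M * (Rabs (eul_coef q n) * r2 ^ n * INR (fact (n + p))) * / B)%R
      with (Rabs (eul_coef q n) * ((K * (r ^ n * INR (fact (n + p)))) * / B * (M * exp (2 * qh) ^ n)))%R.
    2: { unfold r2. rewrite Rpow_mult_distr. ring. }
    apply Rmult_le_compat_l; [exact Ha|].
    assert (HMe : (0 <= M * exp (2 * qh) ^ n)%R) by (apply Rmult_le_pos; [lra|apply pow_le; left; apply exp_pos]).
    apply Rle_trans with ((Cmod (gamma_pow s L) * S2) * (M * exp (2 * qh) ^ n))%R; [nra|].
    apply Rmult_le_compat_r; [exact HMe|].
    apply (Rmult_le_reg_r B); [exact HB|]. rewrite (Rmult_assoc _ (/ B)), Rinv_l by lra. lra.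
Qed.

Lemma one_le_sq s : (1 <= (1 + Cmod s) ^ 2)%R.
Proof. generalize (Cmod_ge_0 s). nra. Qed.

Lemma inner_sum_dom mu L : ~ nonpos_lattice qkap mu -> in_strip L ->
  exists A : nat -> R, ex_series A /\ forall n,
    ex_Zseries (fun k => gamma_pow (gamma_pt qkap mu n k) L) /\
    is_Cseries (zfold (fun k => gamma_pow (gamma_pt qkap mu n k) L)) (inner_sum mu n L) /\
    (Rabs (eul_coef q n) * Cmod (inner_sum mu n L) <= A n)%R.
Proof.
  intros Hmu HL. destruct (outer_dom mu L Hmu HL) as [A [B [HA [HB [HA0 [HB0 H]]]]]].
  exists (fun n => (2 * Series B) * A n)%R. split; [now apply ex_series_scalR|].
  intros n. assert (Ha := eul_coef_abs_pos q hq n).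
  destruct (zfold_dom (fun k => gamma_pow (gamma_pt qkap mu n k) L) (A n / Rabs (eul_coef q n)) B) as [X [Y Z]]; auto.
  - intros k. specialize (H n k 0%R). rewrite Rabs_R0 in H. specialize (H ltac:(generalize qh_pos; lra)).
    replace (L + RtoC 0) with L in H by ring.
    apply (Rmult_le_reg_l (Rabs (eul_coef q n))); [exact Ha|].
    replace (Rabs (eul_coef q n) * (A n / Rabs (eul_coef q n) * B (Z.abs_nat k)))%R with (A n * B (Z.abs_nat k))%R by (field; lra).
    eapply Rle_trans; [|exact H]. apply Rmult_le_compat_l; [lra|].
    generalize (one_le_sq (gamma_pt qkap mu n k)) (Cmod_ge_0 (gamma_pow (gamma_pt qkap mu n k) L)). intros; nra.
  - split; [exact X|]. split; [exact Y|].
    fold (inner_sum mu n L) in Z. apply (Rmult_le_compat_l (Rabs (eul_coef q n))) in Z; [|lra].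
    eapply Rle_trans; [exact Z|]. right. field. lra.
Qed.

Lemma inner_sum_correct mu L : ~ nonpos_lattice qkap mu -> in_strip L -> forall n,
  ex_Zseries (fun k => gamma_pow (gamma_pt qkap mu n k) L) /\
  is_Cseries (zfold (fun k => gamma_pow (gamma_pt qkap mu n k) L)) (inner_sum mu n L).
Proof.
  intros Hmu HL n. destruct (inner_sum_dom mu L Hmu HL) as [A [_ H]]. destruct (H n) as [X [Y _]]. auto.
Qed.

Lemma outer_sum_correct mu L : ~ nonpos_lattice qkap mu -> in_strip L ->
  is_Cseries (fun n => RtoC (eul_coef q n) * inner_sum mu n L) (outer_sum mu L).
Proof.
  intros Hmu HL. destruct (inner_sum_dom mu L Hmu HL) as [A [HA H]].
  apply (CSeries_correct _ A); [|exact HA]. intros n. rewrite Cmod_mult, Cmod_R. apply (H n).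
Qed.

(** [q^(i kappa) = 1]: all terms of the bilateral series are multiplied by the
    same factor when [x] is replaced by [q x]. *)
Lemma inner_sum_period mu n L : ~ nonpos_lattice qkap mu -> in_strip L ->
  inner_sum mu n (L + RtoC (- qh)) = Cexp ((mu + RtoC (INR n)) * RtoC qh) * inner_sum mu n L.
Proof.
  intros Hmu HL.
  destruct (inner_sum_correct mu L Hmu HL n) as [_ H1].
  destruct (inner_sum_correct mu _ Hmu (strip_shift L (- qh) HL) n) as [_ H2].
  apply (is_Cseries_unique _ _ _ H2).
  eapply is_Cseries_ext; [|apply is_Cseries_scal, H1]. intros k; cbv beta.
  rewrite <- zfold_scal. apply zfold_ext. intros j. unfold gamma_pow.
  replace (- (gamma_pt qkap mu n j * (L + RtoC (- qh)))) with
    ((mu + RtoC (INR n)) * RtoC qh + RtoC (2 * PI * IZR j) * Ci + - (gamma_pt qkap mu n j * L)).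
  - rewrite !Cexp_add. replace (Cexp (RtoC (2 * PI * IZR j) * Ci)) with (RtoC 1); [ring|].
    symmetry. unfold Cexp.
    replace (Re (RtoC (2 * PI * IZR j) * Ci)) with 0%R by (simpl; ring).
    replace (Im (RtoC (2 * PI * IZR j) * Ci)) with (0 + 2 * PI * IZR j)%R by (simpl; ring).
    rewrite cos_period_Z, sin_period_Z, exp_0, cos_0, sin_0. apply Ceq; simpl; ring.
  - unfold gamma_pt. rewrite RtoC_opp.
    replace (RtoC (2 * PI * IZR j)) with (RtoC (qkap * IZR j) * RtoC qh).
    + ring.
    + rewrite <- RtoC_mult. f_equal. unfold qkap. field. generalize qh_pos; lra.
Qed.

Lemma inner_sum_succ mu n L : inner_sum (mu + 1) n L = inner_sum mu (S n) L.
Proof.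
  assert (E : forall k, gamma_pt qkap (mu + 1) n k = gamma_pt qkap mu (S n) k).
  { intros k. unfold gamma_pt. rewrite S_INR, RtoC_plus. ring. }
  unfold inner_sum, ZSeries, CSeries.
  f_equal; f_equal; apply Series_ext; intros k; now rewrite E.
Qed.

End Outer.

(** * The two sides as functions of the logarithm of x *)

Lemma qpoch_S a q n : qpoch a q (S n) = (1 - a) * qpoch (a * q) q n.
Proof.
  induction n as [|n IH].
  - simpl. ring.
  - change (qpoch a q (S (S n))) with (qpoch a q (S n) * (1 - a * q ^ S n)).
    rewrite IH. simpl. ring.
Qed.

Lemma INR_sq_le_4 n : (INR n ^ 2 <= 4 ^ n)%R.
Proof.
  assert (H : (INR n <= 2 ^ n)%R).
  { induction n as [|n IH]; [simpl; lra|]. rewrite S_INR.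
    assert (1 <= 2 ^ n)%R by (apply pow_R1_Rle; lra). simpl; lra. }
  replace 4%R with (2 ^ 2)%R by ring.
  rewrite <- pow_mult, Nat.mul_comm, pow_mult. apply pow_incr. split; [apply pos_INR|exact H].
Qed.

Section Main.
Variable q : R.
Hypothesis hq : (0 < q < 1)%R.
Notation h := (qh q).
Notation kap := (qkap q).
Notation al := (eul_coef q).
Notation qpow mu := (Cpower (RtoC q) mu).

Lemma RtoC_q_neq_0 : RtoC q <> 0.
Proof. apply RtoC_neq_0; lra. Qed.

Lemma qpow_exp mu : qpow mu = Cexp (- (mu * RtoC h)).
Proof.
  unfold Cpower. rewrite Clog_RtoC by lra. f_equal. unfold qh. rewrite RtoC_opp. ring.
Qed.

Lemma Cexp_h n : Cexp (- (RtoC (INR n) * RtoC h)) = RtoC (q ^ n).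
Proof. rewrite <- RtoC_mult, <- RtoC_opp, Cexp_RtoC, exp_qh by exact hq. reflexivity. Qed.

Lemma qpow_succ mu : qpow (mu + 1) = qpow mu * RtoC q.
Proof.
  rewrite !qpow_exp.
  replace (RtoC q) with (Cexp (- (RtoC (INR 1) * RtoC h))) by (rewrite Cexp_h, pow_1; reflexivity).
  rewrite <- Cexp_add. f_equal. simpl INR. ring.
Qed.

(** [q^mu = 1] only on the column [m = 0] of the excluded lattice. *)
Lemma nonpos_lattice_qpow mu : ~ nonpos_lattice kap mu -> qpow mu <> 1.
Proof.
  intros Hmu E. rewrite qpow_exp in E. assert (Hh := qh_pos q hq).
  assert (E1 := f_equal Cmod E). rewrite Cmod_Cexp, Cmod_1, <- exp_0 in E1. apply exp_inv in E1.
  replace (Re (- (mu * RtoC h))) with (- (Re mu * h))%R in E1 by (destruct mu; simpl; ring).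
  assert (Hre : Re mu = 0%R) by nra.
  assert (E2 := f_equal Re E). unfold Cexp in E2.
  replace (Re (- (mu * RtoC h))) with 0%R in E2 by (destruct mu; simpl in *; subst; ring).
  replace (Im (- (mu * RtoC h))) with (- (Im mu * h))%R in E2 by (destruct mu; simpl; ring).
  rewrite exp_0 in E2. simpl in E2.
  assert (E3 : cos (- (Im mu * h)) = 1%R) by lra.
  replace (- (Im mu * h))%R with (2 * (- (Im mu * h) / 2))%R in E3 by field.
  rewrite cos_2a_sin in E3.
  assert (E4 : sin (- (Im mu * h) / 2) = 0%R) by nra.
  apply sin_eq_0_0 in E4. destruct E4 as [k Hk].
  apply Hmu. exists 0%Z, (- k)%Z. split; [lia|].
  apply Ceq; simpl; [rewrite Hre; ring|].
  rewrite opp_IZR. unfold qkap.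
  replace (Im mu) with (- 2 * (- (Im mu * h) / 2) / h)%R by (field; lra). rewrite Hk. field. lra.
Qed.

Lemma qpoch_bound a n : (Cmod (qpoch a (RtoC q) n) <= (1 + Cmod a) ^ n)%R.
Proof.
  induction n as [|n IH]; simpl.
  - rewrite Cmod_1; lra.
  - rewrite Cmod_mult, Rmult_comm. apply Rmult_le_compat; try apply Cmod_ge_0; [|exact IH].
    eapply Rle_trans; [apply Cmod_triangle|]. rewrite Cmod_1, Cmod_opp, Cmod_mult, <- RtoC_pow, Cmod_R.
    rewrite Rabs_pos_eq by (left; now apply qpow_pos).
    generalize (qpow_le1 q hq n) (Cmod_ge_0 a). intros; nra.
Qed.

Lemma F_term_bound mu x n :
  (Cmod (F_term mu q x n) <= ((1 + Cmod (qpow mu)) * Cmod x) ^ n / INR (fact n))%R.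
Proof.
  unfold F_term. rewrite Cmod_mult, Cmod_div by (apply RtoC_neq_0, INR_fact_neq_0).
  rewrite Cmod_pow, Cmod_opp, Cmod_R, Rabs_pos_eq by apply pos_INR.
  rewrite Rpow_mult_distr. unfold Rdiv.
  replace ((1 + Cmod (qpow mu)) ^ n * Cmod x ^ n * / INR (fact n))%R
    with ((1 + Cmod (qpow mu)) ^ n * / INR (fact n) * Cmod x ^ n)%R by ring.
  apply Rmult_le_compat_r; [apply pow_le, Cmod_ge_0|].
  apply Rmult_le_compat_r; [left; apply Rinv_0_lt_compat, INR_fact_lt_0|apply qpoch_bound].
Qed.

Lemma F_correct mu x : is_Cseries (F_term mu q x) (F mu q x).
Proof.
  apply (CSeries_correct _ _ (F_term_bound mu x)). eexists; apply is_series_exp.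
Qed.

(** Because [(1 - q^(mu + n)) (q^mu; q)_n = (1 - q^mu) (q^(mu+1); q)_n]. *)
Lemma F_functional mu x : F mu q x - qpow mu * F mu q (RtoC q * x) = (1 - qpow mu) * F (mu + 1) q x.
Proof.
  assert (H1 := is_Cseries_minus _ _ _ _ (F_correct mu x) (is_Cseries_scal (qpow mu) _ _ (F_correct mu (RtoC q * x)))).
  assert (H2 := is_Cseries_scal (1 - qpow mu) _ _ (F_correct (mu + 1) x)).
  apply (is_Cseries_unique _ _ _ H1). eapply is_Cseries_ext; [|exact H2].
  intros n; cbv beta. unfold F_term. rewrite qpow_succ.
  assert (Hf : RtoC (INR (fact n)) <> 0) by apply RtoC_neq_0, INR_fact_neq_0.
  replace (- (RtoC q * x)) with (RtoC q * (- x)) by ring. rewrite Cpow_mult_l.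
  assert (E := qpoch_S (qpow mu) (RtoC q) n). simpl qpoch in E.
  replace ((1 - qpow mu) * (qpoch (qpow mu * RtoC q) (RtoC q) n / RtoC (INR (fact n)) * (- x) ^ n))
    with (((1 - qpow mu) * qpoch (qpow mu * RtoC q) (RtoC q) n) / RtoC (INR (fact n)) * (- x) ^ n)
    by (field; exact Hf).
  rewrite <- E. field. exact Hf.
Qed.

(** The left-hand sum is [x dF/dx]. *)
Lemma F_euler mu x : is_Cseries (fun n => RtoC (INR n) * F_term mu q x n) (- x * (1 - qpow mu) * F (mu + 1) q x).
Proof.
  assert (H2 := is_Cseries_scal (- x * (1 - qpow mu)) _ _ (F_correct (mu + 1) x)).
  assert (X := is_Cseries_incr_1 (fun n => RtoC (INR n) * F_term mu q x n) (- x * (1 - qpow mu) * F (mu + 1) q x)).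
  cbv beta in X. change (INR 0) with 0%R in X. rewrite Cmult_0_l, Cplus_0_l in X. apply X.
  eapply is_Cseries_ext; [|exact H2]. intros n; cbv beta. unfold F_term. rewrite qpoch_S, qpow_succ.
  rewrite fact_simpl, mult_INR, RtoC_mult.
  assert (Hf : RtoC (INR (fact n)) <> 0) by apply RtoC_neq_0, INR_fact_neq_0.
  assert (Hs : RtoC (INR (S n)) <> 0) by (apply RtoC_neq_0, not_0_INR; discriminate).
  simpl Cpow. field. auto.
Qed.

(** The derivative of [F] in [L] is [- e^L (1 - q^mu)] times the same function at
    [mu + 1]. *)
Lemma F_quad mu L : exists K, forall t t', (t <= 0)%R -> (t' <= 0)%R ->
  (Cmod (F mu q (Cexp (L + RtoC t')) - F mu q (Cexp (L + RtoC t))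
     + RtoC (t' - t) * (Cexp (L + RtoC t) * ((1 - qpow mu) * F (mu + 1) q (Cexp (L + RtoC t)))))%C
   <= K * (t' - t) ^ 2)%R.
Proof.
  set (m := ((1 + Cmod (qpow mu)) * Cmod (Cexp L))%R).
  assert (Hm : (0 <= m)%R).
  { apply Rmult_le_pos; [|apply Cmod_ge_0]. generalize (Cmod_ge_0 (qpow mu)); lra. }
  assert (HK := is_series_exp (4 * m)). set (K := exp (4 * m)) in HK.
  exists K. intros t t' Ht Ht'. set (d := (t' - t)%R).
  set (x := Cexp (L + RtoC t)).
  assert (Ht1 : forall n, F_term mu q (Cexp (L + RtoC t')) n = Cexp (RtoC (INR n * d)) * F_term mu q x n).
  { intros n. unfold F_term, x.
    replace (L + RtoC t') with ((L + RtoC t) + RtoC d) by (unfold d; rewrite RtoC_minus; ring).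
    rewrite (Cexp_add (L + RtoC t)).
    replace (- (Cexp (L + RtoC t) * Cexp (RtoC d))) with (- Cexp (L + RtoC t) * Cexp (RtoC d)) by ring.
    rewrite Cpow_mult_l, Cexp_pow, <- RtoC_mult. ring. }
  assert (HS : is_Cseries (fun n => F_term mu q (Cexp (L + RtoC t')) n - F_term mu q x n
                 - RtoC d * (RtoC (INR n) * F_term mu q x n))
     (F mu q (Cexp (L + RtoC t')) - F mu q x - RtoC d * (- x * (1 - qpow mu) * F (mu + 1) q x))).
  { apply is_Cseries_minus; [apply is_Cseries_minus; apply F_correct|]. apply is_Cseries_scal, F_euler. }
  replace (F mu q (Cexp (L + RtoC t')) - F mu q x + RtoC d * (x * ((1 - qpow mu) * F (mu + 1) q x)))
    with (F mu q (Cexp (L + RtoC t')) - F mu q x - RtoC d * (- x * (1 - qpow mu) * F (mu + 1) q x)) by ring.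
  rewrite Rmult_comm.
  refine (is_Cseries_norm _ (fun n => d ^ 2 * ((4 * m) ^ n / INR (fact n)))%R _ _ _ HS _).
  2: apply is_series_scalR, HK.
  intros n. rewrite Ht1.
  replace (Cexp (RtoC (INR n * d)) * F_term mu q x n - F_term mu q x n - RtoC d * (RtoC (INR n) * F_term mu q x n))
    with ((Cexp (RtoC (INR n * d)) - 1 - RtoC (INR n * d)) * F_term mu q x n) by (rewrite RtoC_mult; ring).
  rewrite Cmod_mult.
  assert (HT := Cmod_Cexp_sub2 (RtoC (INR n * d))).
  rewrite Cmod_R in HT. change (Re (RtoC (INR n * d))) with (INR n * d)%R in HT.
  rewrite pow2_abs, Rpow_mult_distr in HT.
  assert (HF : (Rmax 1 (exp (INR n * d)) * Cmod (F_term mu q x n) <= m ^ n / INR (fact n))%R).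
  { assert (B := F_term_bound mu x n).
    assert (Hx : (((1 + Cmod (qpow mu)) * Cmod x) ^ n = m ^ n * exp (INR n * t))%R).
    { unfold x, m. rewrite Cexp_add, Cmod_mult, Cexp_RtoC, Cmod_R, Rabs_pos_eq by (left; apply exp_pos).
      rewrite <- pow_exp, <- Rpow_mult_distr. f_equal. ring. }
    rewrite Hx in B.
    assert (Hn := pos_INR n). assert (Hmn : (0 <= m ^ n / INR (fact n))%R)
      by (apply Rdiv_le_0_compat; [now apply pow_le|apply INR_fact_lt_0]).
    eapply Rle_trans; [apply Rmult_le_compat_l; [|exact B]|].
    { eapply Rle_trans; [|apply Rmax_l]. lra. }
    replace (Rmax 1 (exp (INR n * d)) * (m ^ n * exp (INR n * t) / INR (fact n)))%R
      with (m ^ n / INR (fact n) * (Rmax 1 (exp (INR n * d)) * exp (INR n * t)))%R by (unfold Rdiv; ring).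
    rewrite <- (Rmult_1_r (m ^ n / INR (fact n))) at 2. apply Rmult_le_compat_l; [exact Hmn|].
    unfold Rmax. destruct (Rle_dec 1 (exp (INR n * d))).
    - rewrite <- exp_plus, <- exp_0. apply exp_le. unfold d. nra.
    - rewrite Rmult_1_l, <- exp_0. apply exp_le. nra. }
  assert (H4 := INR_sq_le_4 n). assert (Hd := pow2_ge_0 d). assert (Hn2 := pow2_ge_0 (INR n)).
  assert (Hfn := Cmod_ge_0 (F_term mu q x n)).
  eapply Rle_trans; [apply Rmult_le_compat_r; [exact Hfn|exact HT]|].
  rewrite Rpow_mult_distr.
  replace (INR n ^ 2 * d ^ 2 / 2 * Rmax 1 (exp (INR n * d)) * Cmod (F_term mu q x n))%R
    with (d ^ 2 * (INR n ^ 2 / 2 * (Rmax 1 (exp (INR n * d)) * Cmod (F_term mu q x n))))%R by field.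
  apply Rmult_le_compat_l; [exact Hd|].
  replace (4 ^ n * m ^ n / INR (fact n))%R with (4 ^ n * (m ^ n / INR (fact n)))%R by (unfold Rdiv; ring).
  apply Rmult_le_compat; [lra| |lra|exact HF].
  apply Rmult_le_pos; [|exact Hfn]. eapply Rle_trans; [|apply Rmax_l]. lra.
Qed.

(** Replacing [x] by [q x] multiplies the [n]-th term by [q^(- mu - n)], and
    [(1 - q^(-n))] times the [n]-th coefficient is the previous one. *)
Lemma outer_sum_functional mu L : ~ nonpos_lattice kap mu -> in_strip L ->
  outer_sum q mu L - qpow mu * outer_sum q mu (L + RtoC (- h)) = outer_sum q (mu + 1) L.
Proof.
  intros Hmu HL.
  assert (H1 := is_Cseries_minus _ _ _ _ (outer_sum_correct q hq mu L Hmu HL)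
     (is_Cseries_scal (qpow mu) _ _ (outer_sum_correct q hq mu _ Hmu (strip_shift L (- h) HL)))).
  assert (H2 := outer_sum_correct q hq (mu + 1) L (nonpos_lattice_succ _ _ Hmu) HL).
  apply (is_Cseries_unique _ _ _ H1).
  assert (Eh : forall n, qpow mu * Cexp ((mu + RtoC (INR n)) * RtoC h) = / RtoC (q ^ n)).
  { intros n. rewrite qpow_exp, <- Cexp_add, <- Cexp_h, <- Cexp_opp. f_equal. ring. }
  assert (E : forall n, RtoC (al n) * inner_sum q mu n L - qpow mu * (RtoC (al n) * inner_sum q mu n (L + RtoC (- h)))
     = RtoC (al n) * (1 - / RtoC (q ^ n)) * inner_sum q mu n L).
  { intros n. rewrite inner_sum_period by auto. rewrite <- Eh. ring. }
  eapply is_Cseries_ext; [intros n; symmetry; apply E|].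
  replace (outer_sum q (mu + 1) L) with (RtoC (al 0) * (1 - / RtoC (q ^ 0)) * inner_sum q mu 0 L + outer_sum q (mu + 1) L).
  2: { simpl pow. field. }
  apply (is_Cseries_incr_1 (fun n => RtoC (al n) * (1 - / RtoC (q ^ n)) * inner_sum q mu n L)).
  eapply is_Cseries_ext; [|exact H2]. intros n; cbv beta.
  rewrite inner_sum_succ.
  assert (Hq1 := qpow_lt1 q hq n). assert (Hq0 := qpow_pos q hq (S n)).
  replace (RtoC (al n)) with (RtoC (al (S n)) * (1 - / RtoC (q ^ S n))); [reflexivity|].
  rewrite <- RtoC_inv by lra. rewrite <- RtoC_minus, <- RtoC_mult. f_equal.
  rewrite eul_coef_S by exact hq. field. split; lra.
Qed.

Lemma gamma_pow_quad s L t t' :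
  (Cmod (gamma_pow s (L + RtoC t') - gamma_pow s (L + RtoC t) + RtoC (t' - t) * (s * gamma_pow s (L + RtoC t)))%C
   <= (t' - t) ^ 2 * (Cmod s ^ 2 * (Cmod (gamma_pow s (L + RtoC t)) + Cmod (gamma_pow s (L + RtoC t')))))%R.
Proof.
  set (d := (t' - t)%R). set (g := gamma_pow s (L + RtoC t)).
  assert (E : gamma_pow s (L + RtoC t') = g * Cexp (- (s * RtoC d))).
  { unfold g, gamma_pow. rewrite <- Cmult_assoc, <- Cexp_add. f_equal. f_equal. unfold d. rewrite RtoC_minus. ring. }
  rewrite E. replace (g * Cexp (- (s * RtoC d)) - g + RtoC d * (s * g))
    with (g * (Cexp (- (s * RtoC d)) - 1 - (- (s * RtoC d)))) by ring.
  rewrite !Cmod_mult. assert (H := Cmod_Cexp_sub2 (- (s * RtoC d))).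
  rewrite Cmod_opp, Cmod_mult, Cmod_R, Rpow_mult_distr, pow2_abs in H.
  rewrite Cmod_Cexp. set (e := exp (Re (- (s * RtoC d)))) in *. assert (He : (0 < e)%R) by apply exp_pos.
  assert (Hmx : (Rmax 1 e <= 1 + e)%R) by (apply Rmax_lub; lra).
  assert (Hg := Cmod_ge_0 g). assert (Hsd : (0 <= Cmod s ^ 2 * d ^ 2)%R) by (apply Rmult_le_pos; apply pow2_ge_0).
  replace (d ^ 2 * (Cmod s ^ 2 * (Cmod g + Cmod g * e)))%R with (Cmod g * (Cmod s ^ 2 * d ^ 2 * (1 + e)))%R by ring.
  apply Rmult_le_compat_l; [exact Hg|]. eapply Rle_trans; [exact H|].
  apply Rle_trans with (Cmod s ^ 2 * d ^ 2 / 2 * (1 + e))%R.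
  - apply Rmult_le_compat_l; lra.
  - apply Rmult_le_compat_r; lra.
Qed.

(** [s Gamma s = Gamma (s + 1)] makes the derivative in [L] of each term
    [- e^L] times the corresponding term at [mu + 1]; the quadratic remainders
    are summed with [outer_dom]. *)
Lemma outer_sum_quad mu L : ~ nonpos_lattice kap mu -> in_strip L ->
  exists K, forall t t', (- h <= t <= 0)%R -> (- h <= t' <= 0)%R ->
  (Cmod (outer_sum q mu (L + RtoC t') - outer_sum q mu (L + RtoC t)
     + RtoC (t' - t) * (Cexp (L + RtoC t) * outer_sum q (mu + 1) (L + RtoC t)))%C
   <= K * (t' - t) ^ 2)%R.
Proof.
  intros Hmu HL. assert (Hh := qh_pos q hq).
  destruct (outer_dom q hq mu L Hmu HL) as [A [B [[sA HA] [HB [HA0 [HB0 H]]]]]].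
  exists (2 * (2 * Series B) * sA)%R. intros t t' Ht Ht'.
  set (d := (t' - t)%R).
  assert (Hmu1 := nonpos_lattice_succ _ _ Hmu).
  assert (HLt := strip_shift L t HL). assert (HLt' := strip_shift L t' HL).
  set (x := Cexp (L + RtoC t)).
  set (I' := fun n => inner_sum q mu n (L + RtoC t')). set (I := fun n => inner_sum q mu n (L + RtoC t)).
  set (J := fun n => inner_sum q (mu + 1) n (L + RtoC t)).
  set (tm := fun (n : nat) (k : Z) => (gamma_pow (gamma_pt kap mu n k) (L + RtoC t')
    + (-(1)) * gamma_pow (gamma_pt kap mu n k) (L + RtoC t)) + (RtoC d * x) * gamma_pow (gamma_pt kap (mu + 1) n k) (L + RtoC t)).
  assert (Htm : forall n, is_Cseries (zfold (tm n))
     ((I' n + (-(1)) * I n) + (RtoC d * x) * J n)).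
  { intros n.
    destruct (inner_sum_correct q hq mu _ Hmu HLt' n) as [_ H1]. destruct (inner_sum_correct q hq mu _ Hmu HLt n) as [_ H2].
    destruct (inner_sum_correct q hq _ _ Hmu1 HLt n) as [_ H3].
    eapply is_Cseries_ext.
    2: { apply is_Cseries_plus; [apply is_Cseries_plus; [exact H1|]|]; apply is_Cseries_scal; [exact H2|exact H3]. }
    intros k. unfold tm. rewrite zfold_plus, zfold_plus, !zfold_scal. reflexivity. }
  assert (Hbd : forall n, (Cmod (RtoC (al n) * ((I' n + (-(1)) * I n) + (RtoC d * x) * J n))%C <= 2 * (2 * Series B) * d ^ 2 * A n)%R).
  { intros n. assert (Ha := eul_coef_abs_pos q hq n).
    destruct (zfold_dom (tm n) (2 * d ^ 2 * (A n / Rabs (al n))) B) as [_ [X Y]]; [|exact HB|].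
    - intros k. unfold tm.
      assert (Er := gamma_pow_rec (gamma_pt kap mu n k) (L + RtoC t) (gamma_pt_neq kap mu n k Hmu)).
      rewrite <- gamma_pt_succ in Er. fold x in Er.
      replace (gamma_pow (gamma_pt kap mu n k) (L + RtoC t') + - (1) * gamma_pow (gamma_pt kap mu n k) (L + RtoC t)
         + RtoC d * x * gamma_pow (gamma_pt kap (mu + 1) n k) (L + RtoC t))
        with (gamma_pow (gamma_pt kap mu n k) (L + RtoC t') - gamma_pow (gamma_pt kap mu n k) (L + RtoC t)
         + RtoC d * (gamma_pt kap mu n k * gamma_pow (gamma_pt kap mu n k) (L + RtoC t))) by (rewrite Er; ring).
      eapply Rle_trans; [apply gamma_pow_quad|]. fold d.
      set (s := gamma_pt kap mu n k).
      assert (G1 := H n k t ltac:(apply Rabs_le; lra)). assert (G2 := H n k t' ltac:(apply Rabs_le; lra)).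
      fold s in G1, G2.
      set (g1 := Cmod (gamma_pow s (L + RtoC t))) in *. set (g2 := Cmod (gamma_pow s (L + RtoC t'))) in *.
      assert (Hg1 : (0 <= g1)%R) by apply Cmod_ge_0. assert (Hg2 : (0 <= g2)%R) by apply Cmod_ge_0.
      assert (Hs : (Cmod s ^ 2 <= (1 + Cmod s) ^ 2)%R) by (apply pow_incr; generalize (Cmod_ge_0 s); lra).
      assert (Hs0 := pow2_ge_0 (Cmod s)). assert (Hd0 := pow2_ge_0 d).
      apply (Rmult_le_reg_l (Rabs (al n))); [exact Ha|].
      replace (Rabs (al n) * (2 * d ^ 2 * (A n / Rabs (al n)) * B (Z.abs_nat k)))%R
        with (d ^ 2 * (2 * (A n * B (Z.abs_nat k))))%R by (field; lra).
      replace (Rabs (al n) * (d ^ 2 * (Cmod s ^ 2 * (g1 + g2))))%R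
        with (d ^ 2 * (Rabs (al n) * (Cmod s ^ 2 * (g1 + g2))))%R by ring.
      apply Rmult_le_compat_l; [exact Hd0|].
      apply Rle_trans with (Rabs (al n) * (g1 * (1 + Cmod s) ^ 2) + Rabs (al n) * (g2 * (1 + Cmod s) ^ 2))%R; [|lra].
      rewrite <- Rmult_plus_distr_l. apply Rmult_le_compat_l; [lra|]. nra.
    - rewrite (is_Cseries_unique _ _ _ X (Htm n)) in Y.
      rewrite Cmod_mult, Cmod_R.
      apply (Rmult_le_compat_l (Rabs (al n))) in Y; [|lra].
      eapply Rle_trans; [exact Y|]. right. field. lra. }
  set (S' := outer_sum q mu (L + RtoC t')). set (S0 := outer_sum q mu (L + RtoC t)).
  set (S1 := outer_sum q (mu + 1) (L + RtoC t)).
  assert (HS : is_Cseries (fun n => RtoC (al n) * ((I' n + (-(1)) * I n) + (RtoC d * x) * J n))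
     ((S' + (-(1)) * S0) + (RtoC d * x) * S1)).
  { eapply is_Cseries_ext.
    2: { apply is_Cseries_plus; [apply is_Cseries_plus; [apply (outer_sum_correct q hq mu _ Hmu HLt')|]|]; apply is_Cseries_scal;
           [apply (outer_sum_correct q hq mu _ Hmu HLt)|apply (outer_sum_correct q hq _ _ Hmu1 HLt)]. }
    intros n. unfold I', I, J. ring. }
  replace (S' - S0 + RtoC d * (x * S1))
    with ((S' + (-(1)) * S0) + (RtoC d * x) * S1) by ring.
  apply (is_Cseries_norm _ _ _ _ Hbd HS).
  replace (2 * (2 * Series B) * sA * d ^ 2)%R with ((2 * (2 * Series B) * d ^ 2) * sA)%R by ring.
  apply is_series_scalR, HA.
Qed.

(** * The identity: right half-plane and descent *)

(** [kappa (q^mu; q)_oo / (2 pi (q; q)_oo)], since [kappa / (2 pi) = 1 / h]. *)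
Definition prefactor (mu : C) : C := / RtoC h * (eul q (qpow mu / RtoC q) / eul q 1).

Definition identity (mu : C) : Prop :=
  forall L, in_strip L -> F mu q (Cexp L) = prefactor mu * outer_sum q mu L.

Lemma eul_1_neq_0 : eul q 1 <> 0.
Proof.
  destruct (is_Cseries_inv_eul q hq (RtoC q)) as [E [_ HE]].
  { rewrite Cmod_R, Rabs_pos_eq; lra. }
  replace (RtoC q / RtoC q) with (RtoC 1) in HE by (field; apply RtoC_q_neq_0).
  intros X. rewrite X, Cmult_0_r in HE. apply RtoC_inj in HE. lra.
Qed.

Lemma h_neq_0 : RtoC h <> 0.
Proof. apply RtoC_neq_0. generalize (qh_pos q hq); lra. Qed.

Lemma prefactor_rec mu : prefactor mu = (1 - qpow mu) * prefactor (mu + 1).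
Proof.
  unfold prefactor. rewrite (eul_rec q hq (qpow mu / RtoC q)), qpow_succ.
  assert (H1 := eul_1_neq_0). assert (H2 := h_neq_0). assert (H3 := RtoC_q_neq_0).
  replace (RtoC q * (qpow mu / RtoC q)) with (qpow mu) by (field; exact H3).
  replace (qpow mu * RtoC q / RtoC q) with (qpow mu) by (field; exact H3).
  field. auto.
Qed.

(** Let [D] be the difference of the two sides. By the functional equations and
    the identity at [mu + 1], [D x = q^mu D (q x)]; the derivative of [D] is a
    multiple of the difference at [mu + 1], so [D] is constant along the ray.
    Hence [(1 - q^mu) D = 0], and [q^mu] is not [1]. *)
Lemma identity_step mu : ~ nonpos_lattice kap mu -> identity (mu + 1) -> identity mu.
Proof.
  intros Hmu Hid L HL. assert (Hh := qh_pos q hq).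
  set (D := fun L => F mu q (Cexp L) - prefactor mu * outer_sum q mu L).
  assert (HL' := strip_shift L (- h) HL).
  assert (HqL : Cexp (L + RtoC (- h)) = RtoC q * Cexp L).
  { rewrite Cexp_add, Cmult_comm. f_equal. rewrite RtoC_opp.
    replace (- RtoC h) with (- (RtoC (INR 1) * RtoC h)) by (simpl INR; ring).
    rewrite Cexp_h, pow_1. reflexivity. }
  assert (H1 : D L = qpow mu * D (L + RtoC (- h))).
  { unfold D. rewrite HqL.
    assert (E1 := F_functional mu (Cexp L)). assert (E2 := outer_sum_functional mu L Hmu HL).
    rewrite (Hid L HL), <- E2 in E1.
    replace (F mu q (Cexp L)) with
      ((F mu q (Cexp L) - qpow mu * F mu q (RtoC q * Cexp L)) + qpow mu * F mu q (RtoC q * Cexp L)) by ring.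
    rewrite E1, (prefactor_rec mu). ring. }
  assert (H2 : D (L + RtoC (- h)) = D L).
  { destruct (F_quad mu L) as [K1 HK1]. destruct (outer_sum_quad mu L Hmu HL) as [K2 HK2].
    assert (X := quadratic_increments_const (fun r => D (L + RtoC (- (h * r))))
                 ((K1 + Cmod (prefactor mu) * K2) * h ^ 2)%R).
    cbv beta in X. rewrite Rmult_1_r, Rmult_0_r, Ropp_0 in X.
    replace (L + RtoC 0) with L in X by ring. apply X. clear X.
    intros r r' Hr Hr'. set (t := (- (h * r))%R). set (t' := (- (h * r'))%R).
    assert (Ht : (- h <= t <= 0)%R) by (unfold t; nra). assert (Ht' : (- h <= t' <= 0)%R) by (unfold t'; nra).
    specialize (HK1 t t' ltac:(lra) ltac:(lra)). specialize (HK2 t t' Ht Ht').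
    rewrite (Hid _ (strip_shift L t HL)) in HK1.
    replace (((K1 + Cmod (prefactor mu) * K2) * h ^ 2) * (r' - r) ^ 2)%R
      with (K1 * (t' - t) ^ 2 + Cmod (prefactor mu) * (K2 * (t' - t) ^ 2))%R by (unfold t, t'; ring).
    match type of HK1 with (Cmod ?a <= _)%R => match type of HK2 with (Cmod ?b <= _)%R =>
      replace (D (L + RtoC t') - D (L + RtoC t)) with (a + (- prefactor mu) * b) end end.
    2: { unfold D. rewrite (prefactor_rec mu). ring. }
    eapply Rle_trans; [apply Cmod_triangle|]. rewrite (Cmod_mult (- prefactor mu)), Cmod_opp.
    apply Rplus_le_compat; [exact HK1|]. apply Rmult_le_compat_l; [apply Cmod_ge_0|exact HK2]. }
  assert (H3 : D L = 0).
  { rewrite H2 in H1.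
    assert (E : (1 - qpow mu) * D L = 0).
    { replace ((1 - qpow mu) * D L) with (D L - qpow mu * D L) by ring. rewrite <- H1. ring. }
    assert (Hn : 1 - qpow mu <> 0).
    { intros X. apply (nonpos_lattice_qpow mu Hmu).
      replace (qpow mu) with (1 - (1 - qpow mu)) by ring. rewrite X. ring. }
    replace (D L) with (/ (1 - qpow mu) * ((1 - qpow mu) * D L)) by (field; exact Hn).
    rewrite E. ring. }
  unfold D in H3.
  replace (F mu q (Cexp L)) with (F mu q (Cexp L) - prefactor mu * outer_sum q mu L + prefactor mu * outer_sum q mu L) by ring.
  rewrite H3. ring.
Qed.

Lemma eul_qpow m : eul q 1 = RtoC (qp q m) * eul q (RtoC (q ^ m)).
Proof.
  induction m as [|m IH].
  - simpl. ring.
  - rewrite IH, (eul_rec q hq (RtoC (q ^ m))). cbn [qp].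
    rewrite <- RtoC_mult. change (q * q ^ m)%R with (q ^ S m)%R. rewrite RtoC_mult, RtoC_minus. ring.
Qed.

(** The factor [1 - q^0] occurs in the product. *)
Lemma eul_qpow_neg m : eul q (RtoC (/ q ^ S m)) = 0.
Proof.
  induction m as [|m IH].
  - rewrite eul_rec by exact hq. rewrite <- RtoC_mult.
    replace (q * / q ^ 1)%R with 1%R by (field; lra). ring.
  - rewrite eul_rec by exact hq. rewrite <- (RtoC_mult q (/ q ^ S (S m))).
    assert (H := qpow_pos q hq (S m)).
    replace (q * / q ^ S (S m))%R with (/ q ^ S m)%R.
    + rewrite IH. ring.
    + change (q ^ S (S m))%R with (q * q ^ S m)%R. field. lra.
Qed.

(** [(q^mu; q)_n] is [(q^mu; q)_oo / (q^(mu+n); q)_oo]; expanding the reciprocal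
    in powers of [q^(mu+n)] and summing over [n] first leaves exponentials. *)
Lemma F_exp_series mu L : (0 < Re mu)%R -> exists V : C,
  is_Cseries (fun k => / RtoC (qp q k) * Phi mu L (- (INR k * h))%R) V /\
  F mu q (Cexp L) = eul q (qpow mu / RtoC q) * V.
Proof.
  intros Hmu. assert (Hh := qh_pos q hq).
  set (a := qpow mu). set (x := Cexp L).
  assert (Ha : (Cmod a < 1)%R).
  { unfold a. rewrite qpow_exp, Cmod_Cexp, <- exp_0. apply exp_increasing.
    destruct mu; simpl in *. nra. }
  assert (Ha0 := Cmod_ge_0 a).
  set (an := fun n => RtoC (q ^ n) * a).
  assert (Han : forall n, (Cmod (an n) <= Cmod a)%R).
  { intros n. unfold an. rewrite Cmod_mult, Cmod_R, Rabs_pos_eq by (left; now apply qpow_pos).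
    generalize (qpow_le1 q hq n) (qpow_pos q hq n). intros; nra. }
  set (cf := fun n : nat => (- x) ^ n / RtoC (INR (fact n))).
  assert (Hf : forall n, RtoC (INR (fact n)) <> 0) by (intros; apply RtoC_neq_0, INR_fact_neq_0).
  assert (Hqp : forall k, RtoC (qp q k) <> 0).
  { intros k. apply RtoC_neq_0. generalize (qp_pos q hq k); lra. }
  assert (Hph : forall k, Phi mu L (- (INR k * h))%R = a ^ k * Cexp (RtoC (q ^ k) * (- x))).
  { intros k. unfold Phi, a, x. rewrite qpow_exp, Cexp_pow, <- Cexp_h, <- Cexp_add. f_equal.
    rewrite Cexp_add, RtoC_opp, RtoC_mult. ring. }
  destruct (double_series_swap
     (fun n k => cf n * (/ RtoC (qp q k) * an n ^ k))
     (fun n => Cmod x ^ n / INR (fact n))%R (fun k => Cmod a ^ k / qp q k)%R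
     (fun n => cf n * CSeries (fun k => / RtoC (qp q k) * an n ^ k))
     (fun k => / RtoC (qp q k) * Phi mu L (- (INR k * h))%R)) as [V [HV1 HV2]].
  - intros n. apply Rdiv_le_0_compat; [apply pow_le, Cmod_ge_0|apply INR_fact_lt_0].
  - intros k. apply Rdiv_le_0_compat; [now apply pow_le|now apply qp_pos].
  - intros n k. unfold cf. rewrite !Cmod_mult, Cmod_div, Cmod_inv, !Cmod_pow, !Cmod_R, Cmod_opp by auto.
    rewrite (Rabs_pos_eq (INR (fact n))) by apply pos_INR.
    rewrite (Rabs_pos_eq (qp q k)) by (left; now apply qp_pos).
    apply Rmult_le_compat_l; [apply Rdiv_le_0_compat; [apply pow_le, Cmod_ge_0|apply INR_fact_lt_0]|].
    unfold Rdiv. rewrite Rmult_comm. apply Rmult_le_compat_r.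
    + left. apply Rinv_0_lt_compat. now apply qp_pos.
    + apply pow_incr. split; [apply Cmod_ge_0|apply Han].
  - eexists; apply is_series_exp.
  - apply ex_series_inv_qp; auto.
  - intros n. apply is_Cseries_scal.
    destruct (is_Cseries_inv_eul q hq (an n)) as [E [HE _]]; [specialize (Han n); lra|].
    rewrite (CSeries_unique _ _ HE). exact HE.
  - intros k. rewrite Hph.
    eapply is_Cseries_ext.
    2: { apply is_Cseries_scal, is_Cseries_scal. apply is_Cseries_Cexp. }
    intros n. cbv beta. unfold cf, an. rewrite !Cpow_mult_l.
    replace (RtoC (q ^ n) ^ k) with (RtoC (q ^ k) ^ n).
    + field. split; auto.
    + rewrite <- !RtoC_pow, <- !pow_mult, Nat.mul_comm. reflexivity.
  - exists V. split; [exact HV2|].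
    apply (is_Cseries_unique _ _ _ (F_correct mu x)).
    eapply is_Cseries_ext; [|apply is_Cseries_scal, HV1]. intros n. cbv beta. unfold F_term, cf. fold a.
    destruct (is_Cseries_inv_eul q hq (an n)) as [E [HE1 HE2]]; [specialize (Han n); lra|].
    rewrite (CSeries_unique _ _ HE1).
    rewrite (eul_qpoch q hq a n). unfold an in HE2.
    replace (RtoC (q ^ n) * a / RtoC q) with (RtoC (q ^ n) * (a / RtoC q)) in HE2 by (field; apply RtoC_q_neq_0).
    set (e := eul q (RtoC (q ^ n) * (a / RtoC q))) in *.
    replace (qpoch a (RtoC q) n * e * ((- x) ^ n / RtoC (INR (fact n)) * E))
      with (qpoch a (RtoC q) n * ((- x) ^ n / RtoC (INR (fact n))) * (E * e)) by ring.
    rewrite HE2. field. auto.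
Qed.

(** Poisson summation turns each inner series into a sum over [x q^(-k)], [k] in
    [Z]. Summing over [n] first produces [(q^(1-k); q)_oo], which vanishes for
    [k > 0] and is [(q; q)_oo / (q; q)_(-k)] for [k <= 0]. *)
Lemma outer_sum_exp_series mu L V : (0 < Re mu)%R -> in_strip L ->
  is_Cseries (fun k => / RtoC (qp q k) * Phi mu L (- (INR k * h))%R) V ->
  outer_sum q mu L = RtoC h * eul q 1 * V.
Proof.
  intros Hmu HL HV. assert (Hh := qh_pos q hq). assert (Hgood := nonpos_lattice_pos kap mu Hmu).
  destruct (nat_above (Re mu + 1)) as [p Hp].
  destruct (Rmin1_pos (Re mu) Hmu) as [Ha [Ha1 Has]]. set (a := Rmin 1 (Re mu)) in *.
  assert (Hc := rate_pos L HL). set (r := (1 + / rate L)%R).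
  assert (Hr : (0 < r)%R) by (unfold r; generalize (Rinv_0_lt_compat _ Hc); lra).
  set (Ph := fun (n : nat) (k : Z) => RtoC h * Phi (mu + RtoC (INR n)) L (IZR k * h)%R).
  assert (HPhi : forall n y, Phi (mu + RtoC (INR n)) L y = Cexp (RtoC y) ^ n * Phi mu L y).
  { intros n y. rewrite Phi_shift, Cexp_pow. reflexivity. }
  assert (Hb : forall n k, (Cmod (RtoC (al n) * Ph n k)%C <=
     (h * (2 * r ^ p) * (Rabs (al n) * r ^ n * INR (fact (n + p)))) * exp (- (a * h)) ^ Z.abs_nat k)%R).
  { intros n k. unfold Ph. rewrite !Cmod_mult, !Cmod_R, Cmod_Phi, (Rabs_pos_eq h) by lra.
    assert (HRe : Re (mu + RtoC (INR n)) = (Re mu + INR n)%R) by reflexivity. rewrite HRe.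
    assert (Hn := pos_INR n).
    assert (G := gamma_integrand_bound (Re mu + INR n) (rate L) a (n + p) (IZR k * h) Hc Ha1 ltac:(lra)
                   ltac:(rewrite plus_INR; lra)).
    assert (HF := decay_const_le_pow (rate L) n p Hc). fold r in HF.
    assert (Ee : exp (- (a * Rabs (IZR k * h))) = (exp (- (a * h)) ^ Z.abs_nat k)%R).
    { rewrite pow_exp, INR_abs_nat, Rabs_mult, (Rabs_pos_eq h) by lra. f_equal. ring. }
    rewrite Ee in G. set (e := (exp (- (a * h)) ^ Z.abs_nat k)%R) in *.
    assert (He : (0 <= e)%R) by (apply pow_le; left; apply exp_pos).
    replace (h * (2 * r ^ p) * (Rabs (al n) * r ^ n * INR (fact (n + p))) * e)%R
      with (Rabs (al n) * (h * (2 * r ^ p * (r ^ n * INR (fact (n + p))) * e)))%R by ring.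
    apply Rmult_le_compat_l; [apply Rabs_pos|]. apply Rmult_le_compat_l; [lra|].
    eapply Rle_trans; [exact G|]. now apply Rmult_le_compat_r. }
  set (A := fun n => (2 * (h * (2 * r ^ p) * (Rabs (al n) * r ^ n * INR (fact (n + p)))))%R).
  set (B := fun k => (exp (- (a * h)) ^ k)%R).
  destruct (double_series_swap (fun n k => RtoC (al n) * zfold (Ph n) k) A B
     (fun n => RtoC (al n) * inner_sum q mu n L)
     (fun k => RtoC h * eul q 1 * (/ RtoC (qp q k) * Phi mu L (- (INR k * h))%R))) as [S [HS1 HS2]].
  - intros n. unfold A. apply Rmult_le_pos; [lra|]. apply Rmult_le_pos.
    + apply Rmult_le_pos; [lra|]. apply Rmult_le_pos; [lra|]. apply pow_le; lra.
    + apply Rmult_le_pos; [|left; apply INR_fact_lt_0]. apply Rmult_le_pos; [apply Rabs_pos|apply pow_le; lra].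
  - intros k. apply pow_le. left; apply exp_pos.
  - intros n k. rewrite <- zfold_scal. unfold A, B. rewrite Rmult_assoc.
    apply (Cmod_zfold (fun j => RtoC (al n) * Ph n j)
       (fun k => h * (2 * r ^ p) * (Rabs (al n) * r ^ n * INR (fact (n + p))) * exp (- (a * h)) ^ k)%R).
    + generalize (Hb n (Z.of_nat k)). rewrite Zabs_nat_pos. auto.
    + generalize (Hb n (- Z.of_nat k)%Z). rewrite Zabs_nat_neg. auto.
  - unfold A. apply ex_series_scalR. apply ex_series_scalR.
    now apply ex_series_eul_coef_fact.
  - apply ex_series_geom. apply exp_opp_geom. nra.
  - intros n. apply is_Cseries_scal.
    assert (Hn := pos_INR n).
    apply (poisson_gamma (mu + RtoC (INR n)) L h); [exact Hh| |exact HL|].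
    + destruct mu; simpl in *; lra.
    + apply (inner_sum_correct q hq mu L Hgood HL n).
  - assert (HE : forall j : Z, is_Cseries (fun n => RtoC (al n) * Ph n j)
        (RtoC h * Phi mu L (IZR j * h)%R * eul q (Cexp (RtoC (IZR j * h))))).
    { intros j. eapply is_Cseries_ext; [|apply is_Cseries_scal, is_Cseries_eul, hq]. intros n. cbv beta.
      unfold Ph. rewrite HPhi. ring. }
    assert (Hneg : forall k, (IZR (- Z.of_nat k) * h)%R = (- (INR k * h))%R).
    { intros k. rewrite opp_IZR, <- INR_IZR_INZ. ring. }
    assert (HEn : forall k, is_Cseries (fun n => RtoC (al n) * Ph n (- Z.of_nat k)%Z)
        (RtoC h * eul q 1 * (/ RtoC (qp q k) * Phi mu L (- (INR k * h))%R))).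
    { intros k. specialize (HE (- Z.of_nat k)%Z). rewrite Hneg in HE.
      rewrite Cexp_RtoC, exp_qh in HE by exact hq.
      replace (RtoC h * eul q 1 * (/ RtoC (qp q k) * Phi mu L (- (INR k * h))%R))
        with (RtoC h * Phi mu L (- (INR k * h))%R * eul q (RtoC (q ^ k))); [exact HE|].
      rewrite (eul_qpow k). field. apply RtoC_neq_0. generalize (qp_pos q hq k); lra. }
    intros k. destruct k as [|k].
    + refine (is_Cseries_ext _ _ _ _ (HEn O)). intros n. reflexivity.
    + unfold zfold.
      assert (H0 := HE (Z.of_nat (S k))).
      assert (Ez : eul q (Cexp (RtoC (IZR (Z.of_nat (S k)) * h))) = 0).
      { rewrite <- (eul_qpow_neg k). f_equal. rewrite Cexp_RtoC. f_equal.
        rewrite <- INR_IZR_INZ. rewrite <- (exp_qh q hq), <- exp_Ropp. f_equal. ring. }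
      rewrite Ez, Cmult_0_r in H0.
      eapply is_Cseries_ext; [|].
      2: { rewrite <- Cplus_0_l. apply is_Cseries_plus; [exact H0|exact (HEn (S k))]. }
      intros n; cbv beta. ring.
  - assert (E1 := is_Cseries_unique _ _ _ HS1 (outer_sum_correct q hq mu L Hgood HL)).
    assert (E2 := is_Cseries_unique _ _ _ HS2 (is_Cseries_scal (RtoC h * eul q 1) _ _ HV)).
    rewrite <- E1. exact E2.
Qed.

Lemma identity_right mu : (0 < Re mu)%R -> identity mu.
Proof.
  intros Hmu L HL. destruct (F_exp_series mu L Hmu) as [V [HV HF]].
  rewrite HF, (outer_sum_exp_series mu L V Hmu HL HV). unfold prefactor.
  assert (H1 := eul_1_neq_0). assert (H2 := h_neq_0). field. auto.
Qed.

Lemma identity_all mu : ~ nonpos_lattice kap mu -> identity mu.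
Proof.
  intros Hmu. destruct (nat_above (1 - Re mu)) as [N HN].
  revert mu Hmu HN. induction N as [|N IH]; intros mu Hmu HN.
  - apply identity_right. simpl in HN. lra.
  - apply identity_step; [exact Hmu|]. apply IH.
    + now apply nonpos_lattice_succ.
    + rewrite S_INR in HN. destruct mu; simpl in *. lra.
Qed.

End Main.

Theorem theorem1p2 (q : R) (hq : (0 < q < 1)%R) (mu : C) :
  let kappa := (- (2 * PI / ln q))%R in
  ~ nonpos_lattice kappa mu ->
  forall x : C, (0 < Re x)%R ->
  let xstar := Cpower x (- RtoC kappa * Ci) in
  let outer_term (n : nat) :=
    RtoC (q ^ (n * (n + 1) / 2)) / qpoch (RtoC q) (RtoC q) n
    * Psi (mu + RtoC (INR n)) (kappa * PI / 2) xstar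
    * (- (1 / x)) ^ n in
  xstar = Cexp (RtoC (2 * PI) * Ci * Clog x / RtoC (ln q)) /\
  ex_Cseries (F_term mu q x) /\
  (forall n : nat,
     ex_Zseries (Psi_term (mu + RtoC (INR n)) (kappa * PI / 2) xstar)) /\
  ex_Cseries outer_term /\
  F mu q x =
    RtoC kappa * qpoch_inf (Cpower (RtoC q) mu) (RtoC q)
    / (RtoC (2 * PI) * qpoch_inf (RtoC q) (RtoC q))
    * Cpower (1 / x) mu * CSeries outer_term.
Proof.
  intros kappa Hmu x Hx xstar outer_term.
  assert (Hh := qh_pos q hq).
  assert (Hln : (ln q <> 0)%R) by (unfold qh in Hh; lra).
  assert (Hk : kappa = qkap q) by (unfold kappa, qkap, qh; field; exact Hln).
  rewrite Hk in Hmu.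
  set (L := Clog x). assert (HL : in_strip L) by apply Im_Clog_lt.
  assert (HxL : Cexp L = x) by now apply Cexp_Clog.
  assert (HP : forall n k, Cexp ((mu + RtoC (INR n)) * L) * gamma_pow (gamma_pt (qkap q) mu n k) L
     = Psi_term (mu + RtoC (INR n)) (kappa * PI / 2) xstar k).
  { intros n k. unfold Psi_term, xstar, Cpower. rewrite Cexp_zpow. fold L. rewrite Hk.
    replace (2 * (qkap q * PI / 2) * IZR k / PI)%R with (qkap q * IZR k)%R by (field; apply PI_neq0).
    fold (gamma_pt (qkap q) mu n k). unfold gamma_pow.
    replace (RtoC (IZR k) * (- RtoC (qkap q) * Ci * L))
      with ((mu + RtoC (INR n)) * L + - (gamma_pt (qkap q) mu n k * L))
      by (unfold gamma_pt; rewrite RtoC_mult; ring).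
    rewrite Cexp_add. ring. }
  assert (Hout : forall n, Cexp (mu * L) * (RtoC (eul_coef q n) * inner_sum q mu n L) = outer_term n).
  { intros n. unfold outer_term, Psi.
    rewrite <- (ZSeries_ext _ _ (HP n)), ZSeries_scal by exact (proj1 (inner_sum_correct q hq mu L Hmu HL n)).
    fold (inner_sum q mu n L).
    assert (Hq := qp_pos q hq n).
    assert (Ex : (- (1 / x)) ^ n = RtoC ((-1) ^ n) * Cexp (- (RtoC (INR n) * L))).
    { replace (- (1 / x)) with (RtoC (-1) * Cexp (- L)).
      - rewrite Cpow_mult_l, <- RtoC_pow, Cexp_pow. f_equal. f_equal. ring.
      - rewrite Cexp_opp, HxL. replace (RtoC (-1)) with (- (1)) by (apply Ceq; simpl; ring).
        unfold Cdiv. ring. }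
    rewrite Ex, qpoch_qp. unfold eul_coef. rewrite RtoC_div, RtoC_mult by lra.
    replace ((mu + RtoC (INR n)) * L) with (mu * L + RtoC (INR n) * L) by ring.
    rewrite (Cexp_add (mu * L)), Cexp_opp.
    field. split; [apply Cexp_neq_0|apply RtoC_neq_0; lra]. }
  assert (HR := is_Cseries_scal (Cexp (mu * L)) _ _ (outer_sum_correct q hq mu L Hmu HL)).
  assert (HO : is_Cseries outer_term (Cexp (mu * L) * outer_sum q mu L)).
  { eapply is_Cseries_ext; [|exact HR]. exact Hout. }
  split; [|split; [|split; [|split]]].
  - unfold xstar, Cpower. fold L. f_equal. unfold kappa.
    rewrite RtoC_opp, RtoC_div by exact Hln. field. now apply RtoC_neq_0.
  - eexists; apply (F_correct q hq mu x).
  - intros n. apply (ex_Zseries_ext _ _ (HP n)), ex_Zseries_scal, (proj1 (inner_sum_correct q hq mu L Hmu HL n)).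
  - eexists; exact HO.
  - rewrite (CSeries_unique _ _ HO), !qpoch_inf_eul by exact hq.
    assert (Hid := identity_all q hq mu Hmu L HL). rewrite HxL in Hid. rewrite Hid.
    unfold prefactor, Cpower at 3. rewrite Clog_inv by exact Hx. fold L.
    assert (H1 := eul_1_neq_0 q hq). assert (H2 := h_neq_0 q hq). assert (H3 := RtoC_q_neq_0 q hq).
    replace (RtoC q / RtoC q) with (RtoC 1) by (field; exact H3).
    replace (mu * - L) with (- (mu * L)) by ring. rewrite Cexp_opp.
    assert (HPI := PI_RGT_0).
    assert (H4 : RtoC (2 * PI) <> 0) by (apply RtoC_neq_0; lra).
    rewrite Hk. unfold qkap. rewrite RtoC_div by lra.
    field. repeat split; auto. apply Cexp_neq_0.
Qed.
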